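(* Let $f:[0,1]\setminus\{c\}\to[0,1]$ be a $C^2$ non-flat contracting Lorenz map without periodic attractors. Let $\mathcal R$ be the set of renormalization intervals of $f$ and, for $J\in\mathcal R$, let $K_J$ be the nice trapping region associated to $J$. If $f$ is $\infty$-renormalizable, then there is a compact minimal set $\Lambda$, with $c\in\Lambda\subset\bigcap_{J\in\mathcal R}K_J$, such that $\omega_f(x)=\Lambda$ for every $x\in[0,1]$ with $c\in\omega_f(x)$.
   Context: Lorenz maps. A Lorenz map is a $C^2$ map $f:[0,1]\setminus\{c\}\to[0,1]$, $0<c<1$, with $f(0)=0$, $f(1)=1$ and $f'(x)>0$ for all $x\in[0,1]\setminus\{c\}$. It is contracting if $\lim_{x\to c}f'(x)=0$ and there is no open interval $I$ and $n\ge1$ with $f^n|_I\equiv\mathrm{id}$. A contracting Lorenz map is non-flat if there are $\alpha,\beta>1$, $a,b\in[0,1]$ and $C^2$ orientation preserving diffeomorphisms $\phi_0:[0,c]\to[0,a^{1/\alpha}]$, $\phi_1:[c,1]\to[0,b^{1/\beta}]$ with $f(x)=a-(\phi_0(c-x))^\alpha$ for $x<c$ and $f(x)=1-b+(\phi_1(x))^\beta$ for $x>c$. Orbits. $f^n(c_\pm)=\lim_{\epsilon\downarrow0}f^n(c\pm\epsilon)$. If $x\in\{f(c_-),f(c_+)\}$ put $f^{-1}(x)=\{c\}\cup\{y: f(y)=x\}$, $f^{-1}(X)=\bigcup_{x\in X}f^{-1}(x)$, and $f^{-n}$ is defined inductively; $\mathcal O_f^-(x)=\bigcup_{n\ge0}f^{-n}(x)$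 with $f^0(x)=x$. For $x\notin\mathcal O_f^-(c)$, $\mathcal O_f^+(x)=\{f^j(x):j\ge0\}$. If $f^p(c_-)=c$ for some $p\ge1$, take $p$ minimal and set $\mathcal O_f^+(c_-)=\{f^j(c_-):1\le j\le p\}$; otherwise $\mathcal O_f^+(c_-)=\{f^j(c_-):j\ge0\}$; similarly for $c_+$. For $x\in\mathcal O_f^-(c)$, $\mathcal O_f^+(x)=\{x,f(x),\dots,f^{m-1}(x),c\}\cup\mathcal O_f^+(c_-)\cup\mathcal O_f^+(c_+)$, $m$ minimal with $f^m(x)=c$. $\omega_f(x)$ is the set of accumulation points of the positive orbit of $x$, for $x\in[0,c)\cup\{c_-,c_+\}\cup(c,1]$ (in the usual sense of limits along times tending to infinity). Periodic attractors. For a set $\Lambda$, $\beta(\Lambda)=\{x:\omega_f(x)\subset\Lambda\}$. The orbit of a periodic point $p$ is an attracting periodic orbit if for some $\epsilon>0$, $(p,p+\epsilon)$ or $(p-\epsilon,p)$ is contained in $\beta(\mathcal O_f^+(p))$. A periodic attractor is a finite set $\Lambda$ such that $\{x:\omega_f(x)=\Lambda\}$ has non-empty interior; it is either an attracting periodic orbit or a super-attractor, i.e. a finite set $\{p_1,\dots,p_n,c\}$ with $f(p_i)=p_{i+1}$ for $1\le i<n$, $f(p_n)=c$, and $f(c_+)=p_1$ or $f(c_-)=p_1$. Renormalization. The first return map to an interval $T$ is $x\mapsto f^{R(x)}(x)$, $R(x)=\min\{j\ge1:f^j(x)\in T\}$, defined on the points of $T$ that return to $T$. A renormalization interval of $f$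 is an open interval $J=(a,b)\ni c$ such that the first return map to $[a,b]$ is conjugated to a Lorenz map; then $a,b$ are periodic and $f^{\mathrm{period}(a)}([a,c))\subset[a,b]\supset f^{\mathrm{period}(b)}((c,b])$. The renormalization cycle of $J$ is $U_J=\bigcup_{i=0}^{\mathrm{period}(a)}f^i((a,c))\cup\bigcup_{i=0}^{\mathrm{period}(b)}f^i((c,b))$. Let $\Lambda_J=\{x\in[0,1]:\mathcal O_f^+(x)\cap J=\emptyset\}$; a gap of $\Lambda_J$ is a connected component of $[0,1]\setminus\Lambda_J$. The nice trapping region $K_J$ associated to $J$ is the union of those gaps of $\Lambda_J$ each of which contains one of the intervals of the renormalization cycle. $f$ is $\infty$-renormalizable if it has infinitely many different renormalization intervals. *)

(* Defs.v *)
From mathcomp Require Import all_boot all_order all_algebra.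
From mathcomp Require Import all_classical all_reals all_analysis.

Set Implicit Arguments.
Unset Strict Implicit.
Unset Printing Implicit Defensive.

Import Order.TTheory GRing.Theory Num.Theory.
Import numFieldNormedType.Exports.

Local Open Scope classical_set_scope.
Local Open Scope ring_scope.

(** * Smoothness on a subset of the line *)

(* Derivatives are taken relative to D, hence are one-sided at endpoints
   belonging to D; the sets D used below have no isolated point. *)
Definition derivable_on (R : realType) (D : set R) (f : R -> R) : Prop :=
  forall x : R, D x -> cvg ((f y - f x) / (y - x) @[y --> within D x^']).

Definition derive_on (R : realType) (D : set R) (f : R -> R) (x : R) : R :=
  lim ((f y - f x) / (y - x) @[y --> within D x^']).

Definition C2_on (R : realType) (D : set R) (f : R -> R) : Prop :=
  [/\ derivable_on D f, derivable_on D (derive_on D f)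
    & {within D, continuous (derive_on D (derive_on D f))}].

Definition C2_diffeo_op (R : realType) (A B : set R) (phi : R -> R) : Prop :=
  [/\ set_bij A B phi, C2_on A phi, {in A &, {homo phi : x y / x < y}}
    & exists psi : R -> R, {in A, cancel phi psi} /\ C2_on B psi].

Definition homeomorphism_on (R : realType) (A B : set R) (h : R -> R) : Prop :=
  [/\ set_bij A B h, {within A, continuous h}
    & exists k : R -> R, {in A, cancel h k} /\ {within B, continuous k}].

(** * Lorenz maps *)

(* A Lorenz map is encoded by a total function f : R -> R of which only the
   values on [lorenz_dom c] are meaningful: nothing below depends on f c or on
   the values of f outside [0, 1]. *)
Definition lorenz_dom (R : realType) (c : R) : set R := `[0, 1] `\ c.

Definition lorenz_map (R : realType) (c : R) (f : R -> R) : Prop :=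
  [/\ 0 < c < 1,
      C2_on (lorenz_dom c) f,
      forall x : R, lorenz_dom c x -> f x \in `[0, 1],
      f 0 = 0 /\ f 1 = 1
    & forall x : R, lorenz_dom c x -> 0 < derive_on (lorenz_dom c) f x].

(* The domain of the partial map f^n. *)
Definition iter_dom (R : realType) (c : R) (f : R -> R) (n : nat) : set R :=
  [set x : R | x \in `[0, 1] /\ forall j, (j < n)%N -> iter j f x <> c].

Definition contracting (R : realType) (c : R) (f : R -> R) : Prop :=
  derive_on (lorenz_dom c) f x @[x --> c^'] --> 0 /\
  ~ exists (u v : R) (n : nat),
      [/\ u < v, `]u, v[ `<=` iter_dom c f n, (0 < n)%N
        & forall x : R, x \in `]u, v[ -> iter n f x = x].

Definition nonflat (R : realType) (c : R) (f : R -> R) : Prop :=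
  exists (alpha beta a b : R) (phi0 phi1 : R -> R),
    [/\ 1 < alpha /\ 1 < beta,
        a \in `[0, 1] /\ b \in `[0, 1],
        C2_diffeo_op `[0, c] `[0, a `^ alpha^-1] phi0,
        C2_diffeo_op `[c, 1] `[0, b `^ beta^-1] phi1
      & (forall x : R, x \in `[0, c[ -> f x = a - phi0 (c - x) `^ alpha) /\
        (forall x : R, x \in `]c, 1] -> f x = 1 - b + phi1 x `^ beta)].

(** * Orbits *)

(* f^n(c_-) and f^n(c_+); for n = 0 both are c. *)
Definition iterL (R : realType) (c : R) (f : R -> R) (n : nat) : R :=
  lim (iter n f x @[x --> c^'-]).

Definition iterR (R : realType) (c : R) (f : R -> R) (n : nat) : R :=
  lim (iter n f x @[x --> c^'+]).

(* f^{-1}(X), with c added whenever X contains f(c_-) or f(c_+). *)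
Definition preim1 (R : realType) (c : R) (f : R -> R) (X : set R) : set R :=
  [set y | lorenz_dom c y /\ X (f y)] `|`
  [set y | y = c /\ (X (iterL c f 1) \/ X (iterR c f 1))].

Definition backward_orbit (R : realType) (c : R) (f : R -> R) (x : R) : set R :=
  \bigcup_n iter n (preim1 c f) [set x].

(* O^+(c_-) when u n = f^n(c_-), and O^+(c_+) when u n = f^n(c_+). *)
Definition side_orbit (R : realType) (c : R) (u : nat -> R) : set R :=
  [set y | (exists p, [/\ (0 < p)%N, u p = c,
                          forall j, (0 < j < p)%N -> u j <> c
                        & exists2 j, (0 < j <= p)%N & y = u j])
        \/ ((forall p, (0 < p)%N -> u p <> c) /\ exists j, y = u j)].

Definition forward_orbit (R : realType) (c : R) (f : R -> R) (x : R) : set R :=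
  if x \in backward_orbit c f c then
    [set y | exists m, [/\ iter m f x = c,
                           forall j, (j < m)%N -> iter j f x <> c
                         & exists2 j, (j <= m)%N & y = iter j f x]]
    `|` side_orbit c (iterL c f) `|` side_orbit c (iterR c f)
  else range (fun j => iter j f x).

(* The points of [0, c) \cup {c_-, c_+} \cup (c, 1]. *)
Variant split_point (R : realType) : Type :=
  | Regular of R
  | CritL
  | CritR.
Arguments CritL {R}.
Arguments CritR {R}.

Definition split_dom (R : realType) (c : R) (x : split_point R) : Prop :=
  if x is Regular y then lorenz_dom c y else True.

(* The positive orbit of a regular preimage of c continues along both one-sided
   critical orbits after reaching c. *)
Definition omega (R : realType) (c : R) (f : R -> R) (x : split_point R)
    : set R :=
  match x with
  | Regular y =>
      if y \in backward_orbit c f c then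
        cluster (iterL c f n @[n --> \oo]) `|` cluster (iterR c f n @[n --> \oo])
      else cluster (iter n f y @[n --> \oo])
  | CritL => cluster (iterL c f n @[n --> \oo])
  | CritR => cluster (iterR c f n @[n --> \oo])
  end.

Definition periodic_attractor (R : realType) (c : R) (f : R -> R) (L : set R)
    : Prop :=
  finite_set L /\
  [set x | lorenz_dom c x /\ omega c f (Regular x) = L]° !=set0.

(* Invariance is included: the closure of the orbit of each point of L, followed
   on both sides of c if it meets c, is L itself. *)
Definition minimal_set (R : realType) (c : R) (f : R -> R) (L : set R) : Prop :=
  [/\ L !=set0, L `<=` `[0, 1]
    & forall x : R, L x -> closure (forward_orbit c f x) = L].

(** * Renormalization *)

Definition return_time (R : realType) (c : R) (f : R -> R) (T : set R)
    (x : R) (n : nat) : Prop :=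
  [/\ (0 < n)%N, iter_dom c f n x, T (iter n f x)
    & forall j, (0 < j < n)%N -> ~ T (iter j f x)].

(* The first return map to T is conjugated by h to a Lorenz map g with critical
   point c'; the domains of the two partial maps correspond under h. *)
Definition return_map_lorenz (R : realType) (c : R) (f : R -> R) (T : set R)
    : Prop :=
  exists (c' : R) (g h : R -> R),
    [/\ lorenz_map c' g,
        homeomorphism_on T `[0, 1] h,
        forall x : R, T x -> ((exists n, return_time c f T x n) <-> h x <> c')
      & forall (x : R) n, T x -> return_time c f T x n -> h (iter n f x) = g (h x)].

(* A renormalization interval (a, b) is represented by the pair (a, b). *)
Definition renorm_intervals (R : realType) (c : R) (f : R -> R) : set (R * R) :=
  [set J | [/\ 0 <= J.1, J.1 < c < J.2, J.2 <= 1
             & return_map_lorenz c f `[J.1, J.2]]].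

Definition infinitely_renormalizable (R : realType) (c : R) (f : R -> R)
    : Prop :=
  infinite_set (renorm_intervals c f).

Definition is_period (R : realType) (c : R) (f : R -> R) (p : R) (n : nat)
    : Prop :=
  [/\ (0 < n)%N, iter_dom c f n p, iter n f p = p
    & forall j, (0 < j < n)%N -> iter j f p <> p].

(* The intervals whose union is the renormalization cycle of (a, b). *)
Definition cycle_intervals (R : realType) (c : R) (f : R -> R) (a b : R)
    : set (set R) :=
  [set I | exists p i, [/\ is_period c f a p, (i <= p)%N
                         & I = iter i f @` `]a, c[]] `|`
  [set I | exists p i, [/\ is_period c f b p, (i <= p)%N
                         & I = iter i f @` `]c, b[]].

Definition Lambda_ (R : realType) (c : R) (f : R -> R) (a b : R) : set R :=
  [set x : R | x \in `[0, 1] /\ forward_orbit c f x `&` `]a, b[ = set0].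

Definition gaps (R : realType) (c : R) (f : R -> R) (a b : R) : set (set R) :=
  [set G | exists2 x : R, (`[0, 1] `\` Lambda_ c f a b) x
         & G = connected_component (`[0, 1] `\` Lambda_ c f a b) x].

Definition nice_trapping_region (R : realType) (c : R) (f : R -> R) (a b : R)
    : set R :=
  \bigcup_(G in [set G | gaps c f a b G /\
                   exists2 I, cycle_intervals c f a b I & I `<=` G]) G.

(* Main.v *)
Require Import Defs.
From mathcomp Require Import all_boot all_order all_algebra.
From mathcomp Require Import all_classical all_reals all_analysis.
From mathcomp Require Import measurable_realfun.
From mathcomp Require Import ring lra zify.

Set Implicit Arguments.
Unset Strict Implicit.
Unset Printing Implicit Defensive.

Import Order.TTheory GRing.Theory Num.Theory.
Import numFieldNormedType.Exports.

Local Open Scope classical_set_scope.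
Local Open Scope ring_scope.

(** Write v and w for the one-sided critical values f(c_-) and f(c_+). The minimal
    set is the limit set of the orbit of v. The argument rests on two properties of
    the renormalization intervals (a, b), whose cycles consist of the images A_i of
    (a, c) and B_i of (c, b) up to their return.

    They are linearly ordered. Without periodic attractors, no iterate maps into
    itself an interval on which it is monotone ([no_attractor_no_trap]): by monotone
    convergence, it would be the identity there or attract an open set of points to
    a finite limit set. Hence two renormalization intervals are nested, and the
    smaller one has strictly longer return times on both sides ([rn_ltp], [rn_eqp]).
    So an infinity of them has unbounded return times.

    They shrink to [c] ([renorm_shrink]). This is where smoothness and non-flatness
    enter, through a cross-ratio inequality ([nonflat_lorenz]): powers expand
    cross-ratios, and a C^2 diffeomorphism distorts them on an interval T by a factor
    of at most exp(C |T|). The product of these factors stays bounded along an orbit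
    of intervals of bounded multiplicity. Now suppose that a <= u < c for all
    (a, b), and take the shortest interval of the cycle of a deep one. Since the
    intervals next to it are not shorter, it has space around it, which the
    inequality carries back to the first interval of its half of the cycle
    ([koebe_space]). If the shortest interval is an A_k, this makes f^k monotone
    across endpoints of other renormalization intervals, which accumulate at [u]
    ([left_not_shortest]). Let it be a B_k. If the right endpoints stay away from [c],
    the reflected argument applies. Otherwise the space around the first interval
    contains the image of another interval of the cycle, close to [b], so that f^k
    sends a full interval of the cycle into a quarter of the shortest length
    ([right_not_shortest]).

    Once the intervals shrink to [c], an orbit that accumulates at [c] passes through
    both sides of every (a, b), close to [c] ([visit_left]), and therefore shadows
    both critical orbits; so its limit set contains those of v and w, which coincide
    ([acc_v_acc], [acc_vw]). Conversely, let the orbit accumulate at a point z with a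
    neighbourhood Z that misses the critical orbits. As the orbit eventually moves
    along the cycle of each (a, b), some interval of the cycle contains all of Z, and
    Z moves monotonically until it enters (a, b). That takes arbitrarily long, for
    (a, b) is small, which contradicts the recurrence of the orbit to Z ([acc_acc_v]).
    Points of the limit set enter each (a, b) ([acc_v_return]), which gives minimality
    ([acc_v_minimal]) and, for neighbourhoods of these points, the inclusion in the
    nice trapping regions ([acc_v_trapped]).

    Statements about the right-hand side of [c] follow from those about the left-hand
    side by the reflection x |-> 1 - x. *)

(** * Lorenz maps, reflection, and monotone iterates *)

(** What the order-theoretic part of the argument uses of a Lorenz map [f] with
    critical point [c]; [v] and [w] are the one-sided values f(c_-) and f(c_+).
    The conditions are exchanged by the reflection x |-> 1 - x. *)
Record lorenz (R : realType) (f : R -> R) (c v w : R) : Prop := Lorenz {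
  lz_c0 : 0 < c;
  lz_c1 : c < 1;
  lz_f0 : f 0 = 0;
  lz_f1 : f 1 = 1;
  lz_incL : forall x y, 0 <= x -> x < y -> y < c -> f x < f y;
  lz_incR : forall x y, c < x -> x < y -> y <= 1 -> f x < f y;
  lz_supL : forall x, 0 <= x -> x < c -> f x < v;
  lz_infR : forall x, c < x -> x <= 1 -> w < f x;
  lz_surL : forall y, 0 <= y -> y < v -> exists x, [/\ 0 <= x, x < c & f x = y];
  lz_surR : forall y, w < y -> y <= 1 -> exists x, [/\ c < x, x <= 1 & f x = y];
  lz_v1 : v <= 1;
  lz_w0 : 0 <= w
}.

Definition flip (R : realType) (f : R -> R) (x : R) : R := 1 - f (1 - x).

Lemma iter_flip (R : realType) (f : R -> R) n x :
  iter n (flip f) x = 1 - iter n f (1 - x).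
Proof.
elim: n => [|n IHn] /=; first by rewrite subKr.
by rewrite IHn /flip subKr.
Qed.

Lemma lorenz_flip (R : realType) (f : R -> R) c v w :
  lorenz f c v w -> lorenz (flip f) (1 - c) (1 - w) (1 - v).
Proof.
case=> c0 c1 f0 f1 iL iR sL iR' suL suR v1 w0; split; rewrite /flip.
- by lra.
- by lra.
- by rewrite subr0 f1 subrr.
- by rewrite subrr f0 subr0.
- by move=> x y x0 xy yc; rewrite ltrD2l ltrN2; apply: iR; lra.
- by move=> x y x0 xy yc; rewrite ltrD2l ltrN2; apply: iL; lra.
- by move=> x x0 xc; rewrite ltrD2l ltrN2; apply: iR'; lra.
- by move=> x x0 xc; rewrite ltrD2l ltrN2; apply: sL; lra.
- move=> y y0 yw; have [||x [cx x1 fx]] := suR (1 - y); [lra|lra|].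
  by exists (1 - x); rewrite subKr fx; split; lra.
- move=> y y0 yw; have [||x [cx x1 fx]] := suL (1 - y); [lra|lra|].
  by exists (1 - x); rewrite subKr fx; split; lra.
- by lra.
- by lra.
Qed.

(** On (l, r) the iterates before time n avoid [c], which makes f^n monotone and
    continuous there. *)
Definition no_trap (R : realType) (f : R -> R) (c : R) : Prop :=
  forall (l r : R) (n : nat), 0 <= l -> l < r -> r <= 1 -> (0 < n)%N ->
    (forall x j, l < x -> x < r -> (j < n)%N -> iter j f x <> c) ->
    (forall x, l < x -> x < r -> l < iter n f x /\ iter n f x < r) -> False.

Lemma no_trap_flip (R : realType) (f : R -> R) c :
  no_trap f c -> no_trap (flip f) (1 - c).
Proof.
move=> nt l r n l0 lr r1 n0 av mp.
apply: (nt (1 - r) (1 - l) n) => //; try lra.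
- move=> x j lx xr jn eq; apply: (av (1 - x) j) => //; try lra.
  by rewrite iter_flip subKr eq.
- move=> x lx xr; have := mp (1 - x); rewrite iter_flip subKr => h.
  have [||h1 h2] := h; [lra|lra|].
  by split; lra.
Qed.

(** [x] and [y] stay on the same side of [c] during the first [n] steps, so that
    [f^n] is continuous and increasing on the interval between them. *)
Definition clear (R : realType) (f : R -> R) (c : R) (n : nat) (x y : R) : Prop :=
  forall j, (j < n)%N -> iter j f y < c \/ c < iter j f x.

Lemma clear_flip (R : realType) (f : R -> R) c n x y :
  clear (flip f) (1 - c) n x y <-> clear f c n (1 - y) (1 - x).
Proof.
by split=> h j /h; rewrite !iter_flip => -[]; [right|left|right|left]; lra.
Qed.

Lemma clear_leq (R : realType) (f : R -> R) c n m x y :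
  (m <= n)%N -> clear f c n x y -> clear f c m x y.
Proof. by move=> mn h j jm; apply: h; apply: leq_trans mn. Qed.

Lemma clear_glue (R : realType) (f : R -> R) c n x y z :
  clear f c n x y -> clear f c n y z -> clear f c n x z.
Proof. by move=> h1 h2 j jn; have := h1 j jn; have := h2 j jn; lra. Qed.

Section Monotone.
Variables (R : realType) (f : R -> R) (c v w : R).
Hypothesis lz : lorenz f c v w.

Lemma lz_range x : 0 <= x -> x <= 1 -> x <> c -> 0 <= f x <= 1.
Proof.
case: lz => c0 c1 f0 f1 iL iR sL iR' suL suR v1 w0 x0 x1 xc.
have [xlt|] := ltrP x c.
  have := sL x x0 xlt; suff : 0 <= f x by lra.
  have [->|x_neq] := eqVneq x 0; first by rewrite f0.
  by rewrite -f0; apply/ltW/iL => //; rewrite lt_neqAle eq_sym x_neq.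
rewrite le_eqVlt => /orP[/eqP e|cx]; first by case: xc.
have := iR' x cx x1; suff : f x <= 1 by lra.
have [->|x_neq] := eqVneq x 1; first by rewrite f1.
by rewrite -f1; apply/ltW/iR => //; rewrite lt_neqAle x_neq.
Qed.

Lemma iter_range n x : 0 <= x -> x <= 1 ->
  (forall j, (j < n)%N -> iter j f x <> c) -> 0 <= iter n f x <= 1.
Proof.
move=> x0 x1; elim: n => [|n IHn] av /=; first by lra.
have /andP[h0 h1] : 0 <= iter n f x <= 1.
  by apply: IHn => j jn; apply: av; apply: leqW.
by apply: lz_range => //; apply: av.
Qed.

Lemma clear_mono n x y : 0 <= x -> x < y -> y <= 1 -> clear f c n x y ->
  [/\ 0 <= iter n f x, iter n f x < iter n f y & iter n f y <= 1].
Proof.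
move=> x0 xy y1; elim: n => [|n IHn] cl /=; first by [].
have [h0 h h1] := IHn (clear_leq (leqnSn _) cl).
have [s|s] := cl n (ltnSn n).
- have inc := lz_incL lz h0 h s; split=> //.
  + by have /andP[] : 0 <= f (iter n f x) <= 1 by apply: lz_range; lra.
  + by have /andP[] : 0 <= f (iter n f y) <= 1 by apply: lz_range; lra.
- have inc := lz_incR lz s h h1; split=> //.
  + by have /andP[] : 0 <= f (iter n f x) <= 1 by apply: lz_range; lra.
  + by have /andP[] : 0 <= f (iter n f y) <= 1 by apply: lz_range; lra.
Qed.

Lemma clear_lt n x y : 0 <= x -> x < y -> y <= 1 -> clear f c n x y ->
  iter n f x < iter n f y.
Proof. by move=> x0 xy y1 /(clear_mono x0 xy y1)[]. Qed.

Lemma clear_le n x y : 0 <= x -> x <= y -> y <= 1 -> clear f c n x y ->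
  iter n f x <= iter n f y.
Proof.
move=> x0; rewrite le_eqVlt => /orP[/eqP->//|xy] y1 cl.
exact/ltW/clear_lt.
Qed.

Lemma clear_sub n x y x' y' : 0 <= x -> x <= x' -> x' <= y' -> y' <= y ->
  y <= 1 -> clear f c n x y -> clear f c n x' y'.
Proof.
move=> x0 xx' x'y' y'y y1 cl.
elim: n cl x' y' xx' x'y' y'y => [|n IHn] cl x' y' xx' x'y' y'y j //.
have cln := clear_leq (leqnSn _) cl.
rewrite ltnS leq_eqVlt => /orP[/eqP ->|jn]; last exact: (IHn cln x' y').
have hx : iter n f x <= iter n f x'.
  by apply: clear_le => //; [lra|apply: IHn => //; lra].
have hy : iter n f y' <= iter n f y.
  by apply: clear_le => //; [lra|apply: IHn => //; lra].
by have := cl n (ltnSn n); lra.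
Qed.

Lemma clear_avoid n x y z j : 0 <= x -> x <= z -> z <= y -> y <= 1 ->
  clear f c n x y -> (j < n)%N -> iter j f z <> c.
Proof.
move=> x0 xz zy y1 cl jn e.
have := clear_sub x0 xz (lexx z) zy y1 cl jn.
by rewrite e; lra.
Qed.

Lemma iter_ivt n x y z : 0 <= x -> x <= y -> y <= 1 -> clear f c n x y ->
  iter n f x <= z -> z <= iter n f y ->
  exists t, [/\ x <= t, t <= y & iter n f t = z].
Proof.
move=> x0 xy y1; elim: n z => [|n IHn] z cl /=; first by exists z.
have cln := clear_leq (leqnSn _) cl.
have hle : iter n f x <= iter n f y by apply: clear_le.
have /andP[hx0 hx1] : 0 <= iter n f x <= 1.
  by apply: iter_range => //; [lra|move=> j; apply: (clear_avoid (x := x) (y := y))].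
have /andP[hy0 hy1] : 0 <= iter n f y <= 1.
  by apply: iter_range => //; [lra|move=> j; apply: (clear_avoid (x := x) (y := y))].
move=> xz zy.
suff [s [xs sy fs]] : exists s, [/\ iter n f x <= s, s <= iter n f y & f s = z].
  have [t [xt ty ft]] := IHn s cln xs sy.
  by exists t; split=> //; rewrite ft.
have [s|s] := cl n (ltnSn n).
- have z0 : 0 <= z.
    apply: le_trans xz; have /andP[] // : 0 <= f (iter n f x) <= 1.
    by apply: lz_range => //; lra.
  have zv : z < v by apply: le_lt_trans zy _; apply: (lz_supL lz).
  have [t [t0 tc ft]] := lz_surL lz z0 zv; exists t; split=> //.
  + rewrite leNgt; apply/negP => /(lz_incL lz) h.
    by have := h t0; rewrite ft => /(_ ltac:(lra)); lra.
  + rewrite leNgt; apply/negP => /(lz_incL lz) h.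
    by have := h hy0; rewrite ft => /(_ ltac:(lra)); lra.
- have z1 : z <= 1.
    apply: (le_trans zy); have /andP[] // : 0 <= f (iter n f y) <= 1.
    by apply: lz_range => //; lra.
  have zw : w < z by apply: lt_le_trans xz; apply: (lz_infR lz).
  have [t [tc t1 ft]] := lz_surR lz zw z1; exists t; split=> //.
  + rewrite leNgt; apply/negP => /(lz_incR lz tc) h.
    by have := h hx1; rewrite ft; lra.
  + rewrite leNgt; apply/negP => /(lz_incR lz) h.
    by have := h ltac:(lra) t1; rewrite ft; lra.
Qed.

(** By the intermediate value theorem, the first image that is not on one side of
    [c] contains [c]. *)
Lemma avoid_clear n x y : 0 <= x -> x <= y -> y <= 1 ->
  (forall z j, x <= z -> z <= y -> (j < n)%N -> iter j f z <> c) ->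
  clear f c n x y.
Proof.
move=> x0 xy y1; elim: n => [|n IHn] av j //.
have cln : clear f c n x y by apply: IHn => z i ? ? lin; apply/av/leqW.
rewrite ltnS leq_eqVlt => /orP[/eqP ->|]; last exact: cln.
have [?|h1] := ltrP (iter n f y) c; first by left.
have [?|h2] := ltrP c (iter n f x); first by right.
have [t [xt ty ft]] := iter_ivt x0 xy y1 cln h2 h1.
by case: (av t n xt ty (ltnSn n)).
Qed.

End Monotone.

(** Otherwise [f] would map (0, x) into itself. *)
Lemma lt_climb (R : realType) (f : R -> R) c v w : lorenz f c v w ->
  no_trap f c -> forall x, 0 < x -> x < c -> x < f x.
Proof.
move=> lz nt x x0 xc; rewrite ltNge; apply/negP => fx.
have c1 := lz_c1 lz.
apply: (nt 0 x 1%N) => //; try lra.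
  by move=> y [|j] // y0 yx _ /=; lra.
move=> y y0 yx /=; split; last first.
  by apply: lt_le_trans fx; apply: (lz_incL lz); lra.
by rewrite -(lz_f0 lz); apply: (lz_incL lz); lra.
Qed.

Lemma gt_climb (R : realType) (f : R -> R) c v w : lorenz f c v w ->
  no_trap f c -> forall x, c < x -> x < 1 -> f x < x.
Proof.
move=> lz nt x xc x1; have := lt_climb (lorenz_flip lz) (no_trap_flip nt).
by move=> /(_ (1 - x)); rewrite /flip subKr => h; have := h; lra.
Qed.

(** * Renormalization intervals *)

(** The endpoint data of a renormalization interval (a, b) with return times
    p + 1 on [a, c) and q + 1 on (c, b]. The intervals of the cycle at positive
    times are A_i = [f^i(f a), f^i(v)] for i <= p and B_i = [f^i(w), f^i(f b)]
    for i <= q; before the last one they stay out of (a, b). *)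
Record renorm (R : realType) (f : R -> R) (c v w a b : R) (p q : nat) : Prop :=
  Renorm {
  rn_a0 : 0 <= a;
  rn_ac : a < c;
  rn_cb : c < b;
  rn_b1 : b <= 1;
  rn_outL : forall j, (j < p)%N -> iter j f v <= a \/ b <= iter j f (f a);
  rn_fixL : iter p f (f a) = a;
  rn_retL : iter p f v <= b;
  rn_outR : forall j, (j < q)%N -> iter j f (f b) <= a \/ b <= iter j f w;
  rn_fixR : iter q f (f b) = b;
  rn_retR : a <= iter q f w
}.

Lemma renorm_flip (R : realType) (f : R -> R) c v w a b p q :
  renorm f c v w a b p q ->
  renorm (flip f) (1 - c) (1 - w) (1 - v) (1 - b) (1 - a) q p.
Proof.
case=> a0 ac cb b1 oL fL rL oR fR rR.
have fa : flip f (1 - a) = 1 - f a by rewrite /flip subKr.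
have fb : flip f (1 - b) = 1 - f b by rewrite /flip subKr.
split; rewrite ?fa ?fb; try (move=> j jn); rewrite ?iter_flip ?subKr; try lra.
- by have := oR j jn; lra.
- by have := oL j jn; lra.
Qed.

Lemma rn_bnds (R : realType) (f : R -> R) c v w a b p q :
  renorm f c v w a b p q -> [/\ 0 <= a, a < c, c < b & b <= 1].
Proof. by case. Qed.

Section Renorm.
Variables (R : realType) (f : R -> R) (c v w : R).
Hypothesis lz : lorenz f c v w.
Hypothesis nt : no_trap f c.

Lemma lz_v0 : 0 < v.
Proof. by rewrite -(lz_f0 lz); apply: (lz_supL lz) => //; exact: lz_c0 lz. Qed.

Section One.
Variables (a b : R) (p q : nat).
Hypothesis J : renorm f c v w a b p q.

Lemma rn_fa : [/\ 0 <= f a, f a < v & f a <= 1].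
Proof.
have [a0 ac cb b1] := rn_bnds J; have [v1 c1] := (lz_v1 lz, lz_c1 lz).
have /andP[? ?] : 0 <= f a <= 1 by apply: (lz_range lz); lra.
by split=> //; apply: (lz_supL lz).
Qed.

Lemma rn_clear : clear f c p (f a) v.
Proof.
have [a0 ac cb b1] := rn_bnds J.
by move=> j jp; have := rn_outL J jp; lra.
Qed.

Lemma rn_out x j : a < x -> x < c -> (j < p)%N ->
  iter j.+1 f x < a \/ b < iter j.+1 f x.
Proof.
have [a0 ac cb b1] := rn_bnds J; have [v1 c1] := (lz_v1 lz, lz_c1 lz).
move=> ax xc jp; have [fa0 fav fa1] := rn_fa.
have h1 : f a < f x by apply: (lz_incL lz).
have h2 : f x < v by apply: (lz_supL lz); lra.
have cl := clear_leq (ltnW jp) rn_clear.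
rewrite iterSr.
have := clear_lt lz fa0 h1 (ltW (lt_le_trans h2 v1)) (clear_sub lz fa0 (lexx _) (ltW h1) (ltW h2) v1 cl).
have := clear_lt lz (le_trans fa0 (ltW h1)) h2 v1 (clear_sub lz fa0 (ltW h1) (ltW h2) (lexx _) v1 cl).
by have := rn_outL J jp; lra.
Qed.

Lemma rn_avoid x j : a < x -> x < c -> (j <= p)%N -> iter j f x <> c.
Proof.
have [a0 ac cb b1] := rn_bnds J; have [v1 c1] := (lz_v1 lz, lz_c1 lz).
move=> ax xc; case: j => [|j] jp e; first by move: e => /=; lra.
by have := rn_out ax xc jp; rewrite e; lra.
Qed.

Lemma rn_return x : a < x -> x < c ->
  [/\ a < iter p.+1 f x & iter p.+1 f x < iter p f v].
Proof.
have [a0 ac cb b1] := rn_bnds J; have [v1 c1] := (lz_v1 lz, lz_c1 lz).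
move=> ax xc; have [fa0 fav fa1] := rn_fa.
have h1 : f a < f x by apply: (lz_incL lz).
have h2 : f x < v by apply: (lz_supL lz); lra.
have cl := rn_clear; rewrite iterSr; split.
- rewrite -{1}(rn_fixL J); apply: (clear_lt lz) => //; first lra.
  exact: (clear_sub lz fa0 (lexx _) (ltW h1) (ltW h2) v1 cl).
- apply: (clear_lt lz) => //; first lra.
  exact: (clear_sub lz fa0 (ltW h1) (ltW h2) (lexx _) v1 cl).
Qed.

Lemma rn_return_lt x y : a <= x -> x < y -> y < c -> iter p.+1 f x < iter p.+1 f y.
Proof.
have [a0 ac cb b1] := rn_bnds J; have [v1 c1] := (lz_v1 lz, lz_c1 lz).
move=> ax xy yc; have [fa0 fav fa1] := rn_fa.
have h0 : f a <= f x.
  by move: ax; rewrite le_eqVlt => /orP[/eqP->//|ax]; apply/ltW/(lz_incL lz) => //; lra.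
have h1 : f x < f y by apply: (lz_incL lz); lra.
have h2 : f y < v by apply: (lz_supL lz); lra.
rewrite !iterSr; apply: (clear_lt lz) => //; try lra.
exact: (clear_sub lz fa0 h0 (ltW h1) (ltW h2) v1 rn_clear).
Qed.

(** A point of (a, c) that does not move to the right would bound, together with
    the fixed point [a], an interval trapped by the first return map. *)
Lemma rn_climb x : a < x -> x < c -> x < iter p.+1 f x.
Proof.
have [a0 ac cb b1] := rn_bnds J; have [v1 c1] := (lz_v1 lz, lz_c1 lz).
move=> ax xc; rewrite ltNge; apply/negP => h.
apply: (nt (l := a) (r := x) (n := p.+1)) => //; try lra.
  by move=> y j ay yx jp; apply: rn_avoid => //; lra.
move=> y ay yx; have [|h1 _] := rn_return ay; first lra.
split=> //; apply: lt_le_trans h; apply: rn_return_lt => //; exact: ltW.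
Qed.

(** Otherwise the return map would send (a, c) into itself. *)
Lemma rn_overlap : c < iter p f v.
Proof.
have [a0 ac cb b1] := rn_bnds J; have [v1 c1] := (lz_v1 lz, lz_c1 lz).
rewrite ltNge; apply/negP => h.
apply: (nt (l := a) (r := c) (n := p.+1)) => //; try lra.
  by move=> y j ay yx jp; apply: rn_avoid => //; lra.
by move=> y ay yx; have [h1 h2] := rn_return ay yx; split=> //; lra.
Qed.

Lemma rn_overlap_pt : exists t, [/\ a < t, t < c & c < iter p.+1 f t].
Proof.
have [a0 ac cb b1] := rn_bnds J; have [v1 c1] := (lz_v1 lz, lz_c1 lz).
have [fa0 fav fa1] := rn_fa; have ov := rn_overlap.
set y := (c + iter p f v) / 2.
have [||t [at_ tv ft]] := iter_ivt (z := y) lz fa0 (ltW fav) v1 rn_clear.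
- by rewrite (rn_fixL J) /y; lra.
- by rewrite /y; lra.
have tv' : t < v.
  rewrite lt_neqAle tv andbT; apply/eqP => e.
  by move: ft; rewrite e /y; lra.
have [s [s0 sc fs]] := lz_surL lz (le_trans fa0 at_) tv'.
have fsy : iter p.+1 f s = y by rewrite iterSr fs.
exists s; split=> //; last by rewrite fsy /y; lra.
rewrite ltNge; apply/negP; rewrite le_eqVlt => /orP[/eqP e|sa].
  by move: fsy; rewrite e iterSr (rn_fixL J) /y; lra.
by have := lz_incL lz s0 sa ac; lra.
Qed.

End One.
End Renorm.

Section RenormR.
Variables (R : realType) (f : R -> R) (c v w : R).
Hypothesis lz : lorenz f c v w.
Hypothesis nt : no_trap f c.
Variables (a b : R) (p q : nat).
Hypothesis J : renorm f c v w a b p q.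

Let lz' := lorenz_flip lz. Let nt' := no_trap_flip nt. Let J' := renorm_flip J.

Lemma rn_fb : [/\ 0 <= f b, w < f b & f b <= 1].
Proof. by have [] := rn_fa lz' J'; rewrite /flip subKr; split; lra. Qed.

Lemma rn_outR_pt x j : c < x -> x < b -> (j < q)%N ->
  iter j.+1 f x < a \/ b < iter j.+1 f x.
Proof.
move=> cx xb jq; have := rn_out (x := 1 - x) lz' J' _ _ jq.
by rewrite iter_flip subKr => h; have := h ltac:(lra) ltac:(lra); lra.
Qed.

Lemma rn_avoidR x j : c < x -> x < b -> (j <= q)%N -> iter j f x <> c.
Proof.
move=> cx xb jq; have := rn_avoid (x := 1 - x) lz' J' _ _ jq.
by rewrite iter_flip subKr => h e; apply: h; lra.
Qed.

Lemma rn_returnR x : c < x -> x < b ->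
  [/\ iter q f w < iter q.+1 f x & iter q.+1 f x < b].
Proof.
move=> cx xb; have := rn_return (x := 1 - x) lz' J'.
rewrite !iter_flip !subKr => h.
by have [||h1 h2] := h; [lra|lra|]; split; lra.
Qed.

Lemma rn_climbR x : c < x -> x < b -> iter q.+1 f x < x.
Proof.
move=> cx xb; have := rn_climb (x := 1 - x) lz' nt' J'.
by rewrite iter_flip subKr => h; have := h ltac:(lra) ltac:(lra); lra.
Qed.

Lemma rn_return_ltR x y : c < x -> x < y -> y <= b ->
  iter q.+1 f x < iter q.+1 f y.
Proof.
move=> ax xy yc; have := rn_return_lt (x := 1 - y) (y := 1 - x) lz' J'.
by rewrite !iter_flip !subKr => h; have := h ltac:(lra) ltac:(lra) ltac:(lra); lra.
Qed.

Lemma rn_overlapR : iter q f w < c.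
Proof. by have := rn_overlap lz' nt' J'; rewrite iter_flip subKr; lra. Qed.

Lemma rn_overlap_ptR : exists t, [/\ c < t, t < b & iter q.+1 f t < c].
Proof.
have [t [h1 h2]] := rn_overlap_pt lz' nt' J'; rewrite iter_flip => h3.
by exists (1 - t); split; lra.
Qed.

End RenormR.

(** ** The order of renormalization intervals *)

Section Order.
Variables (R : realType) (f : R -> R) (c v w : R).
Hypothesis lz : lorenz f c v w.
Hypothesis nt : no_trap f c.
Variables (a b : R) (p q : nat) (a' b' : R) (p' q' : nat).
Hypothesis J : renorm f c v w a b p q.
Hypothesis J' : renorm f c v w a' b' p' q'.

Lemma rn_subset_le : a <= a' -> b' <= b -> (p <= p')%N.
Proof.
move=> aa bb; rewrite leqNgt; apply/negP => pp.
have [c0 c1] := (lz_c0 lz, lz_c1 lz).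
have ac' := rn_ac J'; have cb' := rn_cb J'.
set x := (a' + c) / 2.
have h1 := rn_out (x := x) lz J ltac:(rewrite /x; lra) ltac:(rewrite /x; lra) pp.
have [h2 h3] := rn_return (x := x) lz J' ltac:(rewrite /x; lra) ltac:(rewrite /x; lra).
by have := rn_retL J'; lra.
Qed.

(** Suppose b < b'. Since f^(q+1) fixes [b], q' <= q. If q' = q, the return map of
    (a', b') fixes the interior point [b]; if q' < q, it sends (c, b) beyond [b], and
    there is no overlap at [c]. *)
Lemma rn_unlinked : a < a' -> b' <= b.
Proof.
move=> aa; rewrite leNgt; apply/negP => bb.
have [c0 c1] := (lz_c0 lz, lz_c1 lz).
have [ac cb] := (rn_ac J, rn_cb J); have [ac' cb'] := (rn_ac J', rn_cb J').
have qq : (q' <= q)%N.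
  rewrite leqNgt; apply/negP => qq.
  have h := rn_outR_pt lz J' cb bb qq.
  by move: h; rewrite iterSr (rn_fixR J); lra.
have [e|] := eqVneq q' q.
  have := rn_climbR lz nt J' cb bb; rewrite e iterSr (rn_fixR J); lra.
move=> /eqP ne; have qq' : (q' < q)%N by lia.
have ov := rn_overlapR lz nt J'.
have [t [ct tb ft]] := rn_overlap_ptR lz nt J'.
set x := Num.min t ((c + b) / 2).
have xt : x <= t by rewrite /x ge_min lexx.
have cx : c < x by rewrite /x lt_min; lra.
have xb : x < b by rewrite /x gt_min; lra.
have h := rn_outR_pt lz J cx xb qq'.
have [h1 h2] := rn_returnR (x := x) lz J' cx ltac:(lra).
have h3 : iter q'.+1 f x <= iter q'.+1 f t.
  move: xt; rewrite le_eqVlt => /orP[/eqP->//|xt].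
  by apply/ltW/(rn_return_ltR lz J') => //; lra.
by have := rn_retR J'; lra.
Qed.

(** If one time were shorter, the return to [a] and over [c] at this time would come
    too early for the other interval. *)
Lemma rn_eqa : a = a' -> p = p'.
Proof.
move=> aa; suff : forall a1 b1 p1 q1 b2 p2 q2, renorm f c v w a1 b1 p1 q1 ->
    renorm f c v w a1 b2 p2 q2 -> (p1 <= p2)%N.
  move: J'; rewrite -aa => J2 h.
  by apply/eqP; rewrite eqn_leq (h _ _ _ _ _ _ _ J J2) (h _ _ _ _ _ _ _ J2 J).
move=> a1 b1 p1 q1 b2 p2 q2 J1 J2; rewrite leqNgt; apply/negP => pp.
have := rn_outL J1 pp; rewrite (rn_fixL J2).
have := rn_overlap lz nt J2; have := rn_ac J1; have := rn_cb J1; lra.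
Qed.

(** If q < q', the return map of (a, b) would send (c, b') out of (a, b'), hence
    beyond b', and there would be no overlap at [c]. *)
Lemma rn_eqa_eqq : a = a' -> b' <= b -> (q' <= q)%N.
Proof.
move=> aa bb; rewrite leqNgt; apply/negP => qq.
have [c0 c1] := (lz_c0 lz, lz_c1 lz).
have [ac cb] := (rn_ac J, rn_cb J); have [ac' cb'] := (rn_ac J', rn_cb J').
have ov := rn_overlapR lz nt J.
have [t [ct tb ft]] := rn_overlap_ptR lz nt J.
set x := Num.min t ((c + b') / 2).
have xt : x <= t by rewrite /x ge_min lexx.
have cx : c < x by rewrite /x lt_min; lra.
have xb : x < b' by rewrite /x gt_min; lra.
have h := rn_outR_pt lz J' cx xb qq.
have [h1 h2] := rn_returnR (x := x) lz J cx ltac:(lra).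
have h3 : iter q.+1 f x <= iter q.+1 f t.
  move: xt; rewrite le_eqVlt => /orP[/eqP->//|xt].
  by apply/ltW/(rn_return_ltR lz J) => //; lra.
by have := rn_retR J; lra.
Qed.

End Order.

Section OrderFlip.
Variables (R : realType) (f : R -> R) (c v w : R).
Hypothesis lz : lorenz f c v w.
Hypothesis nt : no_trap f c.
Let lz' := lorenz_flip lz. Let nt' := no_trap_flip nt.

(** All points of (a, c) move to the right under the return map, so that [a] is
    the only point of [a, c) fixed by f^(p+1); similarly for [b]. *)
Lemma rn_eqp a b p q a' b' q' : renorm f c v w a b p q ->
  renorm f c v w a' b' p q' -> [/\ a = a', b = b' & q = q'].
Proof.
have sym : forall a1 b1 q1 a2 b2 q2, renorm f c v w a1 b1 p q1 ->
    renorm f c v w a2 b2 p q2 -> a1 <= a2.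
  move=> a1 b1 q1 a2 b2 q2 J1 J2; rewrite leNgt; apply/negP => aa.
  have := rn_climb lz nt J2 aa (rn_ac J1).
  by rewrite iterSr (rn_fixL J1); lra.
have symb : forall a1 b1 q1 b2 q2, renorm f c v w a1 b1 p q1 ->
    renorm f c v w a1 b2 p q2 -> b1 <= b2.
  move=> a1 b1 q1 b2 q2 J1 J2; rewrite leNgt; apply/negP => bb.
  have h := rn_eqa_eqq lz nt J1 J2 erefl (ltW bb).
  have h' : (q1 <= q2)%N.
    by apply: (rn_subset_le lz' (renorm_flip J1) (renorm_flip J2)); lra.
  have e : q2 = q1 by apply/eqP; rewrite eqn_leq h h'.
  have := rn_climbR lz nt J1 (rn_cb J2) bb.
  by rewrite -e iterSr (rn_fixR J2); lra.
move=> J J'; have ea : a = a'.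
  by apply/eqP; rewrite eq_le (sym _ _ _ _ _ _ J J') (sym _ _ _ _ _ _ J' J).
rewrite -ea in J' *; have eb : b = b'.
  by apply/eqP; rewrite eq_le (symb _ _ _ _ _ J J') (symb _ _ _ _ _ J' J).
rewrite -eb in J'; split=> //.
have [J1 J2] := (renorm_flip J, renorm_flip J').
exact: (rn_eqa lz' nt' J1 J2).
Qed.

(** Two nested intervals with a common endpoint or a common return time agree. *)
Lemma rn_ltp a b p q a' b' p' q' : renorm f c v w a b p q ->
  renorm f c v w a' b' p' q' -> (p < p')%N ->
  [/\ a < a', b' < b & (q < q')%N].
Proof.
move=> J J' pp.
have [J1 J1'] := (renorm_flip J, renorm_flip J').
have aa : a < a'.
  rewrite ltNge le_eqVlt; apply/negP => /orP[/eqP e|aa].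
    by move: pp; rewrite (rn_eqa lz nt J J') ?ltnn.
  have bb := rn_unlinked lz nt J' J aa.
  have := rn_subset_le lz J' J (ltW aa) bb; lia.
have bb := rn_unlinked lz nt J J' aa.
have bb' : b' < b.
  rewrite lt_neqAle bb andbT; apply/eqP => e.
  have := rn_eqa_eqq lz' nt' J1 J1' ltac:(lra) ltac:(lra); lia.
split=> //.
rewrite ltn_neqAle; apply/andP; split; last first.
  by apply: (rn_subset_le lz' J1 J1'); lra.
apply/eqP => e; rewrite -e in J1'.
have [h1 h2 h3] : [/\ 1 - b = 1 - b', 1 - a = 1 - a' & p = p'].
  have := rn_climb lz' nt' J1 (x := 1 - b') ltac:(lra) ltac:(have := rn_cb J'; lra).
  by rewrite iterSr (rn_fixL J1'); lra.
lra.
Qed.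

End OrderFlip.

(** * Families of intervals of bounded multiplicity *)

(** Integrate the number of intervals that contain a point. *)
Lemma sum_length_le (R : realType) m (l r : 'I_m -> R) (N : nat) :
  (forall i, 0 <= l i) -> (forall i, l i <= r i) -> (forall i, r i <= 1) ->
  (forall x : R, (#|[set i : 'I_m | (l i < x < r i)%R]%SET| <= N)%N) ->
  \sum_i (r i - l i) <= N%:R.
Proof.
move=> l0 lr r1 mult.
set mu := @lebesgue_measure R.
have len i : mu (`]l i, r i[)%classic = (r i - l i)%:E.
  rewrite /mu lebesgue_measure_itv /= lte_fin; case: ltP => // h.
  by have -> : r i = l i; [apply/eqP; rewrite eq_le h lr|rewrite subrr].
rewrite -lee_fin -sumEFin.
have -> : (\sum_(i < m) (r i - l i)%:E =
    \int[mu]_(x in `[0%R, 1%R]) \sum_(i < m) (\1_(`]l i, r i[)%classic x)%:E)%E.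
  rewrite ge0_integral_sum //=; last first.
    by move=> i; apply/measurable_EFinP; apply: measurable_indic.
  apply: eq_bigr => i _.
  rewrite integral_indic //= setIidl; first by rewrite -len.
  move=> x /=; rewrite !in_itv /= => /andP[h1 h2]; apply/andP; split.
    by apply/ltW/(le_lt_trans _ h1).
  by apply/ltW/(lt_le_trans h2).
apply: (@le_trans _ _ (\int[mu]_(x in `[0%R, 1%R]) N%:R%:E)%E); last first.
  by rewrite integral_cst //= /mu lebesgue_measure_itv /= lte_fin ltr01 oppr0 adde0 mule1.
apply: ge0_le_integral => //=.
- by move=> x _; apply: sume_ge0 => i _; rewrite lee_fin.
- by apply: emeasurable_sum => i; apply/measurable_EFinP; apply: measurable_indic.
- move=> x _; rewrite sumEFin lee_fin.
  apply: (@le_trans _ _ #|[set i : 'I_m | (l i < x < r i)%R]%SET|%:R); last first.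
    by rewrite ler_nat.
  rewrite -sum1_card natr_sum [leRHS]big_mkcond /=.
  apply: ler_sum => i _; rewrite indicE inE mem_setE in_itv /=.
  by case: ifP.
Qed.

(** Of the intervals [l i, r i] that contain a given point to the left of
    [x i, y i], the one with the rightmost [x i, y i] contains [x j, y j] for all
    the others; so at most N are of this kind. *)
Lemma sum_length_disjoint (R : realType) m (l x y r : 'I_m -> R) (N : nat) :
  (forall i, 0 <= l i) -> (forall i, r i <= 1) ->
  (forall i, [/\ l i <= x i, x i < y i & y i <= r i]) ->
  (forall i j, i != j -> y i <= x j \/ y j <= x i) ->
  (forall i, (#|[set j : 'I_m | (l i <= x j)%R && (y j <= r i)%R]%SET| <= N)%N) ->
  \sum_i (r i - l i) <= (N + N + 1)%:R.
Proof.
move=> l0 r1 ord dis mult; apply: sum_length_le => //.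
  by move=> i; have [] := ord i; lra.
move=> z.
set S1 := [set i : 'I_m | (l i < z < r i) && (z <= x i)]%SET.
set S2 := [set i : 'I_m | (l i < z < r i) && (y i <= z)]%SET.
set S3 := [set i : 'I_m | (x i < z < y i)]%SET.
have sub : [set i : 'I_m | l i < z < r i]%SET \subset (S1 :|: S2 :|: S3)%SET.
    apply/fintype.subsetP => i; rewrite !inE => ->/=.
  by case: ltP => //= h1; case: ltP => //= h2.
apply: (leq_trans (subset_leq_card sub)).
apply: (leq_trans (leq_card_setU _ _)); apply: leq_add.
  apply: (leq_trans (leq_card_setU _ _)); apply: leq_add.
  - have [->|/finset.set0Pn[i0 i0S]] := eqVneq S1 finset.set0; first by rewrite cards0.
    case: (arg_maxP (P := mem S1) x i0S) => i iS imax.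
    apply: leq_trans (mult i); apply: subset_leq_card; apply/fintype.subsetP => j jS.
    have h0 : x j <= x i := imax j jS.
    have iS2 : i \in S1 := iS.
    move: iS2 jS; rewrite !inE => /andP[/andP[h1 h2] h3] /andP[/andP[h4 h5] h6].
    have [e1 e2 e3] := ord i; have [e4 e5 e6] := ord j.
    apply/andP; split; first lra.
    have [->|ij] := eqVneq j i; first lra.
    by have := dis _ _ ij; lra.
  - have [->|/finset.set0Pn[i0 i0S]] := eqVneq S2 finset.set0; first by rewrite cards0.
    case: (arg_minP (P := mem S2) y i0S) => i iS imin.
    apply: leq_trans (mult i); apply: subset_leq_card; apply/fintype.subsetP => j jS.
    have h0 : y i <= y j := imin j jS.
    have iS2 : i \in S2 := iS.
    move: iS2 jS; rewrite !inE => /andP[/andP[h1 h2] h3] /andP[/andP[h4 h5] h6].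
    have [e1 e2 e3] := ord i; have [e4 e5 e6] := ord j.
    apply/andP; split; last lra.
    have [->|ij] := eqVneq j i; first lra.
    by have := dis _ _ ij; lra.
apply/card_le1P => i; rewrite inE => hi j; rewrite !inE.
have [->|ij] := eqVneq j i; first by rewrite hi.
apply/negP => hj; have [e1 e2 e3] := ord i; have [e4 e5 e6] := ord j.
by have := dis _ _ ij; lra.
Qed.

(** * Cross-ratios *)

(** On intervals T = L u M u R that do not contain [c] the map decreases the
    cross-ratio |T||M| / (|L||R|) by a factor of at most exp(- C |T|). *)
Definition cross_ratio_bound (R : realType) (f : R -> R) (c C : R) : Prop :=
  forall t0 t1 t2 t3, 0 <= t0 -> t0 < t1 -> t1 < t2 -> t2 < t3 -> t3 <= 1 ->
    t3 < c \/ c < t0 ->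
    (t3 - t0) * (t2 - t1) * ((f t1 - f t0) * (f t3 - f t2)) <=
    expR (C * (t3 - t0)) *
      ((f t3 - f t0) * (f t2 - f t1) * ((t1 - t0) * (t3 - t2))).

Lemma cross_ratio_flip (R : realType) (f : R -> R) c C :
  cross_ratio_bound f c C -> cross_ratio_bound (flip f) (1 - c) C.
Proof.
move=> cr t0 t1 t2 t3 h0 h1 h2 h3 h4 h5.
have := cr (1 - t3) (1 - t2) (1 - t1) (1 - t0).
move=> /(_ ltac:(lra) ltac:(lra) ltac:(lra) ltac:(lra) ltac:(lra) ltac:(lra)).
rewrite /flip.
have -> : 1 - t0 - (1 - t3) = t3 - t0 by ring.
have -> : 1 - t1 - (1 - t2) = t2 - t1 by ring.
have -> : 1 - t2 - (1 - t3) = t3 - t2 by ring.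
have -> : 1 - t0 - (1 - t1) = t1 - t0 by ring.
set e := expR _; set x0 := f (1 - t0); set x1 := f (1 - t1).
set x2 := f (1 - t2); set x3 := f (1 - t3).
have -> : (t3 - t0) * (t2 - t1) * ((x2 - x3) * (x0 - x1)) =
  (t3 - t0) * (t2 - t1) * ((1 - x1 - (1 - x0)) * (1 - x3 - (1 - x2))) by ring.
have -> // : e * ((x0 - x3) * (x1 - x2) * ((t3 - t2) * (t1 - t0))) =
  e * ((1 - x3 - (1 - x0)) * (1 - x2 - (1 - x1)) * ((t1 - t0) * (t3 - t2))) by ring.
Qed.

Section CrossRatio.
Variables (R : realType) (f : R -> R) (c v w C : R).
Hypothesis lz : lorenz f c v w.
Hypothesis cr : cross_ratio_bound f c C.

(** The product of the estimates for the successive images of T telescopes. *)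
Lemma iter_cross_ratio n t0 t1 t2 t3 :
  0 <= t0 -> t0 < t1 -> t1 < t2 -> t2 < t3 -> t3 <= 1 -> clear f c n t0 t3 ->
  (t3 - t0) * (t2 - t1) *
    ((iter n f t1 - iter n f t0) * (iter n f t3 - iter n f t2)) <=
  expR (C * \sum_(i < n) (iter i f t3 - iter i f t0)) *
    ((iter n f t3 - iter n f t0) * (iter n f t2 - iter n f t1) *
     ((t1 - t0) * (t3 - t2))).
Proof.
move=> h0 h1 h2 h3 h4; elim: n => [|n IHn] cl.
  by rewrite big_ord0 mulr0 expR0 mul1r.
have cln := clear_leq (leqnSn _) cl.
have cl01 : clear f c n t0 t1 by apply: (clear_sub lz h0 _ _ _ h4 cln); lra.
have cl12 : clear f c n t1 t2 by apply: (clear_sub lz h0 _ _ _ h4 cln); lra.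
have cl23 : clear f c n t2 t3 by apply: (clear_sub lz h0 _ _ _ h4 cln); lra.
have [t10 t20] : 0 <= t1 /\ 0 <= t2 by lra.
have [t11 t21] : t1 <= 1 /\ t2 <= 1 by lra.
have [g0 k1 _] := clear_mono lz h0 h1 t11 cl01.
have [_ k2 _] := clear_mono lz t10 h2 t21 cl12.
have [_ k3 g1] := clear_mono lz t20 h3 h4 cl23.
have inc1 : iter n.+1 f t0 < iter n.+1 f t1.
  by apply: (clear_lt lz) => //; apply: (clear_sub lz h0 _ _ _ h4 cl); lra.
have inc3 : iter n.+1 f t2 < iter n.+1 f t3.
  by apply: (clear_lt lz) => //; apply: (clear_sub lz h0 _ _ _ h4 cl); lra.
rewrite /= in inc1 inc3; have IH := IHn cln.
have st := cr g0 k1 k2 k3 g1 (cl n (ltnSn n)).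
rewrite big_ord_recr /= [C * _]mulrDr expRD.
set E := expR (C * \sum_(i < n) _) in IH *; set e := expR _ in st *.
set y0 := iter n f t0 in IH st g0 k1 k2 k3 inc1 *; set y1 := iter n f t1 in IH st k1 k2 inc1 *.
set y2 := iter n f t2 in IH st k2 k3 inc3 *; set y3 := iter n f t3 in IH st k3 g1 inc3 *.
set Z := ((y3 - y0) * (y2 - y1)) * ((y1 - y0) * (y3 - y2)).
have k4 := lt_trans (lt_trans k1 k2) k3; have h5 := lt_trans (lt_trans h1 h2) h3.
have Z0 : 0 < Z by rewrite !mulr_gt0 ?subr_gt0.
rewrite -(ler_pM2l Z0).
have pos1 : 0 <= (t3 - t0) * (t2 - t1) * ((y1 - y0) * (y3 - y2)).
  by rewrite !mulr_ge0 // subr_ge0 ltW.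
have pos2 : 0 <= (y3 - y0) * (y2 - y1) * ((f y1 - f y0) * (f y3 - f y2)).
  by rewrite !mulr_ge0 // subr_ge0 ltW.
have := ler_pM pos1 pos2 IH st.
rewrite /Z; set u0 := f y0; set u1 := f y1; set u2 := f y2; set u3 := f y3.
move=> h; apply: (le_trans _ (le_trans h _)); rewrite le_eqVlt; apply/orP; left;
  apply/eqP; ring.
Qed.

End CrossRatio.

Ltac nlia := repeat match goal with
  | H : is_true (Order.le _ _) |- _ => clear H
  | H : is_true (Order.lt _ _) |- _ => clear H
  end; lia.

(** * The cycle of a renormalization interval *)

Section Cycle.
Variables (R : realType) (f : R -> R) (c v w : R).
Hypothesis lz : lorenz f c v w.
Hypothesis nt : no_trap f c.
Variables (a b : R) (p q : nat).
Hypothesis J : renorm f c v w a b p q.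

Lemma rn_pt t : f a < t -> t < v -> exists x, [/\ a < x, x < c & f x = t].
Proof.
move=> at_ tv; have [fa0 fav fa1] := rn_fa lz J.
have [x [x0 xc fx]] := lz_surL lz (y := t) ltac:(lra) tv.
exists x; split=> //; rewrite ltNge; apply/negP; rewrite le_eqVlt => /orP[/eqP e|xa].
  by move: fx; rewrite e; lra.
by have := lz_incL lz x0 xa (rn_ac J); lra.
Qed.

Lemma rn_lt i : (i <= p)%N -> [/\ 0 <= iter i f (f a),
  iter i f (f a) < iter i f v & iter i f v <= 1].
Proof.
move=> ip; have [fa0 fav fa1] := rn_fa lz J.
have [] := clear_mono lz fa0 fav (lz_v1 lz) (clear_leq ip (rn_clear J)).
by split; lra.
Qed.

(** If A_i and A_j met for i < j, a common point would belong to the orbit of some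
    point of (a, c) before its return, and return p - j steps later: too early. *)
Lemma rn_disjoint i j : (i <= p)%N -> (j <= p)%N -> i <> j ->
  iter i f v <= iter j f (f a) \/ iter j f v <= iter i f (f a).
Proof.
wlog ij : i j / (i < j)%N.
  move=> h ip jp ne; have [ij|ij] : (i < j)%N \/ (j < i)%N by nlia.
    exact: h.
  by have := h j i ij jp ip ltac:(nlia); tauto.
move=> ip jp _; have [fa0 fav fa1] := rn_fa lz J.
have [a0 ac cb b1] := rn_bnds J; have v1 := lz_v1 lz.
have [ei1 ei2 ei3] := rn_lt ip; have [ej1 ej2 ej3] := rn_lt jp.
have cl := rn_clear J.
have [//|h1] := lerP (iter i f v) (iter j f (f a)); first by left.
have [//|h2] := lerP (iter j f v) (iter i f (f a)); first by right.
set lo := Num.max (iter i f (f a)) (iter j f (f a)).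
set hi := Num.min (iter i f v) (iter j f v).
have lohi : lo < hi by rewrite /lo /hi gt_max !lt_min; lra.
have [l1 l2] : iter i f (f a) <= lo /\ iter j f (f a) <= lo.
  by rewrite /lo !le_max !lexx orbT.
have [l3 l4] : hi <= iter i f v /\ hi <= iter j f v.
  by rewrite /hi !ge_min !lexx orbT.
set z := (lo + hi) / 2; have zlo : lo < z by rewrite /z; lra.
have zhi : z < hi by rewrite /z; lra.
have [s [s1 s2 fs]] := iter_ivt (z := z) lz fa0 (ltW fav) v1 (clear_leq ip cl)
  ltac:(lra) ltac:(lra).
have [t [t1 t2 ft]] := iter_ivt (z := z) lz fa0 (ltW fav) v1 (clear_leq jp cl)
  ltac:(lra) ltac:(lra).
have strict k u : iter k f u = z -> iter k f (f a) < z -> z < iter k f v ->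
    f a <= u -> u <= v -> f a < u /\ u < v.
  move=> fu u1 u2 u3 u4; rewrite !lt_neqAle u3 u4 !andbT.
  by split; apply/eqP => e; move: u1 u2; rewrite -fu e; lra.
have [z1 z2] : iter i f (f a) < z /\ z < iter i f v by lra.
have [z3 z4] : iter j f (f a) < z /\ z < iter j f v by lra.
have [s3 s4] := strict i s fs z1 z2 s1 s2.
have [t3 t4] := strict j t ft z3 z4 t1 t2.
have [x [xa xc fx]] := rn_pt s3 s4; have [y [ya yc fy]] := rn_pt t3 t4.
have out := rn_out lz J xa xc (j := i + (p - j)) ltac:(nlia).
have [r1 r2] := rn_return lz J ya yc.
have e : iter (i + (p - j)).+1 f x = iter p.+1 f y.
  rewrite !iterSr fx fy addnC iterD fs -ft -iterD; congr iter; nlia.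
by have := rn_retL J; move: out; rewrite e; lra.
Qed.

(** The monotone images T_i of an interval T_0 around A_0 contain A_i. If the last
    one contains no second interval of the cycle, then no T_i contains a second
    one, and the total length is bounded. *)
Lemma chain_length k t0 t3 : (k <= p)%N -> 0 <= t0 -> t0 <= f a -> v <= t3 ->
  t3 <= 1 -> clear f c k t0 t3 ->
  (forall l l', (l <= p)%N -> (l' <= p)%N ->
    iter k f t0 <= iter l f (f a) -> iter l f v <= iter k f t3 ->
    iter k f t0 <= iter l' f (f a) -> iter l' f v <= iter k f t3 -> l = l') ->
  \sum_(i < k) (iter i f t3 - iter i f t0) <= 3.
Proof.
move=> kp t00 t0a vt3 t31 cl uni.
have [fa0 fav fa1] := rn_fa lz J.
have [a0 ac cb b1] := rn_bnds J; have v1 := lz_v1 lz.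
have cl0 i : (i <= k)%N -> [/\ 0 <= iter i f t0, iter i f t0 <= iter i f (f a),
    iter i f v <= iter i f t3 & iter i f t3 <= 1].
  move=> ik; have cli := clear_leq ik cl.
  have t03 : t0 < t3 by lra.
  have [h1 h2 h3] := clear_mono lz t00 t03 t31 cli.
  split=> //.
    by apply: (clear_le lz) => //; apply: (clear_sub lz t00 _ _ _ t31 cli); lra.
  by apply: (clear_le lz) => //; [lra|apply: (clear_sub lz t00 _ _ _ t31 cli); lra].
have push i j : (i < k)%N -> (j < k)%N -> iter i f t0 <= iter j f (f a) ->
    iter j f v <= iter i f t3 ->
    [/\ (j + (k - i) <= p)%N, iter k f t0 <= iter (j + (k - i)) f (f a)
      & iter (j + (k - i)) f v <= iter k f t3].
  move=> ik jk h1 h2.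
  have cli : clear f c (k - i) (iter i f t0) (iter i f t3).
    by move=> l lk; rewrite -!iterD; apply: cl; nlia.
  have [g1 g2 g3 g4] := cl0 i (ltnW ik).
  have [e1 e2 e3] := rn_lt (i := j) ltac:(nlia).
  have mono l : (l <= k - i)%N -> iter (l + i) f t0 <= iter (l + j) f (f a) /\
      iter (l + j) f v <= iter (l + i) f t3.
    move=> lk; rewrite !iterD; have cll := clear_leq lk cli.
    have e5 := ltW e2; split.
      apply: (clear_le lz g1 h1 (le_trans e5 e3)).
      exact: (clear_sub lz g1 (lexx _) h1 (le_trans e5 h2) g4 cll).
    apply: (clear_le lz (le_trans e1 e5) h2 g4).
    exact: (clear_sub lz g1 (le_trans h1 e5) h2 (lexx _) g4 cll).
  have le_p : (j + (k - i) <= p)%N.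
    rewrite leqNgt; apply/negP => pj.
    have [] := mono (p - j)%N ltac:(nlia).
    have -> : (p - j + j = p)%N by nlia.
    rewrite (rn_fixL J) => m1 m2; have := rn_overlap lz nt J.
    by have := cl (p - j + i)%N ltac:(nlia); lra.
  have [] := mono (k - i)%N ltac:(nlia).
  by rewrite (subnK (ltnW ik)) (addnC _ j).
have -> : 3 = (1 + 1 + 1)%:R :> R by [].
pose x (i : 'I_k) := iter i f (f a); pose y (i : 'I_k) := iter i f v.
apply: (sum_length_disjoint (x := x) (y := y)).
- by move=> i; have [] := cl0 i (ltnW (ltn_ord i)).
- by move=> i; have [] := cl0 i (ltnW (ltn_ord i)).
- move=> i; have [_ h1 h2 _] := cl0 i (ltnW (ltn_ord i)).
  by have [] := rn_lt (i := i) ltac:(have := ltn_ord i; nlia).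
- move=> i j ij; rewrite /x /y; apply: rn_disjoint; try (by have := ltn_ord i; have := ltn_ord j; nlia).
  by move=> e; move: ij; rewrite (val_inj e) eqxx.
- move=> i; apply/card_le1P => j; rewrite inE => /andP[h1 h2] j'; rewrite !inE.
  have [->|ne] := eqVneq j' j; first by rewrite h1 h2.
  apply/negP => /andP[h3 h4].
  have [k1 k2 k3] := push i j (ltn_ord i) (ltn_ord j) h1 h2.
  have [k4 k5 k6] := push i j' (ltn_ord i) (ltn_ord j') h3 h4.
  have e := uni _ _ k1 k4 k2 k3 k5 k6.
  by case/eqP: ne; apply/esym/ord_inj/(addIn e).
Qed.

End Cycle.

(** ** Extending the branches of iterates *)

Section Ext.
Variables (R : realType) (f : R -> R) (c v w : R).
Hypothesis lz : lorenz f c v w.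
Hypothesis nt : no_trap f c.
Variables (a b : R) (p q : nat).
Hypothesis J : renorm f c v w a b p q.

(** Extend f^m to the right of [s] as long as it stays monotone. The extension
    ends where an earlier image reaches [c] from the left; that image contains
    (a, c), and so the extension covers an interval A_i. Otherwise it reaches 1. *)
Lemma extend_right s m : 0 <= s -> s <= 1 ->
  (forall j, (j < m)%N -> iter j f s <= a \/ b <= iter j f s) ->
  exists rho : R, [/\ rho <= 1,
    forall y, iter m f s <= y -> y < rho ->
      exists e : R, [/\ s <= e, e <= 1, clear f c m s e & iter m f e = y]
    & (rho = 1 /\ iter m f s <= s) \/
      exists i, [/\ (i <= p)%N, iter m f s <= iter i f (f a) & rho = iter i f v]].
Proof.
move=> s0 s1; have [a0 ac cb b1] := rn_bnds J; have v1 := lz_v1 lz.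
have [c0 c1] := (lz_c0 lz, lz_c1 lz).
have [fa0 fav fa1] := rn_fa lz J.
elim: m => [|m IHm] out.
  exists 1; split=> //=; last by left.
  by move=> y sy y1; exists y; split=> //; apply: ltW.
have [rho [rho1 reach big]] := IHm (fun j jm => out j (leqW jm)).
have outm := out m (ltnSn m).
have /andP[m0 m1] : 0 <= iter m f s <= 1.
  apply: (iter_range lz) => // j jm e; have := out j (leqW jm); lra.
(* a value y' of f^m on the same side of c as f^m s extends the branch by f y' *)
have step y y' : iter m f s <= y' -> y' < rho ->
    (y' < c \/ c < iter m f s) -> f y' = y ->
    exists e : R, [/\ s <= e, e <= 1, clear f c m.+1 s e & iter m.+1 f e = y].
  move=> h1 h2 h3 fy; have [e [se e1 cle fe]] := reach y' h1 h2.
  exists e; split=> //=; last by rewrite fe.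
  move=> j; rewrite ltnS leq_eqVlt => /orP[/eqP->|]; last exact: cle.
  by rewrite fe.
have [sa|sb] := outm.
- have s'c : iter m f s < c by lra.
  have ltv : f (iter m f s) < v by apply: (lz_supL lz).
  have surj y : iter m.+1 f s <= y -> y < v ->
      exists y' : R, [/\ iter m f s <= y', y' < c & f y' = y].
    move=> h1 h2; have [||y' [y'0 y'c fy']] := lz_surL lz (y := y); [|by []|].
      by apply: le_trans h1; have /andP[] : 0 <= f (iter m f s) <= 1
        by apply: (lz_range lz) => //; lra.
    exists y'; split=> //; rewrite leNgt; apply/negP => h.
    by have := lz_incL lz y'0 h s'c; move: h1; rewrite /= fy'; lra.
  have fle x : iter m f s <= x -> x < c -> f (iter m f s) <= f x.
    rewrite le_eqVlt => /orP[/eqP->//|h] h'; exact/ltW/(lz_incL lz).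
  have [rc|rc] := ltrP c rho.
    exists v; split=> //.
      move=> y h1 h2; have [y' [k1 k2 k3]] := surj y h1 h2.
      by apply: (step y y') => //; [lra|left].
    by right; exists 0%N; split=> //=; apply: fle.
  case: big => [[r1 _]|[i [ip i1 i2]]]; first by lra.
  have ip' : (i < p)%N.
    rewrite ltn_neqAle ip andbT; apply/eqP => e.
    by have := rn_overlap lz nt J; move: i2 rc; rewrite e; lra.
  have [e1 e2 e3] := rn_lt lz J ip.
  have outi := rn_outL J ip'.
  have rhoc : rho < c by lra.
  exists (f rho); split.
  + by have /andP[] : 0 <= f rho <= 1 by apply: (lz_range lz) => //; lra.
  + move=> y h1 h2; have [|y' [k1 k2 k3]] := surj y h1.
      by apply: (lt_trans h2); apply: (lz_supL lz) => //; lra.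
    apply: (step y y') => //; last by left.
    rewrite ltNge; apply/negP; rewrite le_eqVlt => /orP[/eqP e|h].
      by move: h2; rewrite -k3 -e ltxx.
    have rho0 : 0 <= rho by lra.
    have := lz_incL lz rho0 h k2; rewrite k3 => /(lt_trans h2).
    by rewrite ltxx.
  + right; exists i.+1; split=> //=; last by rewrite i2.
    by apply: fle => //; lra.
- have s'c : c < iter m f s by lra.
  have gtw : w < f (iter m f s) by apply: (lz_infR lz).
  have surj y : iter m.+1 f s <= y -> y <= 1 ->
      exists y' : R, [/\ iter m f s <= y', y' <= 1 & f y' = y].
    move=> h1 h2; have [||y' [y'0 y'c fy']] := lz_surR lz (y := y); [|by []|].
      by apply: lt_le_trans h1.
    exists y'; split=> //; rewrite leNgt; apply/negP => h.
    by have := lz_incR lz y'0 h m1; move: h1; rewrite /= fy'; lra.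
  have fle x : iter m f s <= x -> x <= 1 -> f (iter m f s) <= f x.
    rewrite le_eqVlt => /orP[/eqP->//|h] h'; exact/ltW/(lz_incR lz).
  have reach' y : c < rho -> iter m.+1 f s <= y -> y < f rho -> f rho <= 1 ->
      exists e : R, [/\ s <= e, e <= 1, clear f c m.+1 s e & iter m.+1 f e = y].
    move=> rc h1 h2 fr1; have [y' [k1 k2 k3]] := surj y h1 ltac:(lra).
    apply: (step y y') => //; last by right.
    rewrite ltNge; apply/negP; rewrite le_eqVlt => /orP[/eqP e|h].
      by move: h2; rewrite -k3 -e ltxx.
    have := lz_incR lz rc h k2; rewrite k3 => /(lt_trans h2).
    by rewrite ltxx.
  case: big => [[r1 ms]|[i [ip i1 i2]]].
    exists 1; split=> //.
      move=> y h1 h2; apply: reach' => //; rewrite ?r1 ?(lz_f1 lz) //.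
    left; split=> //=.
    have [e|ne] := eqVneq (iter m f s) 1; first by rewrite e (lz_f1 lz) -e.
    have mlt : iter m f s < 1 by rewrite lt_neqAle ne m1.
    by have := gt_climb lz nt s'c mlt; lra.
  have ip' : (i < p)%N.
    rewrite ltn_neqAle ip andbT; apply/eqP => e.
    by move: i1; rewrite e (rn_fixL J); lra.
  have [e1 e2 e3] := rn_lt lz J ip.
  have fr : f rho <= 1.
    by have /andP[] : 0 <= f rho <= 1 by apply: (lz_range lz) => //; lra.
  exists (f rho); split=> //.
    by move=> y h1 h2; apply: reach' => //; lra.
  right; exists i.+1; split=> //=; last by rewrite i2.
  by apply: fle => //; lra.
Qed.

End Ext.

Section ExtL.
Variables (R : realType) (f : R -> R) (c v w : R).
Hypothesis lz : lorenz f c v w.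
Hypothesis nt : no_trap f c.
Variables (a b : R) (p q : nat).
Hypothesis J : renorm f c v w a b p q.

Lemma extend_left s m : 0 <= s -> s <= 1 ->
  (forall j, (j < m)%N -> iter j f s <= a \/ b <= iter j f s) ->
  exists rho : R, [/\ 0 <= rho,
    forall y, y <= iter m f s -> rho < y ->
      exists e : R, [/\ 0 <= e, e <= s, clear f c m e s & iter m f e = y]
    & (rho = 0 /\ s <= iter m f s) \/
      exists i, [/\ (i <= q)%N, iter i f (f b) <= iter m f s & rho = iter i f w]].
Proof.
move=> s0 s1 out; have [a0 ac cb b1] := rn_bnds J.
have [|||rho [r1 reach big]] := extend_right (s := 1 - s) (m := m)
  (lorenz_flip lz) (no_trap_flip nt) (renorm_flip J); try lra.
  by move=> j jm; rewrite iter_flip subKr; have := out j jm; lra.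
rewrite iter_flip subKr in reach big; exists (1 - rho); split; first lra.
  move=> y h1 h2; have [||e [e1 e2 e3 e4]] := reach (1 - y); try lra.
  move/clear_flip: e3; rewrite subKr => e3.
  by move: e4; rewrite iter_flip => e4; exists (1 - e); split=> //; lra.
case: big => [[k1 k2]|[i [k1 k2 k3]]]; first by left; split; lra.
right; exists i; split=> //; move: k2 k3; rewrite /flip !iter_flip !subKr; lra.
Qed.

End ExtL.

(** * Geometry of the cycle *)

(** A lower bound for the lengths of the intervals of the cycle. The last two
    conditions record that each half consists of disjoint intervals, so that long
    cycles have short intervals. *)
Definition cycle_lb (R : realType) (f : R -> R) (v w a b : R) (p q : nat) (mu : R)
    : Prop :=
  [/\ 0 < mu,
      forall l, (l <= p)%N -> mu <= iter l f v - iter l f (f a),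
      forall l, (l <= q)%N -> mu <= iter l f (f b) - iter l f w,
      p%:R * mu <= 3 & q%:R * mu <= 3].

Lemma cycle_lb_flip (R : realType) (f : R -> R) v w a b p q mu :
  cycle_lb f v w a b p q mu ->
  cycle_lb (flip f) (1 - w) (1 - v) (1 - b) (1 - a) q p mu.
Proof.
case=> m0 mp mq pm qm; split=> // l; rewrite /flip !subKr !iter_flip !subKr.
  by move=> /mq; lra.
by move=> /mp; lra.
Qed.

Definition koebe_const (R : realType) (C : R) : R := 24 * expR (C * 3).

Section Koebe.
Variables (R : realType) (f : R -> R) (c v w C : R).
Hypothesis lz : lorenz f c v w.
Hypothesis nt : no_trap f c.
Hypothesis C0 : 0 <= C.
Hypothesis cr : cross_ratio_bound f c C.
Variables (a b : R) (p q : nat).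
Hypothesis J : renorm f c v w a b p q.

Lemma chain_cross_ratio k t0 t1 t2 t3 :
  0 <= t0 -> t0 < t1 -> t1 < t2 -> t2 < t3 -> t3 <= 1 -> clear f c k t0 t3 ->
  \sum_(i < k) (iter i f t3 - iter i f t0) <= 3 ->
  (t3 - t0) * (t2 - t1) *
    ((iter k f t1 - iter k f t0) * (iter k f t3 - iter k f t2)) <=
  expR (C * 3) *
    ((iter k f t3 - iter k f t0) * (iter k f t2 - iter k f t1) *
     ((t1 - t0) * (t3 - t2))).
Proof.
move=> h0 h1 h2 h3 h4 cl s3.
apply: (le_trans (iter_cross_ratio lz cr h0 h1 h2 h3 h4 cl)).
apply: ler_wpM2r.
  have g1 : iter k f t1 < iter k f t2.
    by apply: (clear_lt lz) => //; try lra; apply: (clear_sub lz h0 _ _ _ h4 cl); lra.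
  have g2 : iter k f t0 < iter k f t3.
    by apply: (clear_lt lz) => //; lra.
  by apply: mulr_ge0; apply: mulr_ge0; lra.
by rewrite ler_expR; apply: ler_wpM2l.
Qed.

(** Around a shortest interval A_k of the cycle, the branch of f^k covers another
    interval of the cycle on each side, which is not shorter, or reaches an endpoint
    of [0, 1]. The cross-ratio inequality turns this space around A_k into space
    around A_0. *)
Lemma koebe_space k mu : (k <= p)%N -> cycle_lb f v w a b p q mu ->
  iter k f v - iter k f (f a) = mu -> mu <= f a -> mu <= 1 - v ->
  exists t0 t3 : R,
    [/\ 0 <= t0, t0 < f a, v < t3, t3 <= 1 & clear f c k t0 t3] /\
    [/\ iter k f t0 = iter k f (f a) - mu / 4,
        iter k f t3 = iter k f v + mu / 4,
        v - f a <= koebe_const C * (f a - t0)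
      & v - f a <= koebe_const C * (t3 - v)].
Proof.
move=> kp [mu0 mup muq _ _] eqmu mua muv.
have [a0 ac cb b1] := rn_bnds J; have v1 := lz_v1 lz.
have [fa0 fav fa1] := rn_fa lz J.
have v0 : 0 <= v by lra.
have outv j : (j < k)%N -> iter j f v <= a \/ b <= iter j f v.
  move=> jk; have [_ h _] := rn_lt lz J (leq_trans (ltnW jk) kp).
  by have := rn_outL J (leq_trans jk kp); lra.
have outa j : (j < k)%N -> iter j f (f a) <= a \/ b <= iter j f (f a).
  move=> jk; have [_ h _] := rn_lt lz J (leq_trans (ltnW jk) kp).
  by have := rn_outL J (leq_trans jk kp); lra.
have [r3 [r31 reach3 big3]] := extend_right lz nt J v0 v1 outv.
have r3mu : mu <= r3 - iter k f v.
  case: big3 => [[e1 e2]|[i [ip e1 e2]]]; first lra.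
  by have := mup i ip; lra.
have [r0 [r00 reach0 big0]] := extend_left lz nt J fa0 fa1 outa.
have r0mu : mu <= iter k f (f a) - r0.
  case: big0 => [[e1 e2]|[i [ip e1 e2]]]; first lra.
  by have := muq i ip; lra.
have [||t3 [vt3 t31 cl3 ft3]] := reach3 (iter k f v + mu / 4); [lra|lra|].
have [||t0 [t00 t0a cl0 ft0]] := reach0 (iter k f (f a) - mu / 4); [lra|lra|].
clear big0 big3 reach0 reach3 r0mu r3mu r00 r31 outa outv mua muv muq.
have t0a' : t0 < f a.
  by rewrite lt_neqAle t0a andbT; apply/eqP => e; move: ft0; rewrite e; lra.
have vt3' : v < t3.
  by rewrite lt_neqAle vt3 andbT; apply/eqP => e; move: ft3; rewrite -e; lra.
have cl : clear f c k t0 t3.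
  apply: clear_glue cl0 _; apply: clear_glue cl3.
  exact: clear_leq (rn_clear J).
exists t0, t3; split=> //.
have s3 : \sum_(i < k) (iter i f t3 - iter i f t0) <= 3.
  apply: (chain_length lz nt J) => //.
  move=> l l' lp lp' h1 h2 h3 h4.
  have [//|/eqP ne] := eqVneq l l'.
  have dis := rn_disjoint lz J lp lp' ne; clear ne.
  by exfalso; have := mup l lp; have := mup l' lp'; lra.
have := chain_cross_ratio t00 t0a' fav vt3' t31 cl s3.
rewrite ft0 ft3.
have -> : iter k f (f a) - (iter k f (f a) - mu / 4) = mu / 4 by lra.
have -> : iter k f v + mu / 4 - iter k f v = mu / 4 by lra.
have -> : iter k f v + mu / 4 - (iter k f (f a) - mu / 4) = 3 / 2 * mu by lra.
rewrite eqmu /koebe_const; set E := expR (C * 3) => h.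
have E0 : 0 < E by rewrite /E expR_gt0.
have mm : 0 < mu * mu by apply: mulr_gt0.
have {}h : (t3 - t0) * (v - f a) <= 24 * E * ((f a - t0) * (t3 - v)).
  rewrite -(ler_pM2r mm); apply: le_trans (_ : 16 * ((t3 - t0) * (v - f a) * (mu / 4 * (mu / 4))) <= _).
    by rewrite le_eqVlt; apply/orP; left; apply/eqP; field.
  apply: le_trans (_ : 16 * (E * (3 / 2 * mu * mu * ((f a - t0) * (t3 - v)))) <= _).
    by rewrite ler_pM2l.
  by rewrite le_eqVlt; apply/orP; left; apply/eqP; field.
split=> //.
- have T0 : 0 < t3 - v by rewrite subr_gt0.
  rewrite -(ler_pM2r T0).
  apply: le_trans (_ : (t3 - t0) * (v - f a) <= _); last first.
    by apply: (le_trans h); rewrite !mulrA.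
  by rewrite mulrC ler_pM2r ?subr_gt0 // lerD2l lerN2 ltW // (lt_trans t0a').
- have T0 : 0 < f a - t0 by rewrite subr_gt0.
  rewrite -(ler_pM2r T0).
  apply: le_trans (_ : (t3 - t0) * (v - f a) <= _); last first.
    by apply: (le_trans h); rewrite -!mulrA [(f a - t0) * _]mulrC.
  by rewrite mulrC ler_pM2r ?subr_gt0 // lerD2r ltW // (lt_trans fav).
Qed.

Lemma cycle_lb_ex : exists mu, cycle_lb f v w a b p q mu /\
  ((exists2 k, (k <= p)%N & iter k f v - iter k f (f a) = mu) \/
   (exists2 k, (k <= q)%N & iter k f (f b) - iter k f w = mu)).
Proof.
have minL : forall (g : nat -> R) n, exists2 k, (k <= n)%N &
    forall l, (l <= n)%N -> g k <= g l.
  move=> g n.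
  case: (arg_minP (P := xpredT) (fun i : 'I_n.+1 => g i) (i0 := ord0) isT) => i _ h.
  exists i; first by rewrite -ltnS ltn_ord.
  by move=> l ln; have := h (Ordinal (n := n.+1) (m := l) ln) isT.
have disj : forall (f' : R -> R) c' v' w' a' b' p' q' mu, lorenz f' c' v' w' ->
    renorm f' c' v' w' a' b' p' q' ->
    (forall l, (l <= p')%N -> mu <= iter l f' v' - iter l f' (f' a')) ->
    p'%:R * mu <= 3.
  move=> f' c' v' w' a' b' p' q' mu lz' J' h.
  apply: (@le_trans _ _ (\sum_(i < p') (iter i f' v' - iter i f' (f' a')))).
    rewrite -[p' in p'%:R]card_ord -sum1_card natr_sum mulr_suml.
    by apply: ler_sum => i _; rewrite mul1r; apply: h; apply: ltnW.
  have -> : 3 = (1 + 1 + 1)%:R :> R by [].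
  pose x (i : 'I_p') := iter i f' (f' a'); pose y (i : 'I_p') := iter i f' v'.
  have ord i : [/\ 0 <= x i, x i < y i & y i <= 1].
    by have := rn_lt lz' J' (ltnW (ltn_ord i)).
  apply: (sum_length_disjoint (x := x) (y := y)).
  - by move=> i; have [] := ord i.
  - by move=> i; have [] := ord i.
  - by move=> i; have [] := ord i; split.
  - move=> i j ij; apply: (rn_disjoint lz' J'); try exact/ltnW/ltn_ord.
    by move=> e; move: ij; rewrite (val_inj e) eqxx.
  - move=> i; apply/card_le1P => j; rewrite inE => /andP[h1 h2] j'; rewrite !inE.
    have same j1 : x i <= x j1 -> y j1 <= y i -> j1 = i.
      move=> h3 h4; have [//|ne] := eqVneq j1 i.
      have ne' : nat_of_ord j1 <> i by move=> e; move: ne; rewrite (ord_inj e) eqxx.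
      have d := rn_disjoint lz' J' (ltnW (ltn_ord j1)) (ltnW (ltn_ord i)) ne'.
      exfalso; clear ne'; have [g1 g2 g3] := ord i; have [g4 g5 g6] := ord j1.
      by rewrite /x /y in h3 h4 g2 g5; lra.
    rewrite (same _ h1 h2); apply/idP/eqP => [/andP[h3 h4]|->].
      exact: same.
    by rewrite !lexx.
have [k1 k1p m1] := minL (fun i => iter i f v - iter i f (f a)) p.
have [k2 k2q m2] := minL (fun i => iter i f (f b) - iter i f w) q.
pose al := iter k1 f v - iter k1 f (f a).
pose be := iter k2 f (f b) - iter k2 f w.
have al0 : 0 < al by have [] := rn_lt lz J k1p; rewrite /al; lra.
have be0 : 0 < be.
  have [] := rn_lt (lorenz_flip lz) (renorm_flip J) k2q.
  by rewrite /be /flip !subKr !iter_flip !subKr; lra.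
exists (Num.min al be).
have lbs : (forall l, (l <= p)%N -> Num.min al be <= iter l f v - iter l f (f a)) /\
    (forall l, (l <= q)%N -> Num.min al be <= iter l f (f b) - iter l f w).
  split=> l lp; rewrite ge_min.
    by apply/orP; left; apply: m1.
  by apply/orP; right; apply: m2.
case: lbs => lbp lbq; split.
  split=> //; first by rewrite lt_min al0 be0.
    exact: (disj _ _ _ _ _ _ _ _ _ lz J).
  apply: (disj _ _ _ _ _ _ _ _ _ (lorenz_flip lz) (renorm_flip J)).
  by move=> l /lbq; rewrite /flip !subKr !iter_flip !subKr; lra.
by case: (lerP al be) => h; [left; exists k1|right; exists k2].
Qed.

End Koebe.

Lemma koebe_space_right (R : realType) (f : R -> R) c v w C a b p q k mu :
  lorenz f c v w -> no_trap f c -> 0 <= C -> cross_ratio_bound f c C ->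
  renorm f c v w a b p q -> (k <= q)%N -> cycle_lb f v w a b p q mu ->
  iter k f (f b) - iter k f w = mu -> mu <= 1 - f b -> mu <= w ->
  exists t0 t3 : R,
    [/\ 0 <= t0, t0 < w, f b < t3, t3 <= 1 & clear f c k t0 t3] /\
    [/\ iter k f t0 = iter k f w - mu / 4,
        iter k f t3 = iter k f (f b) + mu / 4,
        f b - w <= koebe_const C * (w - t0)
      & f b - w <= koebe_const C * (t3 - f b)].
Proof.
move=> lz nt C0 cr J kq cyc eqmu mub muw.
have e1 : iter k (flip f) (1 - w) - iter k (flip f) (flip f (1 - b)) = mu.
  by rewrite /flip !subKr !iter_flip !subKr -eqmu; ring.
have e2 : mu <= flip f (1 - b) by rewrite /flip subKr.
have e3 : mu <= 1 - (1 - w) by rewrite subKr.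
have [t0 [t3 [[t00 t0a vt3 t31 cl] [ft0 ft3 k1 k2]]]] :=
  koebe_space (lorenz_flip lz) (no_trap_flip nt) C0 (cross_ratio_flip cr)
    (renorm_flip J) kq (cycle_lb_flip cyc) e1 e2 e3.
move: t0a ft0 ft3 k1 k2; rewrite /flip !subKr !iter_flip !subKr.
set K := koebe_const C => t0a ft0 ft3 k1 k2.
have e4 : 1 - w - (1 - f b) = f b - w by ring.
have e5 : 1 - f b - t0 = 1 - t0 - f b by ring.
have e6 : t3 - (1 - w) = w - (1 - t3) by ring.
rewrite e4 e5 in k1; rewrite e4 e6 in k2.
exists (1 - t3), (1 - t0); split; split=> //; try lra.
exact/clear_flip.
Qed.

(** * Renormalization intervals shrink to the critical point *)

Definition unbounded_renorm (R : realType) (f : R -> R) (c v w : R) : Prop :=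
  forall N, exists a b p q,
    [/\ renorm f c v w a b p q, (N <= p)%N & (N <= q)%N].

Lemma unbounded_renorm_flip (R : realType) (f : R -> R) c v w :
  unbounded_renorm f c v w -> unbounded_renorm (flip f) (1 - c) (1 - w) (1 - v).
Proof.
move=> h N; have [a [b [p [q [J pN qN]]]]] := h N.
by exists (1 - b), (1 - a), q, p; split=> //; apply: renorm_flip.
Qed.

Lemma flipK (R : realType) (f : R -> R) : flip (flip f) = f.
Proof. by apply/funext => x; rewrite /flip !subKr. Qed.

Lemma renorm_unflip (R : realType) (f : R -> R) c v w a b p q :
  renorm (flip f) (1 - c) (1 - w) (1 - v) a b p q ->
  renorm f c v w (1 - b) (1 - a) q p.
Proof. by move=> /renorm_flip; rewrite flipK !subKr. Qed.

Lemma min_pos (R : realType) (g : nat -> R) n :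
  (forall k, (k <= n)%N -> 0 < g k) ->
  exists2 d : R, 0 < d & forall k, (k <= n)%N -> d <= g k.
Proof.
elim: n => [|n IHn] h.
  exists (g 0%N); first exact: h.
  by move=> k; rewrite leqn0 => /eqP->.
have [d d0 dm] := IHn (fun k kn => h k (leqW kn)).
exists (Num.min d (g n.+1)); first by rewrite lt_min d0 h.
move=> k; rewrite leq_eqVlt => /orP[/eqP->|]; first by rewrite ge_min lexx orbT.
by rewrite ltnS => /dm; rewrite ge_min => ->.
Qed.

Lemma small_of_many (R : realType) (eta : R) : 0 < eta ->
  exists N, forall p mu, (N <= p)%N -> p%:R * mu <= 3 -> mu < eta.
Proof.
move=> e0; exists (Num.bound (3 / eta)).+1 => p mu Np h.
rewrite ltNge; apply/negP => em.
have := archi_boundP (x := 3 / eta) ltac:(apply: divr_ge0; lra).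
rewrite ltr_pdivrMr // => h1.
have : (Num.bound (3 / eta))%:R * eta <= p%:R * mu.
  by apply: ler_pM => //; [exact: ltW|rewrite ler_nat; exact: ltnW].
lra.
Qed.

Section Family.
Variables (R : realType) (f : R -> R) (c v w C : R).
Hypothesis lz : lorenz f c v w.
Hypothesis nt : no_trap f c.
Hypothesis C0 : 0 <= C.
Hypothesis cr : cross_ratio_bound f c C.
Hypothesis unb : unbounded_renorm f c v w.

(** If v = 1, then f^p(v) = 1 for all p; but f^p(v) <= b, and b < 1 for all but
    one renormalization interval. *)
Lemma v_lt1 : v < 1.
Proof.
rewrite lt_neqAle (lz_v1 lz) andbT; apply/eqP => ev.
have [a [b [p [q [J _ _]]]]] := unb 0%N.
have [a' [b' [p' [q' [J' pp _]]]]] := unb p.+1.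
have [_ bb _] := rn_ltp lz nt J J' pp.
have := rn_retL J'; rewrite ev.
have -> : iter p' f 1 = 1 by elim: p' {J' pp} => //= n ->; rewrite (lz_f1 lz).
by have := rn_b1 J; lra.
Qed.

Lemma fa_lb : exists d N, 0 < d /\
  forall a b p q, renorm f c v w a b p q -> (N <= p)%N -> d <= f a.
Proof.
have [a [b [p [q [J _ _]]]]] := unb 0%N.
have [a' [b' [p' [q' [J' pp _]]]]] := unb p.+1.
have [aa _ _] := rn_ltp lz nt J J' pp; have a0 := rn_a0 J.
exists a', p'.+1; split; first lra.
move=> a2 b2 p2 q2 J2 pp2; have [aa2 _ _] := rn_ltp lz nt J' J2 pp2.
have := lt_climb lz nt (x := a2) ltac:(lra) (rn_ac J2); lra.
Qed.

Variable u : R.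
Hypothesis uc : u < c.
Hypothesis au : forall a b p q, renorm f c v w a b p q -> a <= u.
Hypothesis usup : forall x, x < u -> exists a b p q,
  renorm f c v w a b p q /\ x < a.

Lemma au_lt a b p q : renorm f c v w a b p q -> a < u.
Proof.
move=> J; have [a' [b' [p' [q' [J' pp _]]]]] := unb p.+1.
by have [aa _ _] := rn_ltp lz nt J J' pp; have := au J'; lra.
Qed.

(** The left branch is monotone and onto, hence continuous at [u]. *)
Lemma fu_near : [/\ 0 <= f u, f u < v & forall d, 0 < d -> exists N,
  forall a b p q, renorm f c v w a b p q -> (N <= p)%N -> f u - f a < d].
Proof.
have uc' := uc; have [a [b [p [q [J _ _]]]]] := unb 0%N.
have ua := au_lt J; have a0 := rn_a0 J.
have c1 := lz_c1 lz.
have fu0 : 0 < f u.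
  by have := lz_incL lz (x := 0) (y := u) ltac:(lra) ltac:(lra) uc; rewrite (lz_f0 lz).
have fuv : f u < v by apply: (lz_supL lz); lra.
split; [exact: ltW|by []|move=> d d0].
set y := Num.max 0 (f u - d / 2).
have y0 : 0 <= y by rewrite le_max lexx.
have yd : f u - d / 2 <= y by rewrite le_max lexx orbT.
have yu : y < f u by rewrite gt_max fu0 /=; lra.
have [x [x0 xc fx]] := lz_surL lz y0 (lt_trans yu fuv).
have xu : x < u.
  rewrite ltNge; apply/negP; rewrite le_eqVlt => /orP[/eqP e|h].
    by move: fx; rewrite -e; lra.
  by have := lz_incL lz (x := u) (y := x) ltac:(lra) h xc; lra.
have [a1 [b1 [p1 [q1 [J1 xa1]]]]] := usup xu.
exists p1.+1 => a2 b2 p2 q2 J2 pp.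
have [aa _ _] := rn_ltp lz nt J1 J2 pp.
by have := lz_incL lz (x := x) (y := a2) x0 ltac:(lra) (rn_ac J2); lra.
Qed.

(** If an interval A_k of the left half were the shortest one of a deep cycle, f^k
    would be monotone on a definite neighbourhood of f(u, c). This contains f(a', c)
    for a fixed renormalization interval (a', b') with a' close to [u], which f^p'
    maps across [c]. *)
Lemma left_not_shortest : exists N, forall a b p q mu k,
  renorm f c v w a b p q -> (N <= p)%N -> (k <= p)%N ->
  cycle_lb f v w a b p q mu -> iter k f v - iter k f (f a) <> mu.
Proof.
have [fu0 fuv near] := fu_near; have uc' := uc.
have v1 := v_lt1.
have [d [N0 [d0 lb]]] := fa_lb.
set K := koebe_const C.
have K0 : 0 < K by rewrite /K /koebe_const mulr_gt0 // expR_gt0.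
have [N1 near1] := near ((v - f u) / K) ltac:(rewrite divr_gt0 //; lra).
have [a1 [b1 [p1 [q1 [J1 pN1 _]]]]] := unb N1.
have [a2 [b2 [p2 [q2 [J2 pp2 _]]]]] := unb p1.+1.
have a1u := au_lt J1.
have [fa10 fa1v fa11] := rn_fa lz J1.
have fa1u : f a1 < f u by apply: (lz_incL lz) => //; exact: rn_a0 J1.
have [fa20 fa2v fa21] := rn_fa lz J2.
have fa2u : f a2 < f u.
  by apply: (lz_incL lz) => //; [exact: rn_a0 J2|exact: au_lt J2].
have [e e0 emin] : exists2 e : R, 0 < e & forall k, (k <= p1)%N ->
    e <= iter k f v - iter k f (f u).
  apply: min_pos => k kp; rewrite subr_gt0; apply: (clear_lt lz) => //; first exact: ltW.
  have cl : clear f c k (f a2) v by apply: clear_leq (rn_clear J2); apply: leq_trans kp (ltnW pp2).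
  exact: (clear_sub lz fa20 (ltW fa2u) (ltW fuv) (lexx v) (ltW v1) cl).
have [N2 sm] := small_of_many (eta := Num.min e (Num.min d (1 - v)))
  ltac:(rewrite !lt_min e0 d0 /=; lra).
exists (N2 + N0)%N => a b p q mu k J pN kp cyc eqmu.
have [pN2 pN0] : (N2 <= p)%N /\ (N0 <= p)%N by move: pN; clear; lia.
have [mu0 mup muq pmu qmu] := cyc.
have [mue mud] : mu < e /\ mu < Num.min d (1 - v).
  by apply/andP; rewrite -lt_min; apply: (sm p).
have [mud1 mud2] : mu < d /\ mu < 1 - v by apply/andP; rewrite -lt_min.
have dfa := lb _ _ _ _ J pN0.
have au' := au_lt J; have a0 := rn_a0 J.
have fau : f a < f u by apply: (lz_incL lz).
have clJ := rn_clear J.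
have [fa0 fav fa1] := rn_fa lz J.
have [kp1|kp1] := leqP k p1.
  have := emin k kp1.
  have : iter k f (f a) <= iter k f (f u).
    apply: (clear_le lz fa0 (ltW fau) (ltW (lt_trans fuv v1))).
    exact: (clear_sub lz fa0 (lexx _) (ltW fau) (ltW fuv) (ltW v1) (clear_leq kp clJ)).
  rewrite -eqmu in mue => g1 g2.
  by have := lt_le_trans mue g2; rewrite ltrD2l ltrN2 ltNge g1.
have [t0 [t3 [[t00 t0a vt3 t31 cl] [ft0 ft3 k1 k2]]]] :=
  koebe_space lz nt C0 cr J kp cyc eqmu (le_trans (ltW mud1) dfa) (ltW mud2).
have near' := near1 _ _ _ _ J1 pN1.
have t0a1 : t0 < f a1.
  rewrite ltNge; apply/negP => h.
  have : v - f u < K * ((v - f u) / K).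
    apply: le_lt_trans (_ : K * (f u - f a1) < _); last by rewrite ltr_pM2l.
    apply: (le_trans _ (le_trans k1 _)); first by rewrite lerD2l lerN2 ltW.
    by rewrite ler_pM2l //; apply: lerB h; exact: ltW.
  rewrite mulrC divfK; first by rewrite ltxx.
  by rewrite gt_eqF.
have := clear_sub lz t00 (ltW t0a1) (ltW fa1v) (ltW vt3) t31 cl kp1.
rewrite (rn_fixL J1); have ov := rn_overlap lz nt J1; have ac1 := rn_ac J1.
by case=> h; [have := lt_trans h ov|have := lt_trans h ac1]; rewrite ltxx.
Qed.

(** The cross-ratio inequality for f^p and the points f a, f u, v and t3. Their
    images are a, a point beyond [c], a point of (c, b], and the end of the tail. *)
Lemma branch_tail a b p q t3 : renorm f c v w a b p q ->
  v < t3 -> t3 <= 1 -> clear f c p v t3 ->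
  (forall l, (l < p)%N -> b <= iter l f (f a) -> iter p f t3 < iter l f v) ->
  (v - f u) * (c - u) * (iter p f t3 - iter p f v) <=
    expR (C * 3) * (b - c) * (f u - f a).
Proof.
move=> J vt3 t31 cl3 nl; have uc' := uc.
have [fu0 fuv _] := fu_near.
have [a0 ac cb b1] := rn_bnds J; have au' := au_lt J.
have [fa0 fav fa1] := rn_fa lz J.
have fau : f a < f u by apply: (lz_incL lz).
have cl : clear f c p (f a) t3 := clear_glue (rn_clear J) cl3.
have vt3' : iter p f v < iter p f t3.
  by apply: (clear_lt lz) => //; have := lz_v0 lz; lra.
have pt3 : iter p f t3 <= 1.
  by have [] := clear_mono lz fa0 (lt_trans fav vt3) t31 cl.
(* f^p (f u) is on the right of c, since u lies in all deeper intervals *)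
have Fu : c < iter p f (f u).
  have [a' [b' [p' [q' [J' pp _]]]]] := unb p.+1.
  have au2 := au_lt J'; have [aa _ _] := rn_ltp lz nt J J' pp.
  have [fa0' fav' fa1'] := rn_fa lz J'.
  have fau2 : f a' < f u by apply: (lz_incL lz) => //; lra.
  have : iter p f (f a') < iter p f (f u).
    apply: (clear_lt lz) => //; first lra.
    have cl' : clear f c p (f a') v by apply: clear_leq (rn_clear J'); apply: ltnW.
    exact: (clear_sub lz fa0' (lexx _) (ltW fau2) (ltW fuv) (lz_v1 lz) cl').
  have := rn_outL J' pp; have := rn_overlap lz nt J.
  by have := rn_ac J'; have := rn_cb J'; lra.
have s3 : \sum_(i < p) (iter i f t3 - iter i f (f a)) <= 3.
  apply: (chain_length lz nt J) => //; first exact: ltW.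
  have only l : (l <= p)%N -> iter p f (f a) <= iter l f (f a) ->
      iter l f v <= iter p f t3 -> l = p.
    move=> lp h1 h2; apply/eqP; rewrite eqn_leq lp leqNgt; apply/negP => lp'.
    rewrite (rn_fixL J) in h1.
    have [_ g _] := rn_lt lz J lp.
    have [h|h] := rn_outL J lp'; first lra.
    by have := nl l lp' h; lra.
  by move=> l l' lp lp' h1 h2 h3 h4; rewrite (only l) // (only l').
have := chain_cross_ratio lz C0 cr fa0 fau fuv vt3 t31 cl s3.
rewrite (rn_fixL J); set E := expR _; set F := iter p f v; set Y := iter p f t3.
rewrite -/F -/Y in vt3' pt3 *.
set U := iter p f (f u); rewrite -/U in Fu *.
have UF : U < F.
  apply: (clear_lt lz) => //; first by have := lz_v1 lz; lra.
  by apply: (clear_sub lz fa0 _ _ _ t31 cl); lra.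
have Fb : F <= b := rn_retL J.
have E0 : 0 < E by rewrite /E expR_gt0.
move=> h.
have T0 : 0 < t3 - v by lra.
rewrite -(ler_pM2r T0).
apply: (@le_trans _ _ ((t3 - f a) * (v - f u) * ((U - a) * (Y - F)))).
  have -> : (v - f u) * (c - u) * (Y - F) * (t3 - v) =
    (t3 - v) * (v - f u) * ((c - u) * (Y - F)) by ring.
  have [c_u Y_F v_u] : [/\ 0 <= c - u, 0 <= Y - F & 0 <= v - f u].
    by rewrite !subr_ge0 !ltW.
  apply: ler_pM; rewrite ?mulr_ge0 // ?(ltW T0) //.
    by apply: ler_wpM2r => //; rewrite lerD2l lerN2 ltW.
  by apply: ler_wpM2r => //; apply: lerB; exact: ltW.
apply: (le_trans h).
have -> : E * (b - c) * (f u - f a) * (t3 - v) =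
  E * (1 * (b - c) * ((f u - f a) * (t3 - v))) by ring.
rewrite ler_pM2l //; apply: ler_wpM2r.
  by rewrite mulr_ge0 // ?(ltW T0) // subr_ge0 ltW.
have [Ya UF0] : 0 <= Y - a /\ 0 <= F - U.
  by split; [have := ltW vt3'; lra|rewrite subr_ge0 ltW].
apply: ler_pM => //; first by have := a0; lra.
by apply: lerB => //; exact: ltW.
Qed.

(** The branch of f^p over f(a, c) stretches the short interval f(a, u) over
    (a, c). By the cross-ratio inequality, its extension beyond v gains only a small
    fraction of the length of (c, b) until it covers an interval of the cycle. *)
Lemma cycle_interval_near_b y0 : 0 < y0 -> exists N, forall a b p q,
  renorm f c v w a b p q -> (N <= p)%N ->
  exists s, [/\ (s < p)%N, b <= iter s f (f a)
    & iter s f v <= b + y0 * (b - c)].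
Proof.
move=> y00; have [fu0 fuv near] := fu_near; have uc' := uc; have v1 := v_lt1.
set E := expR (C * 3); have E0 : 0 < E by rewrite /E expR_gt0.
set y1 := Num.min y0 ((1 - v) / 2).
have y10 : 0 < y1 by rewrite /y1 lt_min y00 /=; lra.
have [y1a y1b] : y1 <= y0 /\ y1 <= (1 - v) / 2.
  by rewrite /y1 !ge_min !lexx orbT.
have pos : 0 < (v - f u) * (c - u) by apply: mulr_gt0; lra.
have [N near1] := near ((v - f u) * (c - u) * (y1 / 2) / E)
  ltac:(by rewrite divr_gt0 // mulr_gt0 //; lra).
exists N => a b p q J pN; have fuN := near1 _ _ _ _ J pN.
have [a0 ac cb b1] := rn_bnds J.
have v0 : 0 <= v by have := lz_v0 lz; lra.
have tail t3 : v < t3 -> t3 <= 1 -> clear f c p v t3 ->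
    (forall l, (l < p)%N -> b <= iter l f (f a) -> iter p f t3 < iter l f v) ->
    iter p f t3 - iter p f v <= y1 / 2 * (b - c).
  move=> h1 h2 h3 h4; have := branch_tail J h1 h2 h3 h4; rewrite -/E => h.
  rewrite -(ler_pM2l pos); apply: (le_trans h).
  have -> : (v - f u) * (c - u) * (y1 / 2 * (b - c)) =
    E * (b - c) * ((v - f u) * (c - u) * (y1 / 2) / E).
    by field; rewrite gt_eqF.
  by rewrite ler_wpM2l ?mulr_ge0 ?subr_ge0 ?ltW // (lt_trans ac).
have outv j : (j < p)%N -> iter j f v <= a \/ b <= iter j f v.
  move=> jp; have [_ h _] := rn_lt lz J (ltnW jp).
  by have := rn_outL J jp; lra.
have [rho [rho1 reach big]] := extend_right lz nt J v0 (lz_v1 lz) outv.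
have ov := rn_overlap lz nt J; have rb := rn_retL J.
have bigi i : (i <= p)%N -> iter p f v <= iter i f (f a) ->
    (i < p)%N /\ b <= iter i f (f a).
  move=> ip h; have ip' : (i < p)%N.
    rewrite ltn_neqAle ip andbT; apply/eqP => e.
    by move: h; rewrite e (rn_fixL J); lra.
  have [_ g _] := rn_lt lz J ip.
  by split=> //; have := rn_outL J ip'; lra.
have strict t3 : v <= t3 -> iter p f v < iter p f t3 -> v < t3.
  move=> h1 h2; rewrite lt_neqAle h1 andbT; apply/eqP => e.
  by move: h2; rewrite e ltxx.
have bc1 : b - c <= 1 by have := lz_c0 lz; lra.
have [s0 Ps0|none] := pickP (fun s : 'I_p => b <= iter s f (f a)).
- case: (arg_minP (P := fun s : 'I_p => b <= iter s f (f a))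
    (fun s : 'I_p => iter s f v) Ps0) => s Ps smin.
  have [g1 g2 g3] := rn_lt lz J (ltnW (ltn_ord s)).
  set y := (iter s f (f a) + iter s f v) / 2.
  have yrho : y < rho.
    case: big => [[e _]|[i [ip h e]]]; first by rewrite /y; lra.
    have [ip' bi] := bigi i ip h.
    by have := smin (Ordinal ip') bi; rewrite e /y /=; lra.
  have y_ge : iter p f v < y by rewrite /y; lra.
  have [t3 [vt3 t31 cl3 ft3]] := reach y (ltW y_ge) yrho.
  have vt3' : v < t3 by apply: strict => //; rewrite ft3.
  have := tail t3 vt3' t31 cl3; rewrite ft3 => h.
  have {}h := h ltac:(move=> l lp bl; have := smin (Ordinal lp) bl; rewrite /y /=; lra).
  exists s; split=> //.
  have : y1 * (b - c) <= y0 * (b - c) by apply: ler_wpM2r => //; rewrite subr_ge0 ltW.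
  by rewrite /y in h; lra.
- case: big => [[e vp]|[i [ip h e]]]; last first.
    by have [ip' bi] := bigi i ip h; have := none (Ordinal ip'); rewrite /= bi.
  set y := (1 + iter p f v) / 2.
  have yrho : y < rho by rewrite /y; lra.
  have y_ge : iter p f v < y by rewrite /y; lra.
  have [t3 [vt3 t31 cl3 ft3]] := reach y (ltW y_ge) yrho.
  have vt3' : v < t3 by apply: strict => //; rewrite ft3.
  have := tail t3 vt3' t31 cl3; rewrite ft3 => h.
  have {}h := h ltac:(move=> l lp bl; have := none (Ordinal lp); rewrite /= bl //).
  have : y1 / 2 * (b - c) <= y1 / 2 * 1 by apply: ler_wpM2l => //; rewrite divr_ge0 // ltW.
  by rewrite /y in h; lra.
Qed.

End Family.

(** Uniform continuity of [f] on the scale given by the distance to [c], as for the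
    power law (x - c)^beta. *)
Definition doubling_right (R : realType) (f : R -> R) (c w : R) : Prop :=
  forall eta, 0 < eta -> exists2 theta, 0 < theta & forall b, c < b ->
    b + theta * (b - c) <= 1 -> f (b + theta * (b - c)) - f b <= eta * (f b - w).

(** By the choice of s and t, f maps A_s into (f b, t), and f^k maps the result onto
    A_(s+1+k), whose length is at least [mu]. *)
Lemma cycle_interval_long (R : realType) (f : R -> R) c v w a b p q mu k s t :
  lorenz f c v w -> no_trap f c -> renorm f c v w a b p q ->
  cycle_lb f v w a b p q mu -> (s < p)%N -> b <= iter s f (f a) ->
  f (iter s f v) < t -> t <= 1 -> clear f c k (f b) t ->
  iter k f (f b) + mu <= iter k f t.
Proof.
move=> lz nt J [_ mup _ _ _] sp bs.
have [_ [cb b1]] := (rn_a0 J, (rn_cb J, rn_b1 J)).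
set z := iter s f v; set y := iter s f (f a) in bs => fzt t1 cl.
have [y0 yz z1] : [/\ 0 <= y, y < z & z <= 1] := rn_lt lz J (ltnW sp).
have [wfb fbw] : w < f b /\ f b <= 1 by have [] := rn_fb lz J.
have fb0 : 0 <= f b by have := lz_w0 lz; lra.
have fyz : f y < f z by apply: (lz_incR lz) => //; lra.
have fby : f b <= f y.
  move: bs; rewrite le_eqVlt => /orP[/eqP->//|bs]; apply/ltW/(lz_incR lz) => //; lra.
have sub x x' : f b <= x -> x <= x' -> x' <= t -> clear f c k x x'.
  by move=> h1 h2 h3; apply: (clear_sub lz fb0 h1 h2 h3 t1 cl).
have fyt : f y <= t by lra.
have clyz := sub _ _ fby (ltW fyz) (ltW fzt).
have below : iter k f (f b) <= iter k f (f y).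
  by apply: (clear_le lz) => //; [lra|apply: sub].
have fbz : f b <= f z by lra.
have above : iter k f (f z) <= iter k f t.
  by apply: (clear_le lz) => //; [lra|exact: ltW|apply: sub => //; exact: ltW].
have skp : (s.+1 + k <= p)%N.
  rewrite leqNgt; apply/negP => skp.
  have jk : (p - s.+1 < k)%N by move: skp sp; clear; lia.
  have e : (p - s.+1 + s.+1 = p)%N by move: sp; clear; lia.
  have := clyz _ jk.
  rewrite /y /z -!iterS -!iterD e (rn_fixL J).
  by have := rn_overlap lz nt J; have := rn_ac J; lra.
have := mup _ skp; rewrite addnC !iterD /=.
rewrite -/y -/z; lra.
Qed.

Lemma room_right (R : realType) (c b theta : R) : 0 < theta ->
  b < c + (1 - c) / (1 + theta) -> b + theta * (b - c) <= 1.
Proof.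
move=> th0 bs; have th1 : 0 < 1 + theta by lra.
have : b - c <= (1 - c) / (1 + theta) by lra.
by rewrite ler_pdivlMr //; lra.
Qed.

Lemma below_half_space (R : realType) (K w x y t : R) : 0 < K ->
  x - w <= K * (t - x) -> x < t -> y - x <= K^-1 / 2 * (x - w) -> y < t.
Proof.
move=> K0 xw xt yx; suff : K^-1 / 2 * (x - w) <= (t - x) / 2 by lra.
rewrite -(ler_pM2l K0).
have -> : K * (K^-1 / 2 * (x - w)) = (x - w) / 2 by field; rewrite gt_eqF.
by lra.
Qed.

Section Family2.
Variables (R : realType) (f : R -> R) (c v w C : R).
Hypothesis lz : lorenz f c v w.
Hypothesis nt : no_trap f c.
Hypothesis C0 : 0 <= C.
Hypothesis cr : cross_ratio_bound f c C.
Hypothesis unb : unbounded_renorm f c v w.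
Hypothesis dbl : doubling_right f c w.

Variable u : R.
Hypothesis uc : u < c.
Hypothesis au : forall a b p q, renorm f c v w a b p q -> a <= u.
Hypothesis usup : forall x, x < u -> exists a b p q,
  renorm f c v w a b p q /\ x < a.
Hypothesis binf : forall x, c < x -> exists a b p q,
  renorm f c v w a b p q /\ b < x.

(** If an interval f^k(w, f b) of the right half were the shortest one, f^k would
    be monotone on a definite neighbourhood of (w, f b). This contains the image of
    the interval of the cycle next to [b], whose image under f^k would then be
    shorter still. *)
Lemma right_not_shortest : exists N, forall a b p q mu k,
  renorm f c v w a b p q -> (N <= p)%N -> (k <= q)%N ->
  cycle_lb f v w a b p q mu -> iter k f (f b) - iter k f w <> mu.
Proof.
have v1 := v_lt1 lz nt unb.
have lz' := lorenz_flip lz; have nt' := no_trap_flip nt.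
have unb' := unbounded_renorm_flip unb.
have w0 : 0 < w by have := v_lt1 lz' nt' unb'; lra.
have [dR [NR [dR0 lbR]]] := fa_lb lz' nt' unb'.
set K := koebe_const C.
have K0 : 0 < K by rewrite /K /koebe_const mulr_gt0 // expR_gt0.
have [theta th0 thP] := dbl (eta := K^-1 / 2) ltac:(rewrite divr_gt0 // invr_gt0; lra).
have [N1 tail] := cycle_interval_near_b lz nt C0 cr unb uc au usup th0.
have c1 := lz_c1 lz.
have sp0 : 0 < (1 - c) / (1 + theta) by rewrite divr_gt0 //; lra.
have [aB [bB [pB [qB [JB bBs]]]]] := binf (x := c + (1 - c) / (1 + theta)) ltac:(lra).
have [N2 sm] := small_of_many (eta := Num.min dR w)
  ltac:(rewrite lt_min dR0 /=; lra).
have [aM [bM [pM [qM [JM pMN qMN]]]]] := unb (N2 + NR)%N.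
exists (N1 + pM.+1 + pB.+1)%N => a b p q mu k J pN kq cyc eqmu.
have [pN1 pMp pBp] : [/\ (N1 <= p)%N, (pM < p)%N & (pB < p)%N].
  by move: pN; clear; split; lia.
have [_ _ qMq] := rn_ltp lz nt JM J pMp.
have [_ bbB _] := rn_ltp lz nt JB J pBp.
have [qN2 qNR] : (N2 <= q)%N /\ (NR <= q)%N by move: qMN qMq; clear; lia.
have [a0 ac cb b1] := rn_bnds J.
have [mu0 mup muq pmu qmu] := cyc.
have [mudR muw] : mu < dR /\ mu < w by apply/andP; rewrite -lt_min; apply: (sm q).
have [s [sp bs zs]] := tail _ _ _ _ J pN1.
have := lbR _ _ _ _ (renorm_flip J) qNR; rewrite /flip subKr => fbd.
have mub : mu <= 1 - f b by exact: le_trans (ltW mudR) fbd.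
have [t0 [t [[t00 t0w fbt t1 cl] [_ ft _ tb]]]] :=
  koebe_space_right lz nt C0 cr J kq cyc eqmu mub (ltW muw).
have thb := room_right th0 (lt_trans bbB bBs).
have [_ wfb _] := rn_fb lz J.
have ftht := below_half_space K0 tb fbt (thP b cb thb).
have fzt : f (iter s f v) < t.
  apply: le_lt_trans ftht; move: zs; rewrite le_eqVlt => /orP[/eqP->//|zs].
  have [_ g _] := rn_lt lz J (ltnW sp).
  exact/ltW/(lz_incR lz (lt_le_trans cb (le_trans bs (ltW g))) zs).
have clz := clear_sub lz t00 (ltW (lt_trans t0w wfb)) (ltW fbt) (lexx t) t1 cl.
have := cycle_interval_long lz nt J cyc sp bs fzt t1 clz.
by rewrite ft lerD2l ler_pdivlMr //; lra.
Qed.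

End Family2.

Section Shrink.
Variables (R : realType) (f : R -> R) (c v w C : R).
Hypothesis lz : lorenz f c v w.
Hypothesis nt : no_trap f c.
Hypothesis C0 : 0 <= C.
Hypothesis cr : cross_ratio_bound f c C.
Hypothesis unb : unbounded_renorm f c v w.
Hypothesis dbl : doubling_right f c w.

(** Let [u] < c be the supremum of the left endpoints. The shortest interval of a
    deep cycle cannot belong to the left half. It cannot belong to the right half
    either: by symmetry if the right endpoints stay away from c, and by the doubling
    property otherwise. *)
Lemma renorm_shrink_left x : x < c -> exists a b p q,
  renorm f c v w a b p q /\ x < a.
Proof.
move=> xc; have [//|none] := pselect (exists a b p q,
  renorm f c v w a b p q /\ x < a).
have lz' := lorenz_flip lz; have nt' := no_trap_flip nt.
have unb' := unbounded_renorm_flip unb; have cr' := cross_ratio_flip cr.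
pose A := [set a | exists b p q, renorm f c v w a b p q].
have ubA : ubound A x.
  move=> a [b [p [q J]]]; rewrite leNgt; apply/negP => xa.
  by apply: none; exists a, b, p, q.
have A0 : A !=set0.
  by have [a [b [p [q [J _ _]]]]] := unb 0%N; exists a, b, p, q.
have supA : has_sup A by split=> //; exists x.
set u := sup A.
have uc : u < c by apply: le_lt_trans xc; apply: ge_sup.
have au a b p q : renorm f c v w a b p q -> a <= u.
  move=> J; apply: (ub_le_sup (proj2 supA)); by exists b, p, q.
have usup y : y < u -> exists a b p q, renorm f c v w a b p q /\ y < a.
  move=> yu; have [a [b [p [q J]]] ya] := sup_gt A0 yu.
  by exists a, b, p, q.
have [N1 nL] := left_not_shortest lz nt C0 cr unb uc au usup.
suff [N2 nR] : exists N, forall a b p q mu k, renorm f c v w a b p q ->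
    (N <= p)%N -> (N <= q)%N -> (k <= q)%N -> cycle_lb f v w a b p q mu ->
    iter k f (f b) - iter k f w <> mu.
  have [a [b [p [q [J pN qN]]]]] := unb (N1 + N2)%N.
  have [h1 h2 h3] : [/\ (N1 <= p)%N, (N2 <= p)%N & (N2 <= q)%N].
    by move: pN qN; clear; split; lia.
  have [mu [cyc [[k kp e]|[k kq e]]]] := cycle_lb_ex lz J.
    by case: (nL _ _ _ _ _ _ J h1 kp cyc e).
  by case: (nR _ _ _ _ _ _ J h2 h3 kq cyc e).
have [[y cy yb]|inf] := pselect (exists2 y, c < y & forall a b p q,
    renorm f c v w a b p q -> y <= b); last first.
  have [|N h] := right_not_shortest lz nt C0 cr unb dbl uc au usup.
    move=> y cy; have [//|no] := pselect (exists a b p q,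
      renorm f c v w a b p q /\ b < y).
    case: inf; exists y => // a b p q J; rewrite leNgt; apply/negP => yb.
    by apply: no; exists a, b, p, q.
  exists N => a b p q mu k J pN qN; exact: (h _ _ _ _ _ _ J pN).
pose B := [set a | exists b p q, renorm (flip f) (1 - c) (1 - w) (1 - v) a b p q].
have ubB : ubound B (1 - y).
  by move=> a [b [p [q /renorm_unflip/yb]]]; lra.
have B0 : B !=set0.
  by have [a [b [p [q [J _ _]]]]] := unb' 0%N; exists a, b, p, q.
have supB : has_sup B by split=> //; exists (1 - y).
set u' := sup B.
have uc' : u' < 1 - c.
  have : u' <= 1 - y by apply: ge_sup.
  lra.
have au' a b p q : renorm (flip f) (1 - c) (1 - w) (1 - v) a b p q -> a <= u'.
  move=> J; apply: (ub_le_sup (proj2 supB)); by exists b, p, q.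
have usup' z : z < u' -> exists a b p q,
    renorm (flip f) (1 - c) (1 - w) (1 - v) a b p q /\ z < a.
  move=> zu; have [a [b [p [q J]]] za] := sup_gt B0 zu.
  by exists a, b, p, q.
have [N h] := left_not_shortest lz' nt' C0 cr' unb' uc' au' usup'.
exists N => a b p q mu k J pN qN kq cyc e.
apply: (h _ _ _ _ _ _ (renorm_flip J) qN kq (cycle_lb_flip cyc)).
by rewrite /flip !subKr !iter_flip !subKr; lra.
Qed.

End Shrink.

Lemma renorm_shrink (R : realType) (f : R -> R) c v w C eps :
  lorenz f c v w -> no_trap f c -> 0 <= C -> cross_ratio_bound f c C ->
  doubling_right f c w -> doubling_right (flip f) (1 - c) (1 - v) ->
  unbounded_renorm f c v w -> 0 < eps ->
  forall N, exists a b p q,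
    [/\ renorm f c v w a b p q, c - eps < a, b < c + eps, (N <= p)%N & (N <= q)%N].
Proof.
move=> lz nt C0 cr dR dL unb e0 N.
have [a1 [b1 [p1 [q1 [J1 h1]]]]] :=
  renorm_shrink_left lz nt C0 cr unb dR (x := c - eps) ltac:(lra).
have [a2 [b2 [p2 [q2 [/renorm_unflip J2 h2]]]]] :=
  renorm_shrink_left (lorenz_flip lz) (no_trap_flip nt) C0 (cross_ratio_flip cr)
    (unbounded_renorm_flip unb) dL (x := 1 - c - eps) ltac:(lra).
have [a [b [p [q [J pN qN]]]]] := unb (p1.+1 + q2.+1 + N)%N.
have [k1 k2 [k3 k4]] : [/\ (p1 < p)%N, (q2 < p)%N & (N <= p)%N /\ (N <= q)%N].
  by move: pN qN; clear; split; lia.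
have [g1 _ _] := rn_ltp lz nt J1 J k1; have [_ g2 _] := rn_ltp lz nt J2 J k2.
by exists a, b, p, q; split=> //; lra.
Qed.

(** * Orbits that accumulate at the critical point *)

Definition acc (R : realType) (s : nat -> R) (z : R) : Prop :=
  forall eps, 0 < eps -> forall N, exists n, (N <= n)%N /\ `|s n - z| < eps.

Definition orbit_of (R : realType) (f : R -> R) (x : R) (n : nat) : R := iter n f x.

Definition free (R : realType) (f : R -> R) (c x : R) : Prop :=
  forall n, iter n f x <> c.

Definition cont_off (R : realType) (f : R -> R) (c : R) : Prop :=
  forall x, 0 <= x -> x <= 1 -> x <> c -> forall eps, 0 < eps ->
    exists2 delta : R, 0 < delta & forall y, 0 <= y -> y <= 1 ->
      `|y - x| < delta -> `|f y - f x| < eps.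

Definition shrinking_renorm (R : realType) (f : R -> R) (c v w : R) : Prop :=
  forall eps, 0 < eps -> forall N, exists a b p q,
    [/\ renorm f c v w a b p q, c - eps < a, b < c + eps, (N <= p)%N & (N <= q)%N].

Lemma acc_flip (R : realType) (f : R -> R) x z :
  acc (orbit_of f x) z -> acc (orbit_of (flip f) (1 - x)) (1 - z).
Proof.
move=> h eps e0 N; have [n [Nn hn]] := h eps e0 N; exists n; split=> //.
rewrite /orbit_of iter_flip subKr.
have -> : 1 - iter n f x - (1 - z) = - (iter n f x - z) by ring.
by rewrite normrN.
Qed.

Lemma acc_unflip (R : realType) (f : R -> R) x z :
  acc (orbit_of (flip f) (1 - x)) (1 - z) -> acc (orbit_of f x) z.
Proof. by move/acc_flip; rewrite flipK !subKr. Qed.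

Lemma free_flip (R : realType) (f : R -> R) c x :
  free f c x -> free (flip f) (1 - c) (1 - x).
Proof. by move=> h n; rewrite iter_flip subKr => e; apply: (h n); lra. Qed.

Lemma cont_off_flip (R : realType) (f : R -> R) c :
  cont_off f c -> cont_off (flip f) (1 - c).
Proof.
move=> h x x0 x1 xc eps e0.
have [||||d d0 hd] := h (1 - x) _ _ _ eps; try lra.
exists d => // y y0 y1 yx; rewrite /flip.
have -> : 1 - f (1 - y) - (1 - f (1 - x)) = - (f (1 - y) - f (1 - x)) by ring.
rewrite normrN; apply: hd; try lra.
have -> : 1 - y - (1 - x) = - (y - x) by ring.
by rewrite normrN.
Qed.

Lemma shrinking_renorm_flip (R : realType) (f : R -> R) c v w :
  shrinking_renorm f c v w -> shrinking_renorm (flip f) (1 - c) (1 - w) (1 - v).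
Proof.
move=> h eps e0 N; have [a [b [p [q [J h1 h2 h3 h4]]]]] := h eps e0 N.
by exists (1 - b), (1 - a), q, p; split=> //; [exact: renorm_flip|lra|lra].
Qed.

Lemma acc_closed (R : realType) (s t : nat -> R) z :
  (forall m, acc s (t m)) -> acc t z -> acc s z.
Proof.
move=> st tz eps e0 N.
have e2 : 0 < eps / 2 by lra.
have [m [_ hm]] := tz _ e2 0%N; have [n [Nn hn]] := st m _ e2 N.
exists n; split=> //.
have -> : s n - z = (s n - t m) + (t m - z) by ring.
by apply: (le_lt_trans (ler_normD _ _)); lra.
Qed.

Section Orbits.
Variables (R : realType) (f : R -> R) (c v w : R).
Hypothesis lz : lorenz f c v w.
Hypothesis nt : no_trap f c.
Hypothesis fc : cont_off f c.
Hypothesis shr : shrinking_renorm f c v w.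

Lemma iter_cont m x eps : 0 <= x -> x <= 1 ->
  (forall j, (j < m)%N -> iter j f x <> c) -> 0 < eps ->
  exists2 delta : R, 0 < delta & forall y, 0 <= y -> y <= 1 ->
    `|y - x| < delta -> `|iter m f y - iter m f x| < eps /\
      forall j, (j < m)%N -> iter j f y <> c.
Proof.
move=> x0 x1; elim: m eps => [|m IHm] eps av e0.
  by exists eps => // y y0 y1 yx; split.
have avm j : (j < m)%N -> iter j f x <> c by move=> jm; apply/av/leqW.
have /andP[m0 m1] := iter_range lz x0 x1 avm.
have mc := av m (ltnSn m).
have [d d0 hd] := fc m0 m1 mc e0.
have [|d' d'0 hd'] := IHm (Num.min d `|iter m f x - c|) avm.
  by rewrite lt_min d0 normr_gt0 subr_eq0; apply/eqP.
exists d' => // y y0 y1 yx; have [] := hd' y y0 y1 yx.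
rewrite lt_min => /andP[h1 h2] avy.
have /andP[my0 my1] := iter_range lz y0 y1 avy.
split; first by apply: hd.
move=> j; rewrite ltnS leq_eqVlt => /orP[/eqP-> e|]; last exact: avy.
by move: h2; rewrite e -normrN opprB ltxx.
Qed.

Lemma v_free : free f c v.
Proof.
move=> n e; have [a [b [p [q [J _ _ np _]]]]] := shr ltr01 n.+1.
have [_ h _] := rn_lt lz J (ltnW np).
by have := rn_outL J np; have := rn_ac J; have := rn_cb J; lra.
Qed.

(** An orbit that eventually avoids (a, c) could not return close to [c], where the
    right branch of the return map sends it to (a, c). *)
Lemma visit_left x a b p q : free f c x -> acc (orbit_of f x) c ->
  renorm f c v w a b p q ->
  forall N, exists n, [/\ (N <= n)%N, a < iter n f x & iter n f x < c].
Proof.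
move=> fx xc J N.
have [a0 ac cb b1] := rn_bnds J.
have [t [ct tb ft]] := rn_overlap_ptR lz nt J.
have [|n [Nn]] := xc (Num.min (t - c) (c - a)) _ N; first by rewrite lt_min; lra.
rewrite lt_min /orbit_of => /andP[h1 h2].
have [ln|ln] := ltrP (iter n f x) c.
  by exists n; split=> //; move: h2; rewrite ltr_norml; lra.
have cn : c < iter n f x.
  by rewrite lt_neqAle ln andbT; apply/eqP => e; apply: (fx n).
have nx : iter n f x < t by move: h1; rewrite ltr_norml; lra.
have [r1 r2] := rn_returnR lz J cn (lt_trans nx tb).
have r3 := rn_return_ltR lz J cn nx (ltW tb).
have e : iter (q.+1 + n) f x = iter q.+1 f (iter n f x) by rewrite iterD.
exists (q.+1 + n)%N; rewrite e; split; first by apply: leq_trans Nn (leq_addl _ _).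
  by have := rn_retR J; lra.
by lra.
Qed.

(** The orbit passes through (a, c) for every renormalization interval, hence
    through left neighbourhoods of [c] that [f] maps close to v. *)
Lemma acc_v_orbit x : 0 <= x -> x <= 1 -> free f c x -> acc (orbit_of f x) c ->
  forall m, acc (orbit_of f x) (iter m f v).
Proof.
move=> x0 x1 fx xc m eps e0 N.
have v0 := lz_v0 lz; have v1 := lz_v1 lz.
have [d d0 hd] := iter_cont (m := m) (ltW v0) v1 (fun j _ => v_free (n := j)) e0.
set y := Num.max 0 (v - d / 2).
have y0 : 0 <= y by rewrite /y le_max lexx.
have yd : v - d / 2 <= y by rewrite /y le_max lexx orbT.
have yv : y < v by rewrite /y gt_max v0 /=; lra.
have [s [s0 sc fs]] := lz_surL lz y0 yv.
have [a [b [p [q [J sa _ _ _]]]]] := shr (eps := c - s) ltac:(lra) 0%N.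
have [n [Nn an nc]] := visit_left fx xc J N.
have h1 : f s < f (iter n f x) by apply: (lz_incL lz) => //; lra.
have h2 : f (iter n f x) < v by apply: (lz_supL lz) => //; lra.
exists (m + n.+1)%N; split; first by apply: leq_trans Nn (leq_trans (leqnSn n) (leq_addl m _)).
rewrite /orbit_of iterD; have [] // := hd (iter n.+1 f x).
- by rewrite /=; lra.
- by rewrite /=; lra.
- by rewrite ltr_norml /=; lra.
Qed.

Lemma v_acc_c : acc (orbit_of f v) c.
Proof.
move=> eps e0 N; have [a [b [p [q [J h1 h2 h3 _]]]]] := shr e0 N.
exists p; split=> //; rewrite /orbit_of ltr_norml.
by have := rn_overlap lz nt J; have := rn_retL J; lra.
Qed.

End Orbits.

Section OrbitsR.
Variables (R : realType) (f : R -> R) (c v w : R).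
Hypothesis lz : lorenz f c v w.
Hypothesis nt : no_trap f c.
Hypothesis fc : cont_off f c.
Hypothesis shr : shrinking_renorm f c v w.
Let lz' := lorenz_flip lz. Let nt' := no_trap_flip nt.
Let fc' := cont_off_flip fc. Let shr' := shrinking_renorm_flip shr.

Lemma w_free : free f c w.
Proof. by have := free_flip (v_free lz' shr'); rewrite flipK !subKr. Qed.

Lemma acc_w_orbit x : 0 <= x -> x <= 1 -> free f c x -> acc (orbit_of f x) c ->
  forall m, acc (orbit_of f x) (iter m f w).
Proof.
move=> x0 x1 fx xc m; apply: acc_unflip.
have := acc_v_orbit lz' nt' fc' shr' (x := 1 - x) ltac:(lra) ltac:(lra)
  (free_flip fx) (acc_flip xc) m.
by rewrite iter_flip subKr.
Qed.

Lemma w_acc_c : acc (orbit_of f w) c.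
Proof. exact: acc_unflip (v_acc_c lz' nt' shr'). Qed.

Lemma lz_v01 : 0 <= v <= 1.
Proof. by have := lz_v0 lz; have := lz_v1 lz; lra. Qed.

Lemma lz_w01 : 0 <= w <= 1.
Proof. by have := lz_v0 lz'; have := lz_w0 lz; lra. Qed.

(** Each critical orbit accumulates at [c], and hence at all points of the other. *)
Lemma acc_vw z : acc (orbit_of f v) z <-> acc (orbit_of f w) z.
Proof.
have /andP[v0 v1] := lz_v01; have /andP[w0 w1] := lz_w01.
split=> h; apply: acc_closed h.
- exact: (acc_v_orbit lz nt fc shr w0 w1 w_free w_acc_c).
- exact: (acc_w_orbit v0 v1 (v_free lz shr) (v_acc_c lz nt shr)).
Qed.

Lemma acc_v_acc x z : 0 <= x -> x <= 1 -> free f c x -> acc (orbit_of f x) c ->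
  acc (orbit_of f v) z -> acc (orbit_of f x) z.
Proof.
move=> x0 x1 fx xc; apply: acc_closed.
exact: (acc_v_orbit lz nt fc shr x0 x1 fx xc).
Qed.

End OrbitsR.

(** ** Following an orbit along the cycle *)

(** Between the critical values of the first return map, f^q(w) and f^p(v), the
    orbit moves along the intervals of the cycle. *)
Definition on_cycle (R : realType) (f : R -> R) (c v w : R) (p q : nat) (y : R) (i : nat)
    : Prop :=
  (iter q f w < y /\ y < c /\ (i <= p)%N) \/ (c < y /\ y < iter p f v /\ (i <= q)%N).

Definition returns_at (R : realType) (f : R -> R) (a b z eps : R) (k : nat) : Prop :=
  [/\ (0 < k)%N,
      forall t, `|t - z| < eps -> a <= iter k f t <= b,
      forall t j, `|t - z| < eps -> (0 < j)%N -> (j < k)%N ->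
        ~ (a <= iter j f t /\ iter j f t <= b)
    & forall s t, `|s - z| < eps -> `|t - z| < eps -> s < t ->
        iter k f s < iter k f t].

Lemma returns_at_unflip (R : realType) (f : R -> R) a b z eps k :
  returns_at (flip f) (1 - b) (1 - a) (1 - z) eps k -> returns_at f a b z eps k.
Proof.
case=> k0 h1 h2 h3.
have nf t : `|t - z| < eps -> `|1 - t - (1 - z)| < eps.
  have -> : 1 - t - (1 - z) = - (t - z) by ring.
  by rewrite normrN.
split=> //.
- by move=> t /nf /h1; rewrite iter_flip subKr; lra.
- by move=> t j /nf tz j0 jk; have := h2 _ _ tz j0 jk; rewrite iter_flip subKr; lra.
- move=> s t /nf hs /nf ht st; have := h3 _ _ ht hs ltac:(lra).
  by rewrite !iter_flip !subKr; lra.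
Qed.

Section Follow.
Variables (R : realType) (f : R -> R) (c v w : R).
Hypothesis lz : lorenz f c v w.
Hypothesis nt : no_trap f c.
Hypothesis fc : cont_off f c.
Hypothesis shr : shrinking_renorm f c v w.

Lemma on_cycle_next a b p q x n y i : renorm f c v w a b p q -> free f c x ->
  iter n f x = iter i f y -> on_cycle f c v w p q y i ->
  exists y' i', iter n.+1 f x = iter i' f y' /\ on_cycle f c v w p q y' i'.
Proof.
move=> J fx e on.
have [a0 ac cb b1] := rn_bnds J.
have ovL := rn_overlap lz nt J; have ovR := rn_overlapR lz nt J.
have rL := rn_retL J; have rR := rn_retR J.
case: on => [[h1 [h2 h3]]|[h1 [h2 h3]]].
- have [ip|ip] := ltnP i p.
    by exists y, i.+1; split; [rewrite /= e|left].
  have ei : i = p by apply/eqP; rewrite eqn_leq h3 ip.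
  exists (iter p.+1 f y), 0%N; split; first by rewrite /= e ei.
  have ay : a < y by lra.
  have [g1 g2] := rn_return lz J ay h2; have g3 := rn_climb lz nt J ay h2.
  have nc : iter p.+1 f y <> c by move=> e'; apply: (fx n.+1); rewrite /= e ei.
  case: (ltrgtP (iter p.+1 f y) c) => // h.
    by left; split; [lra|].
  by right; split.
- have [ip|ip] := ltnP i q.
    by exists y, i.+1; split; [rewrite /= e|right].
  have ei : i = q by apply/eqP; rewrite eqn_leq h3 ip.
  exists (iter q.+1 f y), 0%N; split; first by rewrite /= e ei.
  have yb : y < b by lra.
  have [g1 g2] := rn_returnR lz J h1 yb; have g3 := rn_climbR lz nt J h1 yb.
  have nc : iter q.+1 f y <> c by move=> e'; apply: (fx n.+1); rewrite /= e ei.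
  case: (ltrgtP (iter q.+1 f y) c) => // h.
    by left; split.
  by right; split=> //; split=> //; lra.
Qed.

(** A visit of the orbit to (f^q(w), c), to the left of [c], puts it on the cycle for
    good. *)
Lemma eventually_on_cycle a b p q x : renorm f c v w a b p q -> free f c x ->
  acc (orbit_of f x) c -> exists N, forall n, (N <= n)%N ->
    exists y i, iter n f x = iter i f y /\ on_cycle f c v w p q y i.
Proof.
move=> J fx xc; have ovR := rn_overlapR lz nt J.
have [a' [b' [p' [q' [J' h _ _ _]]]]] := shr (eps := c - iter q f w) ltac:(lra) 0%N.
have [N [_ h1 h2]] := visit_left lz nt fx xc J' 0%N.
exists N; elim=> [|n IHn] Nn.
  exists (iter 0 f x), 0%N; split=> //.
  by have e : N = 0%N by [apply/eqP; rewrite -leqn0]; rewrite e in h1 h2; left; split=> //; lra.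
move: Nn; rewrite leq_eqVlt => /orP[/eqP <-|].
  by exists (iter N f x), 0%N; split=> //; left; split=> //; lra.
rewrite ltnS => /IHn[y [i [e on]]]; exact: (on_cycle_next J fx e on).
Qed.

(** The endpoints of f^i(f^q(w), c) are [c] or points of the critical orbits. So this
    interval contains the neighbourhood of [z], and it returns after p + 1 - i steps. *)
Lemma cycle_returns_left a b p q y i z eps : renorm f c v w a b p q ->
  (forall m, eps <= `|iter m f v - z|) -> (forall m, eps <= `|iter m f w - z|) ->
  eps <= `|c - z| -> 0 < eps ->
  iter q f w < y -> y < c -> (i <= p)%N -> `|iter i f y - z| < eps ->
  exists k, returns_at f a b z eps k.
Proof.
move=> J hv hw hc e0 ky yc ip yz.
have [a0 ac cb b1] := rn_bnds J; have c1 := lz_c1 lz.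
have rR := rn_retR J; have rL := rn_retL J.
set kap := iter q f w in ky rR.
have all_Z t : `|t - z| < eps -> exists s, [/\ kap < s, s < c & iter i f s = t].
  move=> tz; move: ip yz; case: i => [|i] ip yz.
    exists t; split=> //; have := hw q; rewrite -/kap; move: tz yz hc;
      rewrite !ltr_norml !ler_normr /=; lra.
  have fk0 : 0 <= f kap.
    by have /andP[] : 0 <= f kap <= 1 by apply: (lz_range lz) => //; lra.
  have h1 : f kap < f y by apply: (lz_incL lz); lra.
  have h2 : f y < v by apply: (lz_supL lz); lra.
  have v1 := lz_v1 lz.
  have fak : f a <= f kap.
    move: rR; rewrite le_eqVlt => /orP[/eqP->//|rR].
    by apply/ltW/(lz_incL lz) => //; lra.
  have [fa0 fav fa1] := rn_fa lz J.
  have cl : clear f c i (f kap) v.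
    apply: (clear_sub lz fa0 fak _ (lexx v) v1 (clear_leq (ltnW ip) (rn_clear J))); lra.
  have g1 : iter i f (f kap) < iter i f (f y).
    apply: (clear_lt lz fk0 h1 (ltW (lt_le_trans h2 v1))).
    exact: (clear_sub lz fk0 (lexx _) (ltW h1) (ltW h2) v1 cl).
  have g2 : iter i f (f y) < iter i f v.
    apply: (clear_lt lz (le_trans fk0 (ltW h1)) h2 v1).
    exact: (clear_sub lz fk0 (ltW h1) (ltW h2) (lexx v) v1 cl).
  have o1 := hv i; have o2 := hw (i.+1 + q)%N.
  rewrite iterD iterSr -/kap in o2.
  rewrite iterSr in yz.
  have [k1 k2] : iter i f (f kap) < t /\ t < iter i f v.
    by clear -yz o1 o2 g1 g2 tz; move: yz o1 o2 tz; rewrite !ltr_norml !ler_normr; lra.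
  have kv : f kap <= v by lra.
  have [s [s1 s2 fs]] := iter_ivt lz fk0 kv v1 cl (ltW k1) (ltW k2).
  have sv : s < v by rewrite lt_neqAle s2 andbT; apply/eqP => e; move: k2; rewrite -fs e ltxx.
  have ks : f kap < s by rewrite lt_neqAle s1 andbT; apply/eqP => e; move: k1; rewrite -fs e ltxx.
  have [x [xa xc fx]] := rn_pt lz J (le_lt_trans fak ks) sv.
  exists x; split=> //; last by rewrite iterSr fx.
  rewrite ltNge; apply/negP; rewrite le_eqVlt => /orP[/eqP e|h].
    by move: ks; rewrite -fx e ltxx.
  have := lz_incL lz (le_trans a0 (ltW xa)) h (lt_trans ky yc).
  by rewrite fx => /(lt_trans ks); rewrite ltxx.
have e t s : iter i f s = t -> iter (p.+1 - i) f t = iter p.+1 f s.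
  by move=> <-; rewrite -iterD subnK // leqW.
exists (p.+1 - i)%N; split.
- by rewrite subn_gt0 ltnS.
- move=> t /all_Z[s [s1 s2 fs]]; rewrite (e _ _ fs).
  by have [] := rn_return lz J (x := s) ltac:(lra) s2; lra.
- move=> t j /all_Z[s [s1 s2 fs]] j0 jk; rewrite -fs -iterD => out.
  have jp : (j.-1 + i < p)%N by move: j0 jk; clear; lia.
  have := rn_out lz J (x := s) (j := j.-1 + i) ltac:(lra) s2 jp.
  by rewrite -addSn prednK //; lra.
- move=> t t' /all_Z[s [s1 s2 fs]] /all_Z[s' [s1' s2' fs']] tt'.
  rewrite (e _ _ fs) (e _ _ fs'); apply: (rn_return_lt lz J) => //; first lra.
  rewrite ltNge; apply/negP => ss'.
  suff : iter i f s' <= iter i f s by rewrite fs fs' leNgt tt'.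
  have s'0 := le_trans (le_trans a0 rR) (ltW s1'); have s_1 := ltW (lt_trans s2 c1).
  have cl : clear f c i s' s.
    apply: (avoid_clear lz s'0 ss' s_1) => x j x1 x2 ji.
    apply: (rn_avoid lz J); last exact: ltnW (leq_trans ji ip).
      exact: le_lt_trans rR (lt_le_trans s1' x1).
    exact: le_lt_trans x2 s2.
  exact: (clear_le lz s'0 ss' s_1 cl).
Qed.

End Follow.

Section Minimal.
Variables (R : realType) (f : R -> R) (c v w : R).
Hypothesis lz : lorenz f c v w.
Hypothesis nt : no_trap f c.
Hypothesis fc : cont_off f c.
Hypothesis shr : shrinking_renorm f c v w.

(** Suppose that the orbit of [x] accumulates at some [z] but the critical orbits
    stay out of a neighbourhood Z of z. For every renormalization interval, the
    orbit of [x] then passes through Z inside an interval of the cycle that contains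
    all of Z. Hence Z moves monotonically until it enters (a, b), at a time which
    is unbounded since (a, b) shrinks to [c]. But the orbit of [x] returns to Z. *)
Lemma acc_acc_v x z : 0 <= x -> x <= 1 -> free f c x -> acc (orbit_of f x) c ->
  acc (orbit_of f x) z -> acc (orbit_of f v) z.
Proof.
move=> x0 x1 fx xc xz; have [//|nv] := pselect (acc (orbit_of f v) z).
have /andP[v0 v1] := lz_v01 lz.
have [e [e0 far]] : exists e : R, 0 < e /\ forall y, acc (orbit_of f v) y -> e <= `|y - z|.
  have [//|none] := pselect (exists e : R, 0 < e /\
    forall y, acc (orbit_of f v) y -> e <= `|y - z|).
  case: nv => eps e0 N.
  have [y [hy yz]] : exists y, acc (orbit_of f v) y /\ `|y - z| < eps / 2.
    have [//|no] := pselect (exists y, acc (orbit_of f v) y /\ `|y - z| < eps / 2).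
    case: none; exists (eps / 2); split; first lra.
    by move=> y hy; rewrite leNgt; apply/negP => h; apply: no; exists y.
  have [n [Nn hn]] := hy (eps / 2) ltac:(lra) N; exists n; split=> //.
  have -> : orbit_of f v n - z = (orbit_of f v n - y) + (y - z) by ring.
  by apply: (le_lt_trans (ler_normD _ _)); lra.
have vc := v_acc_c lz nt shr; have vf := v_free lz shr.
have hv m : e <= `|iter m f v - z|.
  exact/far/(acc_v_orbit lz nt fc shr v0 v1 vf vc).
have hw m : e <= `|iter m f w - z|.
  exact/far/(acc_w_orbit lz nt fc shr v0 v1 vf vc).
have hc : e <= `|c - z| by apply: far.
have [n1 [_ z1]] := xz e e0 0%N; have [n2 [n12 z2]] := xz e e0 n1.+1.
rewrite /orbit_of in z1 z2.
set m := (n2 - n1)%N; have m0 : (0 < m)%N by rewrite /m subn_gt0.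
have em : iter n2 f x = iter m f (iter n1 f x) by rewrite -iterD subnK // ltnW.
have ret a b p q : renorm f c v w a b p q -> exists k, returns_at f a b z e k.
  move=> J; have [N on] := eventually_on_cycle lz nt shr J fx xc.
  have [n [Nn nz]] := xz e e0 N.
  have [y [i [ey oc]]] := on n Nn; rewrite /orbit_of ey in nz.
  case: oc => [[h1 [h2 h3]]|[h1 [h2 h3]]].
    exact: (cycle_returns_left lz J hv hw hc e0 h1 h2 h3 nz).
  have fl u : `|1 - u - (1 - z)| = `|u - z|.
    have -> : 1 - u - (1 - z) = - (u - z) by ring.
    by rewrite normrN.
  have hv' l : e <= `|iter l (flip f) (1 - v) - (1 - z)| by rewrite iter_flip subKr fl.
  have hw' l : e <= `|iter l (flip f) (1 - w) - (1 - z)| by rewrite iter_flip subKr fl.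
  have hc' : e <= `|1 - c - (1 - z)| by rewrite fl.
  have nz' : `|iter i (flip f) (1 - y) - (1 - z)| < e by rewrite iter_flip subKr fl.
  have y1 : iter p (flip f) (1 - v) < 1 - y by rewrite iter_flip subKr; lra.
  have y2 : 1 - y < 1 - c by lra.
  have [k hk] := cycle_returns_left (lorenz_flip lz) (renorm_flip J) hw' hv' hc' e0
    y1 y2 h3 nz'.
  by exists k; apply: returns_at_unflip.
exfalso.
pose z' := z + e / 2; have zlt : z < z' by rewrite /z'; lra.
have zz : `|z - z| < e by rewrite subrr normr0.
have zz' : `|z' - z| < e by rewrite /z' addrAC subrr add0r gtr0_norm; lra.
pose g k := if iter k f z < iter k f z' then iter k f z' - iter k f z else 1.
have [d d0 hd] : exists2 d : R, 0 < d & forall k, (k <= m)%N -> d <= g k.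
  by apply: min_pos => k _; rewrite /g; case: ifP => // h; rewrite subr_gt0.
have [a [b [p [q [J ha hb _ _]]]]] := shr (eps := d / 4) ltac:(lra) 0%N.
have [k [k0 h1 h2 h3]] := ret _ _ _ _ J.
have [km|km] := leqP k m.
  have := hd k km; have lt := h3 z z' zz zz' zlt.
  rewrite /g lt; have /andP[u1 u2] := h1 _ zz; have /andP[u3 u4] := h1 _ zz'.
  by clear -d0 ha hb u1 u2 u3 u4; lra.
apply: (h2 _ (k - m)%N z2).
- by rewrite subn_gt0.
- by rewrite ltn_subrL m0 k0.
- by rewrite em -iterD subnK ?(ltnW km) //; have := h1 _ z1; lra.
Qed.

(** Points of the limit set pass near [c] within a bounded time, because orbits
    that move along a cycle do. *)
Lemma acc_v_return z a b p q : 0 <= z -> z <= 1 -> free f c z ->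
  acc (orbit_of f v) z -> renorm f c v w a b p q ->
  exists i, a <= iter i f z <= b.
Proof.
move=> z0 z1 zf vz J; have [//|none] := pselect (exists i, a <= iter i f z <= b).
have /andP[v0 v1] := lz_v01 lz.
have [N on] := eventually_on_cycle lz nt shr J (v_free lz shr) (v_acc_c lz nt shr).
have [a0 ac cb b1] := rn_bnds J.
have far M : exists2 d : R, 0 < d & forall y, 0 <= y -> y <= 1 -> `|y - z| < d ->
    forall k, (k <= M)%N -> ~ (a <= iter k f y <= b).
  elim: M => [|M [d d0 hd]].
  - pose g := Num.max (a - z) (z - b).
    have g0 : 0 < g.
      rewrite /g lt_max; have [h|h] := ltrP z a; first by rewrite subr_gt0 h.
      rewrite !subr_gt0 orbC; apply/orP; left; rewrite ltNge; apply/negP => h'.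
      by apply: none; exists 0%N; rewrite /= h h'.
    exists g => // y y0 y1 yz k; rewrite leqn0 => /eqP -> /= h.
    by move: yz; rewrite /g lt_max !ltr_norml; lra.
  - pose g := Num.max (a - iter M.+1 f z) (iter M.+1 f z - b).
    have g0 : 0 < g.
      rewrite /g lt_max; have [h|h] := ltrP (iter M.+1 f z) a; first by rewrite subr_gt0 h.
      rewrite !subr_gt0 orbC; apply/orP; left; rewrite ltNge; apply/negP => h'.
      by apply: none; exists M.+1; rewrite h h'.
    have [d' d'0 hd'] := iter_cont lz fc (m := M.+1) z0 z1 (fun j _ => zf j) g0.
    exists (Num.min d d'); first by rewrite lt_min d0.
    move=> y y0 y1; rewrite lt_min => /andP[y2 y3] k.
    rewrite leq_eqVlt => /orP[/eqP -> h|]; last by rewrite ltnS; apply: hd.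
    have [h1 _] := hd' y y0 y1 y3; move: h h1 => /andP[].
    by rewrite /g lt_max !ltr_norml; lra.
have [d d0 hd] := far (p.+1 + q.+1)%N.
have [n [Nn vn]] := vz d d0 N.
have /andP[vn0 vn1] : 0 <= iter n f v <= 1.
  by apply: (iter_range lz) => // j _; apply: v_free lz shr j.
have [y [i [e oc]]] := on n Nn.
have h := hd (iter n f v) vn0 vn1 vn; exfalso.
have rR := rn_retR J; have rL := rn_retL J.
case: oc => [[h1 [h2 h3]]|[h1 [h2 h3]]].
- apply: (h (p.+1 - i)%N); first by clear; lia.
  rewrite e -iterD subnK ?leqW //.
  by have [] := rn_return lz J (x := y) ltac:(lra) h2; lra.
- apply: (h (q.+1 - i)%N); first by clear; lia.
  rewrite e -iterD subnK ?leqW //.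
  by have [] := rn_returnR lz J (x := y) h1 ltac:(lra); lra.
Qed.

Lemma acc_v_acc_c z : 0 <= z -> z <= 1 -> free f c z ->
  (forall n, acc (orbit_of f v) (iter n f z)) -> acc (orbit_of f z) c.
Proof.
move=> z0 z1 zf vz eps e0 N.
have [a [b [p [q [J ha hb _ _]]]]] := shr e0 0%N.
have /andP[zN0 zN1] := iter_range lz z0 z1 (fun j (_ : (j < N)%N) => zf j).
have [|i] := acc_v_return zN0 zN1 _ (vz N) J.
  by move=> n; rewrite -iterD.
rewrite -iterD => h; exists (i + N)%N; split; first exact: leq_addl.
by rewrite /orbit_of ltr_norml; lra.
Qed.

End Minimal.

(** * Relative derivatives *)

Section RelativeDerivative.
Variables (R : realType) (D : set R) (f : R -> R).

Lemma derive_on_eps x : derivable_on D f -> D x -> forall eps, 0 < eps ->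
  exists2 delta : R, 0 < delta & forall y, D y -> y != x -> `|y - x| < delta ->
    `|derive_on D f x - (f y - f x) / (y - x)| < eps.
Proof.
move=> df Dx eps e0; have /cvgrPdist_lt/(_ eps e0) := df x Dx.
rewrite -/(derive_on D f x) /within /dnbhs /within /= => h.
have /nbhs_ballP[d d0 hd] := h; exists d => // y Dy yx yd.
by apply: hd => //; rewrite /ball /= distrC.
Qed.

Lemma derivable_on_cont x : derivable_on D f -> D x -> forall eps, 0 < eps ->
  exists2 delta : R, 0 < delta & forall y, D y -> `|y - x| < delta ->
    `|f y - f x| < eps.
Proof.
move=> df Dx eps e0; have [d d0 hd] := derive_on_eps df Dx ltr01.
set l := derive_on D f x in hd.
have L0 : 0 < `|l| + 1 by rewrite ltr_wpDl.
exists (Num.min d (eps / (`|l| + 1))); first by rewrite lt_min d0 divr_gt0.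
move=> y Dy; have [->|yx] := eqVneq y x; first by move=> _; rewrite subrr normr0.
rewrite lt_min => /andP[y1 y2].
have y0 : 0 < `|y - x| by rewrite normr_gt0 subr_eq0.
have := hd y Dy yx y1; set s := (f y - f x) / (y - x) => h.
have -> : f y - f x = s * (y - x) by rewrite /s divfK // subr_eq0.
rewrite normrM.
have : `|s| < `|l| + 1.
  have -> : s = l - (l - s) by ring.
  by apply: (le_lt_trans (ler_normB _ _)); rewrite ltrD2l.
move=> h1; apply: (lt_trans (_ : _ < (`|l| + 1) * `|y - x|)); first by rewrite ltr_pM2r.
by move: y2; rewrite ltr_pdivlMr // mulrC.
Qed.

Lemma derive_on_interior x y z : derivable_on D f ->
  (forall t, x < t -> t < y -> D t) -> x < z -> z < y ->
  is_derive z 1 f (derive_on D f z).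
Proof.
move=> df sub xz zy.
suff h : (h^-1 *: (f (h *: 1 + z) - f z)) @[h --> 0^'] --> derive_on D f z.
  apply: DeriveDef; first by apply/cvg_ex; exists (derive_on D f z).
  exact/cvg_lim.
apply/cvgrPdist_lt => eps e0.
have [d d0 hd] := derive_on_eps df (sub z xz zy) e0.
rewrite /dnbhs /within /=; apply/nbhs_ballP.
exists (Num.min d (Num.min (z - x) (y - z))) => /=.
  by rewrite !lt_min d0 !subr_gt0 xz zy.
move=> h; rewrite /ball /= sub0r normrN !lt_min => /andP[h1 /andP[h2 h3]] h0.
have [hx hy] : - (z - x) < h /\ h < y - z by move: h2 h3; rewrite !ltr_norml; lra.
have := hd (h + z); rewrite addrK => k.
have Dhz : D (h + z) by apply: sub; lra.
have {}k := k Dhz _ h1.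
rewrite scaler1; rewrite /GRing.scale /= mulrC.
by apply: k; rewrite -subr_eq0 addrK.
Qed.

Lemma derivable_on_within (A : set R) : derivable_on D f -> A `<=` D ->
  {within A, continuous f}.
Proof.
move=> df AD; apply/subspace_continuousP => x Ax; apply/cvgrPdist_lt => eps e0.
have [d d0 hd] := derivable_on_cont df (AD _ Ax) e0.
rewrite /within /=; apply/nbhs_ballP; exists d => // y yd Ay.
by rewrite distrC; apply: hd; [exact: AD|rewrite distrC].
Qed.

Lemma derive_on_MVT x y : derivable_on D f -> (forall t, x <= t -> t <= y -> D t) ->
  x < y -> exists z, [/\ x < z, z < y & f y - f x = derive_on D f z * (y - x)].
Proof.
move=> df sub xy.
have [||z zxy e] := @MVT R f (derive_on D f) x y xy.
- move=> z; rewrite in_itv /= => /andP[xz zy].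
  by apply: (derive_on_interior (x := x) (y := y)) => // t h1 h2; apply: sub; exact: ltW.
- apply: derivable_on_within => // t /=; rewrite in_itv /= => /andP[h1 h2].
  exact: sub.
by move: zxy; rewrite in_itv /= => /andP[h1 h2]; exists z.
Qed.

End RelativeDerivative.

(** * Slopes of a C^2 diffeomorphism *)

(** Over an interval T the slopes of the chords of [phi] agree up to exp(C |T|). *)
Definition slopes_bound (R : realType) (phi : R -> R) (l r C : R) : Prop :=
  forall s t x y x' y', l <= s -> t <= r -> s <= x -> x < y -> y <= t ->
    s <= x' -> x' < y' -> y' <= t ->
    (phi y - phi x) * (y' - x') <= expR (C * (t - s)) * ((phi y' - phi x') * (y - x)).

Section DiffeoSlopes.
Variables (R : realType) (l r s0 s1 : R) (phi : R -> R).
Hypothesis lr : l < r.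
Hypothesis diffeo : C2_diffeo_op `[l, r] `[s0, s1] phi.

Let D : set R := `[l, r].
Let d1 := derive_on D phi.

Let Dx x : D x <-> l <= x /\ x <= r.
Proof. by rewrite /D /= in_itv /=; split=> [/andP|[h1 h2]] //; apply/andP. Qed.

Let phi_inc x y : D x -> D y -> x < y -> phi x < phi y.
Proof. by case: diffeo => _ _ inc _ h1 h2; apply: inc; rewrite inE. Qed.

Let near_point x (d : R) : D x -> 0 < d -> exists y, [/\ D y, y != x & `|y - x| < d].
Proof.
move=> /Dx[x0 x1] d0; have lr' := lr.
have [xr|xr] := ltrP x r.
  set e := Num.min (d / 2) (r - x); exists (x + e).
  have h1 : e <= d / 2 by rewrite /e ge_min lexx.
  have h2 : e <= r - x by rewrite /e ge_min lexx orbT.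
  have h3 : 0 < e by rewrite /e lt_min; lra.
  split; [apply/Dx; lra|rewrite gt_eqF //; lra|].
  by rewrite addrC addKr gtr0_norm //; lra.
set e := Num.min (d / 2) (x - l); exists (x - e).
have h1 : e <= d / 2 by rewrite /e ge_min lexx.
have h2 : e <= x - l by rewrite /e ge_min lexx orbT.
have h3 : 0 < e by rewrite /e lt_min; lra.
split; [apply/Dx; lra|rewrite lt_eqF //; lra|].
by rewrite addrC addKr normrN gtr0_norm //; lra.
Qed.

(** The difference quotients of [phi] are inverse to those of its inverse, which
    are bounded. *)
Lemma diffeo_derive_gt0 x : D x -> 0 < d1 x.
Proof.
have [[maps _ _] [df _ _] inc [psi [psiK [dpsi _ _]]]] := diffeo.
move=> hx; set B : set R := `[s0, s1]%classic in dpsi.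
have Bphi y : D y -> B (phi y) by exact: maps.
set L := derive_on B psi (phi x).
have L0 : 0 < `|L| + 1 by rewrite ltr_wpDl.
have e0 : 0 < (`|L| + 1)^-1 / 2 by rewrite divr_gt0 // invr_gt0.
have [d d0 hd] := derive_on_eps dpsi (Bphi x hx) ltr01.
have [d' d'0 hd'] := derivable_on_cont df hx d0.
have [d'' d''0 hd''] := derive_on_eps df hx e0.
have [|y [Dy yx]] := near_point (d := Num.min d' d'') hx; first by rewrite lt_min d'0.
rewrite lt_min => /andP[y1 y2].
have h2 := hd'' y Dy yx y2; rewrite -/(d1 x) in h2.
have q0 : 0 < (phi y - phi x) / (y - x).
  case: (ltrgtP y x) yx => // h _.
    rewrite -mulrNN -invrN; apply: divr_gt0; last lra.
    by have := phi_inc Dy hx h; lra.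
  by apply: divr_gt0; have := phi_inc hx Dy h; lra.
have pxy : phi y != phi x.
  by apply/eqP => e; move: q0; rewrite e subrr mul0r ltxx.
have h1 := hd (phi y) (Bphi y Dy) pxy (hd' y Dy y1).
rewrite !psiK ?inE // -/L -[(y - x) / _]invrK invf_div in h1.
set q := (phi y - phi x) / (y - x) in h2 q0 h1.
have : q^-1 < `|L| + 1.
  have -> : q^-1 = L - (L - q^-1) by ring.
  apply: le_lt_trans (_ : `|L - (L - q^-1)| < _); first exact: ler_norm.
  by apply: (le_lt_trans (ler_normB _ _)); rewrite ltrD2l.
rewrite invf_plt ?posrE // => h3.
by move: h2; rewrite ltr_norml; lra.
Qed.

(** The logarithm of phi' is Lipschitz: phi'' is bounded, and phi' is bounded away
    from 0. *)
Lemma diffeo_slopes : exists2 C, 0 <= C & slopes_bound phi l r C.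
Proof.
have [[maps _ _] [df ddf cdd] inc _] := diffeo; have lr' := lr.
rewrite -/D -/d1 in df ddf cdd.
set d2 := derive_on D d1 in cdd.
have [xM xMD hM] := EVT_max (ltW lr) cdd.
have [xm xmD hm] := EVT_min (ltW lr) cdd.
have [x1 x1D h1] := EVT_min (ltW lr) (derivable_on_within ddf (@subset_refl _ D)).
have inD x : x \in `[l, r] <-> D x by [].
have m0 : 0 < d1 x1 by apply: diffeo_derive_gt0.
set m := d1 x1 in m0 h1.
set M := `|d2 xM| + `|d2 xm|.
have M0 : 0 <= M by rewrite addr_ge0.
have d2M x : D x -> `|d2 x| <= M.
  move=> hx; rewrite ler_norml /M.
  have k1 := hM x hx; have k2 := hm x hx.
  have k3 := ler_norm (d2 xM); have k4 := ler_norm (- d2 xm).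
  rewrite normrN in k4.
  have k5 := normr_ge0 (d2 xM); have k6 := normr_ge0 (d2 xm).
  move: k1 k2 k3 k4 k5 k6; generalize (d2 x) `|d2 xM| `|d2 xm| (d2 xM) (d2 xm).
  by clear => *; apply/andP; split; lra.
have lip x y : D x -> D y -> x <= y -> `|d1 y - d1 x| <= M * (y - x).
  move=> /Dx[x0 xr] /Dx[y0 yr]; rewrite le_eqVlt => /orP[/eqP->|xy].
    by rewrite !subrr normr0 mulr0.
  have [|z [z1 z2 ->]] := derive_on_MVT ddf _ xy.
    by move=> t t1 t2; apply/Dx; lra.
  rewrite normrM (gtr0_norm (x := y - x)) ?subr_gt0 //.
  by apply: ler_wpM2r; [lra|apply: d2M; apply/Dx; lra].
exists (M / m); first exact: divr_ge0 M0 (ltW m0).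
move=> s t x y x' y' ls tr sx xy yt sx' xy' yt'.
have [|z [z1 z2 ->]] := derive_on_MVT df _ xy.
  by move=> u u1 u2; apply/Dx; lra.
have [|z' [z1' z2' ->]] := derive_on_MVT df _ xy'.
  by move=> u u1 u2; apply/Dx; lra.
rewrite -/d1.
have Dz : D z by apply/Dx; lra.
have Dz' : D z' by apply/Dx; lra.
have mz' : m <= d1 z' := h1 z' Dz'.
have ts0 : 0 <= t - s by lra.
have key : d1 z <= d1 z' * (1 + M / m * (t - s)).
  have : d1 z - d1 z' <= M * (t - s).
    apply: le_trans (ler_norm _) _; have [zz|zz] := lerP z z'.
      rewrite distrC; apply: (le_trans (lip z z' Dz Dz' zz)).
      by apply: ler_wpM2l => //; lra.
    apply: (le_trans (lip z' z Dz' Dz (ltW zz))).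
    by apply: ler_wpM2l => //; lra.
  have : M * (t - s) <= d1 z' * (M / m * (t - s)).
    have -> : M * (t - s) = m * (M / m * (t - s)) by field; rewrite gt_eqF.
    by apply: ler_wpM2r => //; rewrite mulr_ge0 ?(divr_ge0 M0 (ltW m0)) // ts0.
  by rewrite [d1 z' * (1 + _)]mulrDr mulr1; lra.
have ex : 1 + M / m * (t - s) <= expR (M / m * (t - s)) by apply: expR_ge1Dx.
have -> : expR (M / m * (t - s)) * (d1 z' * (y' - x') * (y - x)) =
  d1 z' * expR (M / m * (t - s)) * ((y - x) * (y' - x')) by ring.
have -> : d1 z * (y - x) * (y' - x') = d1 z * ((y - x) * (y' - x')) by ring.
apply: ler_wpM2r; first by rewrite mulr_ge0 // subr_ge0 ltW.
exact: le_trans key (ler_wpM2l (le_trans (ltW m0) mz') ex).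
Qed.

End DiffeoSlopes.

(** * Cross-ratios of powers *)

Section Sinh.
Variable R : realType.

(** Twice the hyperbolic sine and cosine. *)
Definition sh (t : R) : R := expR t - expR (- t).
Definition ch (t : R) : R := expR t + expR (- t).

Lemma sh_ge0 t : 0 <= t -> 0 <= sh t.
Proof. by move=> t0; rewrite subr_ge0 ler_expR; lra. Qed.

Lemma sh_gt0 t : 0 < t -> 0 < sh t.
Proof. by move=> t0; rewrite subr_gt0 ltr_expR; lra. Qed.

Lemma is_derive_scal (al t : R) : is_derive t 1 ( *%R al) al.
Proof.
have h := is_deriveZ al (is_derive_id t (1 : R)).
have e : al *: (1 : R) = al by rewrite [al *: _]mulr1.
by rewrite e in h.
Qed.

Lemma is_derive_expR_scal (al t : R) :
  is_derive t 1 (fun t => expR (al * t)) (al * expR (al * t)).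
Proof.
rewrite mulrC.
exact: (is_derive1_comp (is_derive_expR (al * t)) (is_derive_scal al t)).
Qed.

Lemma is_derive_sh (al t : R) :
  is_derive t 1 (fun t => sh (al * t)) (al * ch (al * t)).
Proof.
have := is_deriveB (is_derive_expR_scal al t) (is_derive_expR_scal (- al) t).
have -> : al * expR (al * t) - - al * expR (- al * t) = al * ch (al * t).
  by rewrite /ch !mulNr; ring.
have -> // : ((fun t => expR (al * t)) - (fun t => expR (- al * t))) =
  (fun t => sh (al * t)).
by apply/funext => x; rewrite /sh -mulNr.
Qed.

Lemma is_derive_ch (al t : R) :
  is_derive t 1 (fun t => ch (al * t)) (al * sh (al * t)).
Proof.
have := is_deriveD (is_derive_expR_scal al t) (is_derive_expR_scal (- al) t).
have -> : al * expR (al * t) + - al * expR (- al * t) = al * sh (al * t).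
  by rewrite /sh !mulNr; ring.
have -> // : ((fun t => expR (al * t)) + (fun t => expR (- al * t))) =
  (fun t => ch (al * t)).
by apply/funext => x; rewrite /ch -mulNr.
Qed.

Lemma le_of_derive_ge0 (f df : R -> R) (a b : R) : a <= b ->
  (forall x : R, a <= x -> x <= b -> is_derive x 1 f (df x)) ->
  (forall x : R, a <= x -> x <= b -> 0 <= df x) -> f a <= f b.
Proof.
rewrite le_eqVlt => /orP[/eqP->//|ab] der pos.
have [||z] := @MVT R f df a b ab.
- by move=> x; rewrite in_itv /= => /andP[ax xb]; apply: der; exact: ltW.
- apply: derivable_within_continuous => x; rewrite in_itv /= => /andP[ax xb].
  by have [] := der x ax xb.
rewrite in_itv /= => /andP[az zb] e.
by rewrite -subr_ge0 e; apply: mulr_ge0; [apply: pos; exact: ltW|lra].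
Qed.

Lemma sh_ratio_derive_ge0 (al t : R) : 1 <= al -> 0 <= t ->
  0 <= al * ch (al * t) * sh (1 * t) - sh (al * t) * (1 * ch (1 * t)).
Proof.
move=> al1 t0.
pose W t := al * (ch (al * t) * sh (1 * t)) - sh (al * t) * ch (1 * t).
pose dW t := (al * al - 1) * (sh (al * t) * sh (1 * t)).
have -> : al * ch (al * t) * sh (1 * t) - sh (al * t) * (1 * ch (1 * t)) = W t.
  by rewrite /W; ring.
have <- : W 0 = 0 by rewrite /W !mulr0 /sh /ch oppr0 subrr !mulr0 mul0r subrr.
apply: (@le_of_derive_ge0 W dW 0 t t0) => x x0 xt.
- have h1 := is_deriveM (is_derive_ch al x) (is_derive_sh 1 x).
  have h2 := is_deriveM (is_derive_sh al x) (is_derive_ch 1 x).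
  have h3 := is_deriveB (is_deriveZ al h1) h2.
  apply: (is_derive_eq h3); rewrite /dW /GRing.scale /=; ring.
- by apply: mulr_ge0; [nra|apply: mulr_ge0; apply: sh_ge0 => //; nra].
Qed.

(** sinh (al d) / sinh d is nondecreasing for al >= 1: the numerator W of its
    derivative vanishes at 0 and W' = (al^2 - 1) sinh (al d) sinh d. *)
Lemma sh_ratio (al d d' : R) : 1 <= al -> 0 < d -> d <= d' ->
  sh (al * d) * sh d' <= sh (al * d') * sh d.
Proof.
move=> al1 d0 dd.
pose Q t := sh (al * t) * (sh (1 * t))^-1.
pose dQ t := (al * ch (al * t) * sh (1 * t) - sh (al * t) * (1 * ch (1 * t))) /
  (sh (1 * t)) ^+ 2.
have shp t : d <= t -> 0 < sh (1 * t) by move=> dt; apply: sh_gt0; lra.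
have : Q d <= Q d'.
  apply: (@le_of_derive_ge0 Q dQ d d' dd) => x x0 xt; have sx := shp x x0.
  - have sx0 : sh (1 * x) != 0 by rewrite gt_eqF.
    have h1 := is_deriveV (f := fun t => sh (1 * t)) sx0 (is_derive_sh 1 x).
    have h2 := is_deriveM (is_derive_sh al x) h1.
    apply: (is_derive_eq h2); rewrite /dQ /GRing.scale /=.
    by field.
  - apply: divr_ge0; last by rewrite exprn_ge0 // ltW.
    by apply: sh_ratio_derive_ge0 => //; lra.
have s1 := shp d (lexx d); have s2 := shp d' dd; rewrite /Q !mul1r in s1 s2 *.
by rewrite ler_pdivrMr // mulrAC ler_pdivlMr.
Qed.

Lemma expR_diff (x y : R) :
  expR y - expR x = expR ((x + y) / 2) * sh ((y - x) / 2).
Proof.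
rewrite /sh mulrBr -!expRD.
have -> : (x + y) / 2 + (y - x) / 2 = y by lra.
by have -> : (x + y) / 2 + - ((y - x) / 2) = x by lra.
Qed.

(** Powers expand the cross-ratio: in logarithmic coordinates this is the
    monotonicity of sinh (al d) / sinh d applied to the pairs (0, 1), (0, 2) and
    (2, 3), (1, 3), together with |T||M| = |L u M||M u R| - |L||R|. *)
Lemma powR_cross_ratio (al s0 s1 s2 s3 : R) : 1 <= al -> 0 < s0 -> s0 < s1 ->
  s1 < s2 -> s2 < s3 ->
  (s3 - s0) * (s2 - s1) * ((s1 `^ al - s0 `^ al) * (s3 `^ al - s2 `^ al)) <=
  (s3 `^ al - s0 `^ al) * (s2 `^ al - s1 `^ al) * ((s1 - s0) * (s3 - s2)).
Proof.
move=> al1 h0 h1 h2 h3.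
have [k1 [k2 k3]] : 0 < s1 /\ 0 < s2 /\ 0 < s3 by lra.
set P0 := s0 `^ al; set P1 := s1 `^ al; set P2 := s2 `^ al; set P3 := s3 `^ al.
suff key : (P1 - P0) * (P3 - P2) * ((s2 - s0) * (s3 - s1)) <=
           (P2 - P0) * (P3 - P1) * ((s1 - s0) * (s3 - s2)).
  have -> : (s3 - s0) * (s2 - s1) * ((P1 - P0) * (P3 - P2)) =
    (P1 - P0) * (P3 - P2) * ((s2 - s0) * (s3 - s1)) -
    (s1 - s0) * (s3 - s2) * ((P1 - P0) * (P3 - P2)) by ring.
  have -> : (P3 - P0) * (P2 - P1) * ((s1 - s0) * (s3 - s2)) =
    (P2 - P0) * (P3 - P1) * ((s1 - s0) * (s3 - s2)) -
    (s1 - s0) * (s3 - s2) * ((P1 - P0) * (P3 - P2)) by ring.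
  by rewrite lerD2r.
have e s : 0 < s -> s `^ al = expR (al * ln s).
  by move=> s0'; rewrite /powR gt_eqF.
have lnlt x y : 0 < x -> x < y -> ln x < ln y.
  by move=> x0 xy; rewrite ltr_ln ?posrE //; lra.
rewrite /P0 /P1 /P2 /P3 !e //.
set x0 := ln s0; set x1 := ln s1; set x2 := ln s2; set x3 := ln s3.
have e0 : s0 = expR x0 by rewrite lnK ?posrE.
have e1 : s1 = expR x1 by rewrite lnK ?posrE.
have e2 : s2 = expR x2 by rewrite lnK ?posrE.
have e3 : s3 = expR x3 by rewrite lnK ?posrE.
have [l1 [l2 l3]] : x0 < x1 /\ x1 < x2 /\ x2 < x3 by split; [|split]; exact: lnlt.
rewrite e0 e1 e2 e3 !expR_diff.
have half x y : x < y -> 0 <= (y - x) / 2 by move=> xy; rewrite divr_ge0 // subr_ge0 ltW.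
have sc a b : (al * b - al * a) / 2 = al * ((b - a) / 2) by ring.
rewrite !sc.
set d01 := (x1 - x0) / 2; set d23 := (x3 - x2) / 2.
set d02 := (x2 - x0) / 2; set d13 := (x3 - x1) / 2.
have r1 := sh_ratio (d := d01) (d' := d02) al1 ltac:(rewrite /d01; lra) ltac:(rewrite /d01 /d02; lra).
have r2 := sh_ratio (d := d23) (d' := d13) al1 ltac:(rewrite /d23; lra) ltac:(rewrite /d23 /d13; lra).
set E := expR ((al * x0 + al * x1 + al * x2 + al * x3) / 2) * expR ((x0 + x1 + x2 + x3) / 2).
have E1 : expR ((al * x0 + al * x1) / 2) * expR ((al * x2 + al * x3) / 2) *
    (expR ((x0 + x2) / 2) * expR ((x1 + x3) / 2)) = E.
  by rewrite /E -!expRD; congr (expR _); ring.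
have E2 : expR ((al * x0 + al * x2) / 2) * expR ((al * x1 + al * x3) / 2) *
    (expR ((x0 + x1) / 2) * expR ((x2 + x3) / 2)) = E.
  by rewrite /E -!expRD; congr (expR _); ring.
have E0 : 0 < E by rewrite /E mulr_gt0 ?expR_gt0.
apply: le_trans (_ : E * ((sh (al * d01) * sh d02) * (sh (al * d23) * sh d13)) <= _).
  by rewrite -E1 le_eqVlt; apply/orP; left; apply/eqP; ring.
apply: le_trans (_ : E * ((sh (al * d02) * sh d01) * (sh (al * d13) * sh d23)) <= _).
  have nn a b : x0 < x1 -> 0 <= a -> 0 <= b -> 0 <= sh (al * a) * sh b.
    move=> _ a0 b0; apply: mulr_ge0; apply: sh_ge0 => //; apply: mulr_ge0 => //; lra.
  have [l02 l13] := (lt_trans l1 l2, lt_trans l2 l3).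
  by rewrite ler_pM2l //; apply: ler_pM => //; apply: nn => //; exact: half.
by rewrite -E2 le_eqVlt; apply/orP; left; apply/eqP; ring.
Qed.

End Sinh.

(** * Power-law branches *)

(** The right branch of [f] is w + phi (x - e)^be for a C^2 diffeomorphism [phi];
    the shift [e] makes room for the reflection of the left branch. *)
Section PowerBranch.
Variables (R : realType) (f phi : R -> R) (c w e be : R).
Hypothesis c1 : c < 1.
Hypothesis be1 : 1 < be.
Hypothesis diffeo : C2_diffeo_op `[c - e, 1 - e] `[0, (1 - w) `^ be^-1] phi.
Hypothesis fE : forall x, c < x -> x <= 1 -> f x = w + phi (x - e) `^ be.

Let ce1 : c - e < 1 - e. Proof. by rewrite ltrD2r. Qed.

Let phi_range x : c <= x -> x <= 1 -> 0 <= phi (x - e) <= (1 - w) `^ be^-1.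
Proof.
move=> cx x1; have [[maps _ _] _ _ _] := diffeo.
have := maps (x - e); rewrite /= !in_itv /= !lerD2r => h.
by apply: h; apply/andP.
Qed.

Let phi_lt x y : c <= x -> x < y -> y <= 1 -> phi (x - e) < phi (y - e).
Proof.
move=> cx xy y1; have [_ _ inc _] := diffeo.
apply: inc; rewrite ?inE /= ?in_itv /= ?lerD2r ?ltrD2r //.
- by apply/andP; split=> //; lra.
- by apply/andP; split=> //; lra.
Qed.

Let be0 : 0 < be. Proof. exact: lt_trans be1. Qed.

Let phi_surj y : 0 <= y -> y <= (1 - w) `^ be^-1 ->
  exists x, [/\ c <= x, x <= 1 & phi (x - e) = y].
Proof.
move=> y0 y1; have [[_ _ surj] _ _ _] := diffeo.
have [|x] := surj y; first by rewrite /= in_itv /= y0 y1.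
rewrite /= in_itv /= => /andP[h1 h2] <-; exists (x + e).
by rewrite addrK -lerBlDr h1 -lerBrDr h2.
Qed.

Let phi_c : phi (c - e) = 0.
Proof.
have cl1 := c1; have [x [cx x1 px]] := phi_surj (lexx 0) (powR_ge0 _ _).
have /andP[h _] := phi_range (lexx c) (ltW c1).
apply/eqP; rewrite eq_le h andbT -px.
have [->//|ne] := eqVneq x c.
by apply/ltW/phi_lt => //; rewrite lt_neqAle eq_sym ne.
Qed.

Let phi_gt0 x : c < x -> x <= 1 -> 0 < phi (x - e).
Proof. by move=> cx x1; rewrite -phi_c; apply: phi_lt. Qed.

Let pow_lt (s t : R) : 0 <= s -> s < t -> s `^ be < t `^ be.
Proof. by move=> s0 st; apply: gt0_ltr_powR; rewrite ?nnegrE //; lra. Qed.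

Lemma branch_lt x y : c < x -> x < y -> y <= 1 -> f x < f y.
Proof.
move=> cx xy y1; rewrite !fE ?ltrD2l; try lra.
have p0 := phi_gt0 cx (le_trans (ltW xy) y1).
by apply: pow_lt; [exact: ltW|apply: phi_lt => //; exact: ltW].
Qed.

Lemma branch_gt x : c < x -> x <= 1 -> w < f x.
Proof. by move=> cx x1; rewrite fE // ltrDl powR_gt0 // phi_gt0. Qed.

Lemma branch_surj y : w < y -> y <= 1 -> exists x, [/\ c < x, x <= 1 & f x = y].
Proof.
move=> wy y1; have [||x [cx x1 px]] := phi_surj (y := (y - w) `^ be^-1).
- exact: powR_ge0.
- by apply: ge0_ler_powR; rewrite ?invr_ge0 ?nnegrE; have := ltW be0; lra.
have cx' : c < x.
  rewrite lt_neqAle cx andbT; apply/eqP => ecx.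
  have : 0 < (y - w) `^ be^-1 by rewrite powR_gt0 // subr_gt0.
  by rewrite -px -ecx phi_c ltxx.
exists x; split=> //; rewrite fE // px -powRrM mulVf ?powRr1; try lra.
by rewrite gt_eqF.
Qed.

(** When y - b is small relative to b - c, the bound on slopes gives
    phi(y) <= (1 + eta)^(1/be) phi(b); then take powers. *)
Lemma branch_doubling : doubling_right f c w.
Proof.
have [C C0 sl] := diffeo_slopes ce1 diffeo; have cl1 := c1.
move=> eta eta0; set E := expR (C * (1 - e - (c - e))).
have E0 : 0 < E by apply: expR_gt0.
set th := ((1 + eta) `^ be^-1 - 1) / E.
have g1 : 1 < (1 + eta) `^ be^-1.
  have : 1 `^ be^-1 < (1 + eta) `^ be^-1.
    by apply: gt0_ltr_powR; rewrite ?invr_gt0 ?nnegrE //; lra.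
  by rewrite powR1.
have th0 : 0 < th by rewrite divr_gt0 // subr_gt0.
exists th => // b cb; set y := b + th * (b - c) => y1.
have by_ : b < y by rewrite /y ltrDl mulr_gt0 // subr_gt0.
have b1 : b <= 1 by lra.
have := sl (c - e) (1 - e) (b - e) (y - e) (c - e) (b - e); rewrite !lerD2r !ltrD2r.
move=> /(_ (lexx _) (lexx _) (ltW cb) by_ y1 (lexx _) cb b1).
rewrite -/E phi_c subr0.
have -> : b - e - (c - e) = b - c by ring.
have -> : y - e - (b - e) = th * (b - c) by rewrite /y; ring.
have -> : E * (phi (b - e) * (th * (b - c))) = E * th * phi (b - e) * (b - c) by ring.
rewrite ler_pM2r ?subr_gt0 // => h.
have pb := phi_gt0 cb b1.
have Eth : E * th = (1 + eta) `^ be^-1 - 1 by rewrite /th mulrC divfK // gt_eqF.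
have {}h : phi (y - e) <= (1 + eta) `^ be^-1 * phi (b - e).
  by rewrite Eth in h; lra.
have py := phi_gt0 (lt_trans cb by_) y1.
rewrite !fE //; last by lra.
have : phi (y - e) `^ be <= (1 + eta) * phi (b - e) `^ be.
  have -> : (1 + eta) * phi (b - e) `^ be = ((1 + eta) `^ be^-1 * phi (b - e)) `^ be.
    rewrite powRM ?powR_ge0 //; last exact: ltW.
    rewrite -powRrM mulVf ?powRr1 //; last by rewrite gt_eqF.
    by lra.
  apply: ge0_ler_powR; rewrite ?nnegrE ?mulr_ge0 ?powR_ge0 //; exact: ltW.
lra.
Qed.

(** The power expands the cross-ratio, and [phi] changes it, as a product of two
    quotients of slopes, by at most exp(2 C |T|). *)
Lemma branch_cross_ratio : exists2 C, 0 <= C & forall t0 t1 t2 t3, c < t0 ->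
  t0 < t1 -> t1 < t2 -> t2 < t3 -> t3 <= 1 ->
  (t3 - t0) * (t2 - t1) * ((f t1 - f t0) * (f t3 - f t2)) <=
  expR (C * (t3 - t0)) *
    ((f t3 - f t0) * (f t2 - f t1) * ((t1 - t0) * (t3 - t2))).
Proof.
have [C C0 sl] := diffeo_slopes ce1 diffeo; have cl1 := c1.
exists (C * 2); first by rewrite mulr_ge0.
move=> t0 t1 t2 t3 h0 h1 h2 h3 h4; rewrite !fE; try lra.
have [ct1 ct2] : c <= t1 /\ c <= t2 by lra.
have [t01 t11 t21] : [/\ t0 <= 1, t1 <= 1 & t2 <= 1] by split; lra.
have s0 := phi_gt0 h0 t01; have s1 := phi_lt (ltW h0) h1 t11.
have s2 := phi_lt ct1 h2 t21; have s3 := phi_lt ct2 h3 h4.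
have pw := powR_cross_ratio (ltW be1) s0 s1 s2 s3.
have eq1 x y : w + x - (w + y) = x - y by ring.
rewrite !eq1.
have sl' x y x' y' : t0 <= x -> x < y -> y <= t3 -> t0 <= x' -> x' < y' -> y' <= t3 ->
    (phi (y - e) - phi (x - e)) * (y' - x') <=
    expR (C * (t3 - t0)) * ((phi (y' - e) - phi (x' - e)) * (y - x)).
  move=> k1 k2 k3 k4 k5 k6.
  have := sl (t0 - e) (t3 - e) (x - e) (y - e) (x' - e) (y' - e).
  rewrite !lerD2r !ltrD2r => /(_ (ltW h0) h4 k1 k2 k3 k4 k5 k6).
  have eq2 u u' : u - e - (u' - e) = u - u' by ring.
  by rewrite !eq2.
have h02 := lt_trans h1 h2; have h13 := lt_trans h2 h3; have h03 := lt_trans h02 h3.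
have a1 := sl' t0 t1 t0 t3 (lexx _) h1 (ltW h13) (lexx _) h03 (lexx _).
have a2 := sl' t2 t3 t1 t2 (ltW h02) h3 (lexx _) (ltW h1) h2 (ltW h3).
clear sl sl' fE.
have -> : expR (C * 2 * (t3 - t0)) = expR (C * (t3 - t0)) * expR (C * (t3 - t0)).
  by rewrite -expRD; congr expR; ring.
set E := expR (C * (t3 - t0)) in a1 a2 *.
have E0 : 0 < E by apply: expR_gt0.
set x0 := phi (t0 - e) in s0 s1 pw a1 a2 *; set x1 := phi (t1 - e) in s1 s2 pw a1 a2 *.
set x2 := phi (t2 - e) in s2 s3 pw a1 a2 *; set x3 := phi (t3 - e) in s3 pw a1 a2 *.
set P0 := x0 `^ be in pw *; set P1 := x1 `^ be in pw *.
set P2 := x2 `^ be in pw *; set P3 := x3 `^ be in pw *.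
have p1 : P0 < P1 by apply: pow_lt => //; exact: ltW.
have s01 := lt_trans s0 s1; have s02 := lt_trans s01 s2.
have p2 : P1 < P2 by apply: pow_lt => //; exact: ltW.
have p3 : P2 < P3 by apply: pow_lt => //; exact: ltW.
have D1 : 0 <= (x1 - x0) * (t3 - t0) by rewrite mulr_ge0 // subr_ge0 ltW.
have D2 : 0 <= (x3 - x2) * (t2 - t1) by rewrite mulr_ge0 // subr_ge0 ltW.
have a12 := ler_pM D1 D2 a1 a2.
set X := (x3 - x0) * (x2 - x1) * ((x1 - x0) * (x3 - x2)).
have s13 := lt_trans s1 (lt_trans s2 s3); have p13 := lt_trans p1 (lt_trans p2 p3).
have X0 : 0 < X by rewrite !mulr_gt0 // subr_gt0.
rewrite -(ler_pM2l X0).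
have B1 : 0 <= (x1 - x0) * (t3 - t0) * ((x3 - x2) * (t2 - t1)) by apply: mulr_ge0.
have B2 : 0 <= (x3 - x0) * (x2 - x1) * ((P1 - P0) * (P3 - P2)).
  by rewrite !mulr_ge0 // subr_ge0 ltW.
have := ler_pM B1 B2 a12 pw; rewrite /X => h.
apply: (le_trans _ (le_trans h _)); rewrite le_eqVlt; apply/orP; left; apply/eqP; ring.
Qed.

End PowerBranch.

(** The estimate on the left branch is the one on the right branch of the
    reflected map. *)
Lemma cross_ratio_of_branches (R : realType) (f : R -> R) c v w C1 C2 :
  lorenz f c v w -> 0 <= C1 -> 0 <= C2 ->
  (forall t0 t1 t2 t3 : R, c < t0 -> t0 < t1 -> t1 < t2 -> t2 < t3 -> t3 <= 1 ->
    (t3 - t0) * (t2 - t1) * ((f t1 - f t0) * (f t3 - f t2)) <=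
    expR (C1 * (t3 - t0)) *
      ((f t3 - f t0) * (f t2 - f t1) * ((t1 - t0) * (t3 - t2)))) ->
  (forall t0 t1 t2 t3 : R, 1 - c < t0 -> t0 < t1 -> t1 < t2 -> t2 < t3 -> t3 <= 1 ->
    (t3 - t0) * (t2 - t1) *
      ((flip f t1 - flip f t0) * (flip f t3 - flip f t2)) <=
    expR (C2 * (t3 - t0)) *
      ((flip f t3 - flip f t0) * (flip f t2 - flip f t1) *
       ((t1 - t0) * (t3 - t2)))) ->
  cross_ratio_bound f c (C1 + C2).
Proof.
move=> lz C10 C20 cr1 cr2 t0 t1 t2 t3 h0 h1 h2 h3 h4 side.
have h03 := lt_trans (lt_trans h1 h2) h3.
have mono (C : R) Y : C <= C1 + C2 -> 0 <= Y ->
    expR (C * (t3 - t0)) * Y <= expR ((C1 + C2) * (t3 - t0)) * Y.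
  move=> CC Y0; apply: ler_wpM2r => //; rewrite ler_expR; apply: ler_wpM2r => //.
  by rewrite subr_ge0 ltW.
have up x y : t0 <= x -> x < y -> y <= t3 -> f x < f y.
  move=> x0 xy y3; case: side => [tc|ct].
    exact: (lz_incL lz (le_trans h0 x0) xy (le_lt_trans y3 tc)).
  exact: (lz_incR lz (lt_le_trans ct x0) xy (le_trans y3 h4)).
have pos : 0 <= (f t3 - f t0) * (f t2 - f t1) * ((t1 - t0) * (t3 - t2)).
  have u1 := up t0 t3 (lexx _) h03 (lexx _).
  have u2 := up t1 t2 (ltW h1) h2 (ltW h3).
  by rewrite !mulr_ge0 // subr_ge0 ltW.
case: side => [t3c|ct0]; last first.
  apply: (le_trans (cr1 _ _ _ _ ct0 h1 h2 h3 h4)); apply: mono => //.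
  by rewrite lerDl.
have := cr2 (1 - t3) (1 - t2) (1 - t1) (1 - t0).
rewrite !(ltrD2l 1) !ltrN2 gerDl oppr_le0 => /(_ t3c h3 h2 h1 h0).
have C2C : C2 <= C1 + C2 by rewrite lerDr.
move=> h; apply: le_trans (mono C2 _ C2C pos).
move: h; rewrite /flip !subKr.
have -> : 1 - t0 - (1 - t3) = t3 - t0 by ring.
have -> : 1 - t1 - (1 - t2) = t2 - t1 by ring.
have -> : 1 - t2 - (1 - t3) = t3 - t2 by ring.
have -> : 1 - t0 - (1 - t1) = t1 - t0 by ring.
have eqf x y : 1 - f x - (1 - f y) = f y - f x by ring.
by rewrite !eqf [(f t3 - f t2) * _]mulrC [(t3 - t2) * _]mulrC.
Qed.

Lemma nonflat_lorenz (R : realType) (f : R -> R) (c : R) : lorenz_map c f ->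
  nonflat c f -> exists v w C,
    [/\ lorenz f c v w, 0 <= C, cross_ratio_bound f c C,
        doubling_right f c w & doubling_right (flip f) (1 - c) (1 - v)].
Proof.
case=> /andP[c0 c1] _ _ [f0 f1] _.
move=> [al [be [a [b [phi0 [phi1 [[al1 be1] [a01 b01] df0 df1 [fL fR]]]]]]]].
move: a01 b01; rewrite !in_itv /= => /andP[a0 a1] /andP[b0 b1].
have fR' x : c < x -> x <= 1 -> f x = 1 - b + phi1 (x - 0) `^ be.
  by move=> h1 h2; rewrite subr0 fR // in_itv /= h1.
have fL' x : 1 - c < x -> x <= 1 -> flip f x = 1 - a + phi0 (x - (1 - c)) `^ al.
  move=> h1 h2; rewrite /flip fL; last by rewrite in_itv /=; apply/andP; lra.
  have -> : c - (1 - x) = x - (1 - c) by ring.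
  by ring.
have df1' : C2_diffeo_op `[c - 0, 1 - 0] `[0, (1 - (1 - b)) `^ be^-1] phi1.
  have -> : c - 0 = c by ring.
  have -> : 1 - 0 = 1 :> R by ring.
  have -> : 1 - (1 - b) = b by ring.
  exact: df1.
have df0' : C2_diffeo_op `[1 - c - (1 - c), 1 - (1 - c)]
    `[0, (1 - (1 - a)) `^ al^-1] phi0.
  have -> : 1 - c - (1 - c) = 0 by ring.
  have -> : 1 - (1 - c) = c by ring.
  have -> : 1 - (1 - a) = a by ring.
  exact: df0.
have c1' : 1 - c < 1 by lra.
have [C1 C10 cr1] := branch_cross_ratio c1 be1 df1' fR'.
have [C2 C20 cr2] := branch_cross_ratio c1' al1 df0' fL'.
have lz : lorenz f c a (1 - b).
  split=> //; try lra.
  + move=> x y x0 xy yc.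
    have := branch_lt c1' al1 df0' fL' (x := 1 - y) (y := 1 - x).
    by move=> /(_ ltac:(lra) ltac:(lra) ltac:(lra)); rewrite /flip !subKr; lra.
  + by move=> x y cx xy y1; apply: (branch_lt c1 be1 df1' fR').
  + move=> x x0 xc; have := branch_gt c1' df0' fL' (x := 1 - x).
    by move=> /(_ ltac:(lra) ltac:(lra)); rewrite /flip !subKr; lra.
  + by move=> x cx x1; apply: (branch_gt c1 df1' fR').
  + move=> y y0 ya.
    have [||x [cx x1 fx]] := branch_surj c1' al1 df0' fL' (y := 1 - y); try lra.
    by exists (1 - x); rewrite /flip in fx; split; lra.
  + by move=> y wy y1; apply: (branch_surj c1 be1 df1' fR').
exists a, (1 - b), (C1 + C2); split=> //.
- exact: addr_ge0.
- exact: (cross_ratio_of_branches lz C10 C20 cr1 cr2).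
- exact: (branch_doubling c1 be1 df1' fR').
- exact: (branch_doubling c1' al1 df0' fL').
Qed.

Lemma lorenz_map_cont (R : realType) (f : R -> R) (c : R) : lorenz_map c f ->
  cont_off f c.
Proof.
case=> _ [df _ _] _ _ _ x x0 x1 xc eps e0.
have Dx : lorenz_dom c x by split=> //=; rewrite in_itv /= x0.
have [d d0 hd] := derivable_on_cont df Dx e0.
have cx : 0 < `|x - c| by rewrite normr_gt0 subr_eq0; apply/eqP.
exists (Num.min d `|x - c|); first by rewrite lt_min d0.
move=> y y0 y1; rewrite lt_min => /andP[h1 h2]; apply: hd => //.
split; first by rewrite /= in_itv /= y0.
by move=> /= e; move: h2; rewrite e distrC ltxx.
Qed.

(** * Limit sets and attractors *)

Lemma cluster_acc (R : realType) (s : nat -> R) (z : R) :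
  cluster (s n @[n --> \oo]) z <-> acc s z.
Proof.
split=> [h eps e0 N|h A B [N _ sA] /nbhs_ballP[e e0 eB]].
- have [||t [[n /= Nn <-] tz]] := h [set s n | n in [set n | (N <= n)%N]] (ball z eps).
  + by exists N => // n Nn; exists n.
  + exact: nbhsx_ballx.
  by exists n; split=> //; move: tz; rewrite /ball /= distrC.
- have [n [Nn hn]] := h e e0 N; exists (s n); split; first exact: sA.
  by apply: eB; rewrite /ball /= distrC.
Qed.

Lemma backward_orbitP (R : realType) (f : R -> R) c v w y : lorenz f c v w ->
  0 <= y -> y <= 1 -> backward_orbit c f c y <-> exists m, iter m f y = c.
Proof.
move=> lz y0 y1; split.
  move=> [n _]; elim: n y {y0 y1} => [|n IHn] y /=; first by move=> ->; exists 0%N.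
  case=> [[_ /IHn[m fm]]|[-> _]]; last by exists 0%N.
  by exists m.+1; rewrite iterSr.
move=> [m]; elim: m y y0 y1 => [|m IHm] y y0 y1.
  by move=> /= ->; exists 0%N.
have [->|/eqP yc] := eqVneq y c; first by move=> _; exists 0%N.
rewrite iterSr => fm.
have /andP[fy0 fy1] := lz_range lz y0 y1 yc.
have [n _ hn] := IHm (f y) fy0 fy1 fm.
exists n.+1 => //=; left; split=> //; split=> //=.
by rewrite in_itv /= y0.
Qed.

Lemma acc_periodic_limits (R : realType) (s z : nat -> R) (n : nat) (t : R) :
  (0 < n)%N ->
  (forall i, (i < n)%N -> forall eps, 0 < eps -> exists K, forall k, (K <= k)%N ->
    `|s (i + k * n)%N - z i| < eps) ->
  acc s t <-> exists2 i, (i < n)%N & t = z i.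
Proof.
move=> n0 lim; split=> [h|[i ilt ->] eps e0 N]; last first.
  have [K hK] := lim i ilt eps e0; exists (i + (K + N) * n)%N; split.
    by apply: leq_trans (leq_addl _ _); rewrite mulnDl (leq_trans _ (leq_addl _ _)) // leq_pmulr.
  by apply: hK; apply: leq_addr.
have [//|none] := pselect (exists2 i, (i < n)%N & t = z i).
have [d d0 hd] : exists2 d : R, 0 < d & forall i, (i <= n.-1)%N -> d <= `|t - z i|.
  apply: min_pos => i; rewrite -ltnS prednK // => ilt.
  by rewrite normr_gt0 subr_eq0; apply/eqP => e; apply: none; exists i.
have unif m : (m <= n)%N -> exists K, forall i k, (i < m)%N -> (K <= k)%N ->
    `|s (i + k * n)%N - z i| < d / 2.
  elim: m => [|m IHm] mn; first by exists 0%N.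
  have [K hK] := IHm (ltnW mn); have [K' hK'] := lim m mn (d / 2) ltac:(lra).
  exists (maxn K K') => i k; rewrite ltnS geq_max => im /andP[Kk K'k].
  by move: im; rewrite leq_eqVlt => /orP[/eqP->|im]; [exact: hK'|exact: hK].
have [K hK] := unif n (leqnn n).
have [j [Kj hj]] := h (d / 2) ltac:(lra) (K * n)%N.
have ilt : (j %% n < n)%N by rewrite ltn_mod.
have Kk : (K <= j %/ n)%N by rewrite leq_divRL.
have := hK _ _ ilt Kk; rewrite addnC -divn_eq => h1.
have := hd (j %% n)%N; rewrite -ltnS prednK // => /(_ ilt).
have -> : t - z (j %% n)%N = (s j - z (j %% n)%N) - (s j - t) by ring.
by have := ler_normB (s j - z (j %% n)%N) (s j - t); lra.
Qed.

Section Trap.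
Variables (R : realType) (f : R -> R) (c v w : R).
Hypothesis lz : lorenz f c v w.
Variables (l r : R) (n : nat).
Hypothesis l0 : 0 <= l.
Hypothesis r1 : r <= 1.
Hypothesis av : forall x j, l < x -> x < r -> (j < n)%N -> iter j f x <> c.
Hypothesis mp : forall x, l < x -> x < r -> l < iter n f x /\ iter n f x < r.

Lemma trap_iter k x : l < x -> x < r -> l < iter (k * n) f x /\ iter (k * n) f x < r.
Proof.
move=> lx xr; elim: k => [|k [IH1 IH2]] //.
by rewrite mulSn iterD; apply: mp.
Qed.

Lemma trap_free x : (0 < n)%N -> l < x -> x < r -> free f c x.
Proof.
move=> n0 lx xr j; rewrite (divn_eq j n) addnC iterD.
have [h1 h2] := trap_iter (j %/ n) lx xr.
by apply: av => //; rewrite ltn_mod.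
Qed.

Lemma trap_le i x y : (i <= n)%N -> l < x -> x <= y -> y < r ->
  iter i f x <= iter i f y.
Proof.
move=> ilt lx xy yr; have [l0' r1'] := (l0, r1).
apply: (clear_le lz) => //; try lra.
apply: (avoid_clear lz) => //; try lra.
by move=> z j xz zy ji; apply: av; [lra|lra|exact: leq_trans ilt].
Qed.

(** Iterates of points between y and f^n y > y are squeezed between consecutive
    terms of monotone sequences. *)
Lemma trap_limits y : l < y -> y < r -> y < iter n f y ->
  exists z : nat -> R, forall x i, y < x -> x < iter n f y -> (i < n)%N ->
    forall eps, 0 < eps -> exists K, forall k, (K <= k)%N ->
      `|iter (i + k * n) f x - z i| < eps.
Proof.
move=> ly yr yF; have [_ Fr] := mp ly yr; have r1' := r1; have l0' := l0.
pose F k := iter (k * n) f y.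
have Fin k : l < F k /\ F k < r by apply: trap_iter.
have Fn k : F k.+1 = iter n f (F k) by rewrite /F mulSn iterD.
have FS k : F k <= F k.+1.
  elim: k => [|k IHk]; first by rewrite /F mul0n mul1n; exact: ltW.
  rewrite (Fn k.+1) {1}(Fn k).
  by apply: trap_le; [|have [] := Fin k|exact: IHk|have [] := Fin k.+1].
have squeeze k x : y < x -> x < iter n f y ->
    F k <= iter (k * n) f x /\ iter (k * n) f x <= F k.+1.
  move=> yx xF; elim: k => [|k [IH1 IH2]].
    by rewrite /F mul0n mul1n /=; split; exact: ltW.
  have [h1 h2] := trap_iter k (lt_trans ly yx) (lt_trans xF Fr).
  rewrite [(k.+1 * n)%N]mulSn iterD; split.
    by rewrite (Fn k); apply: trap_le; [|have [] := Fin k|exact: IH1|].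
  by rewrite (Fn k.+1); apply: trap_le; [| |exact: IH2|have [] := Fin k.+1].
pose a i k := iter i f (F k).
have aS i k : (i < n)%N -> a i k <= a i k.+1.
  move=> ilt.
  by apply: trap_le; [exact: ltnW|have [] := Fin k|exact: FS|have [] := Fin k.+1].
have amono i : (i < n)%N -> forall k k', (k <= k')%N -> a i k <= a i k'.
  move=> ilt k k'; elim: k' => [|k' IHk]; first by rewrite leqn0 => /eqP->.
  rewrite leq_eqVlt => /orP[/eqP->//|]; rewrite ltnS => /IHk h.
  exact: (le_trans h (aS i k' ilt)).
have a1 i k : (i < n)%N -> a i k <= 1.
  move=> ilt; have [h1 h2] := Fin k.
  have /andP[//] : 0 <= a i k <= 1.
  apply: (iter_range lz); try lra.
  by move=> j ji; apply: av => //; apply: ltn_trans ilt.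
exists (fun i => sup (range (a i))) => x i yx xF ilt eps e0.
have supa : has_sup (range (a i)).
  by split; [exists (a i 0%N), 0%N|exists 1 => _ [k _ <-]; apply: a1].
have [_ [K _ <-] hK] := sup_adherent e0 supa.
exists K => k Kk; rewrite iterD.
have [s1 s2] := squeeze k x yx xF.
have [h1 h2] := trap_iter k (lt_trans ly yx) (lt_trans xF Fr).
have b1 : a i k <= iter i f (iter (k * n) f x).
  by apply: trap_le; [exact: ltnW|have [] := Fin k|exact: s1|exact: h2].
have b2 : iter i f (iter (k * n) f x) <= a i k.+1.
  by apply: trap_le; [exact: ltnW|exact: h1|exact: s2|have [] := Fin k.+1].
have b3 := amono i ilt K k Kk.
have b4 : a i k.+1 <= sup (range (a i)).
  by apply: (ub_le_sup (proj2 supa)); exists k.+1.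
by rewrite ltr_norml; lra.
Qed.

End Trap.

(** If f^n maps an interval into itself, either it is the identity there, or some
    point moves, and then an open set of points has the same finite limit set. *)
Lemma no_attractor_no_trap (R : realType) (f : R -> R) c v w : lorenz f c v w ->
  contracting c f -> ~ (exists P : set R, periodic_attractor c f P) -> no_trap f c.
Proof.
move=> lz [_ nid] nattr l r n l0 lr r1 n0 av mp.
have c01 : 0 < c /\ c < 1 by split; [exact: lz_c0 lz|exact: lz_c1 lz].
suff [p1 [p2 [z [p12 lp1 pr hz]]]] : exists p1 p2 (z : nat -> R),
    [/\ p1 < p2, l <= p1, p2 <= r & forall x i, p1 < x -> x < p2 -> (i < n)%N ->
    forall eps, 0 < eps -> exists K, forall k, (K <= k)%N ->
      `|iter (i + k * n) f x - z i| < eps].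
  apply: nattr; exists [set z i | i in `I_n]; split.
    exact: finite_image (finite_II n).
  exists ((p1 + p2) / 2); apply/nbhs_ballP; exists ((p2 - p1) / 2); first by rewrite /=; lra.
  move=> x; rewrite /ball /= => hx.
  have [px xp] : p1 < x /\ x < p2 by move: hx; rewrite ltr_norml; lra.
  have lx : l < x by lra. have xr : x < r by lra.
  have fx := trap_free av mp n0 lx xr.
  have x0 : 0 <= x by lra. have x1 : x <= 1 by lra.
  split.
    split; first by rewrite /= in_itv /= x0.
    by move=> /= e; apply: (fx 0%N).
  rewrite /omega memNset; last first.
    by move=> /(backward_orbitP lz x0 x1)[m e]; apply: (fx m).
  apply/seteqP; split=> t.
    move=> /cluster_acc/(acc_periodic_limits (z := z) (n := n) t n0).
    move=> h; have [|i ilt ->] := h; last by exists i.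
    by move=> i ilt; apply: hz.
  move=> [i ilt <-]; apply/cluster_acc/(acc_periodic_limits (z := z) (n := n) _ n0).
    by move=> j jlt; apply: hz.
  by exists i.
have [[y [ly [yr yF]]]|fixed] := pselect (exists y, l < y /\ (y < r /\ iter n f y <> y)); last first.
  exfalso; apply: nid; exists l, r, n; split=> //.
    move=> x; rewrite /= in_itv /= => /andP[lx xr]; split.
      by rewrite in_itv /=; apply/andP; split; lra.
    by move=> j jn; apply: av.
  move=> x; rewrite in_itv /= => /andP[lx xr].
  by apply: contrapT => e; apply: fixed; exists x.
have [F1 F2] := mp y ly yr.
case: (ltrgtP y (iter n f y)) => [lt|gt|e]; last by case: yF.
  have [z hz] := trap_limits lz l0 r1 av mp ly yr lt.
  by exists y, (iter n f y), z; split=> //; exact: ltW.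
have av' x j : 1 - r < x -> x < 1 - l -> (j < n)%N -> iter j (flip f) x <> 1 - c.
  by move=> h1 h2 jn; rewrite iter_flip => e; apply: (av (1 - x) j) => //; lra.
have mp' x : 1 - r < x -> x < 1 - l ->
    1 - r < iter n (flip f) x /\ iter n (flip f) x < 1 - l.
  move=> h1 h2; rewrite iter_flip.
  by have [||h3 h4] := mp (1 - x); [lra|lra|]; split; lra.
have r0 : 0 <= 1 - r by lra.
have l1 : 1 - l <= 1 by lra.
have y1 : 1 - r < 1 - y by lra.
have y2 : 1 - y < 1 - l by lra.
have y3 : 1 - y < iter n (flip f) (1 - y) by rewrite iter_flip subKr; lra.
have [z hz] := trap_limits (lorenz_flip lz) r0 l1 av' mp' y1 y2 y3.
exists (iter n f y), y, (fun i => 1 - z i); split=> //; try exact: ltW.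
move=> x i h1 h2 ilt eps e0.
have [||K hK] := hz (1 - x) i _ _ ilt eps e0; [lra|rewrite iter_flip subKr; lra|].
exists K => k /hK; rewrite iter_flip subKr.
have -> : 1 - iter (i + k * n) f x - z i = - (iter (i + k * n) f x - (1 - z i)) by ring.
by rewrite normrN.
Qed.

(** * From the first return map to the endpoint data *)

Definition first_return (R : realType) (f : R -> R) (c a b x : R) (n : nat) : Prop :=
  [/\ (0 < n)%N, forall j, (j < n)%N -> iter j f x <> c, a <= iter n f x <= b
    & forall j, (0 < j)%N -> (j < n)%N -> ~ (a <= iter j f x <= b)].

Lemma first_return_flip (R : realType) (f : R -> R) c a b x n :
  first_return f c a b x n ->
  first_return (flip f) (1 - c) (1 - b) (1 - a) (1 - x) n.
Proof.
case=> n0 av /andP[h1 h2] out; split=> //.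
- by move=> j jn; rewrite iter_flip subKr => e; apply: (av j jn); lra.
- by rewrite iter_flip subKr; apply/andP; split; lra.
- move=> j j0 jn; rewrite iter_flip subKr => /andP[k1 k2].
  by apply: (out j j0 jn); apply/andP; split; lra.
Qed.

Lemma first_return_unflip (R : realType) (f : R -> R) c a b x n :
  first_return (flip f) (1 - c) (1 - b) (1 - a) x n ->
  first_return f c a b (1 - x) n.
Proof. by move/first_return_flip; rewrite flipK !subKr. Qed.

(** The return time is constant on [a, c): let m be the first time at which some
    point of [a, c) is in [a, b]. Before m the iterates are continuous on [a, c); and
    f^m cannot leave [a, b], since by the intermediate value theorem it would take
    the value a or b at a point that is not a fixed point of the return map. *)
Lemma return_left (R : realType) (f : R -> R) c v w a b : lorenz f c v w ->
  0 <= a -> a < c -> c < b -> b <= 1 ->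
  (forall x, a <= x -> x <= b -> x <> c -> exists n, first_return f c a b x n) ->
  (forall x n, a <= x -> x <= b -> first_return f c a b x n ->
     (iter n f x = a <-> x = a) /\ (iter n f x = b <-> x = b)) ->
  exists p, [/\ forall j, (j < p)%N -> iter j f v <= a \/ b <= iter j f (f a),
    iter p f (f a) = a & iter p f v <= b].
Proof.
move=> lz a0 ac cb b1 H1 H2; have [c0 c1] := (lz_c0 lz, lz_c1 lz).
have v1 := lz_v1 lz.
pose P m := (0 < m)%N && `[< exists x, [/\ a <= x, x < c & a <= iter m f x <= b] >].
have exP : exists m, P m.
  have [||n [n0 _ ret _]] := H1 a (lexx a); [lra|lra|].
  by exists n; rewrite /P n0; apply/asboolP; exists a.
have [m /andP[m0 /asboolP[x0 [ax0 x0c x0ret]]] mmin] := ex_minnP exP.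
have out x j : a <= x -> x < c -> (0 < j)%N -> (j < m)%N -> ~ (a <= iter j f x <= b).
  move=> ax xc j0 jm h; have := mmin j; rewrite leqNgt jm => /(_ _)/negP[] //.
  by rewrite /P j0; apply/asboolP; exists x.
have av x j : a <= x -> x < c -> (j < m)%N -> iter j f x <> c.
  move=> ax xc; case: j => [|j] jm e; first by move: e => /=; lra.
  by apply: (out x j.+1 ax xc _ jm) => //; rewrite e; apply/andP; split; lra.
have cl x y i : (i <= m)%N -> a <= x -> x <= y -> y < c -> clear f c i x y.
  move=> im ax xy yc; apply: (avoid_clear lz); try lra.
  by move=> z j xz zy ji; apply: av; [lra|lra|exact: leq_trans im].
have ret x : a <= x -> x < c -> a <= iter m f x <= b -> first_return f c a b x m.
  move=> ax xc h; split=> //; last by move=> j j0 jm; apply: out.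
  by move=> j jm; apply: av.
(* a point whose return is interior; between it and a point that is sent out of
   [a, b], f^m would take the value a or b *)
have [x1 [ax1 x1c m1 m2]] : exists x, [/\ a <= x, x < c, a < iter m f x & iter m f x < b].
  have inner x : a < x -> x < c -> a <= iter m f x <= b ->
      a < iter m f x /\ iter m f x < b.
    move=> ax xc h; have [ha hb] := H2 x m ltac:(lra) ltac:(lra) (ret x (ltW ax) xc h).
    move: h => /andP[h1 h2]; split; rewrite lt_neqAle ?h1 ?h2 andbT; apply/eqP => e.
      by have := (proj1 ha) (esym e); lra.
    by have := (proj1 hb) e; lra.
  move: (ax0); rewrite le_eqVlt => /orP[/eqP e|ax]; last first.
    by have [h1 h2] := inner x0 ax x0c x0ret; exists x0.
  rewrite -e in x0ret.
  have [ha _] := H2 a m (lexx a) ltac:(lra) (ret a (lexx a) ac x0ret).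
  have fma : iter m f a = a by apply/ha.
  set y := (a + c) / 2.
  have ay : a < y by rewrite /y; lra. have yc : y < c by rewrite /y; lra.
  have my : a < iter m f y.
    by rewrite -{1}fma; apply: (clear_lt lz) => //; [lra|apply: cl => //; exact: ltW].
  have [yb|yb] := ltrP (iter m f y) b; first by exists y; split=> //; exact: ltW.
  have [|||t [at_ ty ft]] := iter_ivt (x := a) (y := y) (n := m) (z := (a + c) / 2) lz a0
    (ltW ay) _ (cl a y m (leqnn m) (lexx a) (ltW ay) yc); try (rewrite ?fma; lra).
  by exists t; rewrite ft; split=> //; lra.
have all_in x : a <= x -> x < c -> a <= iter m f x <= b.
  move=> ax xc; apply/andP; split; rewrite leNgt; apply/negP => h.
  - have xx1 : x <= x1.
      rewrite leNgt; apply/negP => h'.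
      have le1 : iter m f x1 <= iter m f x.
        apply: (clear_le lz (le_trans a0 ax1) (ltW h') (ltW (lt_trans xc c1))).
        exact: cl (leqnn m) ax1 (ltW h') xc.
      by have := lt_trans m1 (le_lt_trans le1 h); rewrite ltxx.
    have [t [xt tx1 ft]] := iter_ivt lz (le_trans a0 ax) xx1 (ltW (lt_trans x1c c1))
      (cl x x1 m (leqnn m) ax xx1 x1c) (ltW h) (ltW m1).
    have tc : t < c by lra. have at_ : a <= t by lra.
    have ra : a <= iter m f t <= b by rewrite ft lexx; lra.
    have [ha _] := H2 t m at_ ltac:(lra) (ret t at_ tc ra).
    have ta := (proj1 ha) ft.
    have xa : x = a by apply/eqP; rewrite eq_le ax andbT; lra.
    by move: h; rewrite xa -{1}ta ft ltxx.
  - have x1x : x1 <= x.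
      rewrite leNgt; apply/negP => h'.
      have le1 : iter m f x <= iter m f x1.
        apply: (clear_le lz (le_trans a0 ax) (ltW h') (ltW (lt_trans x1c c1))).
        exact: cl (leqnn m) ax (ltW h') x1c.
      by have := lt_trans (lt_le_trans h le1) m2; rewrite ltxx.
    have [t [x1t tx ft]] := iter_ivt lz (le_trans a0 ax1) x1x (ltW (lt_trans xc c1))
      (cl x1 x m (leqnn m) ax1 x1x xc) (ltW m2) (ltW h).
    have tc : t < c by lra. have at_ : a <= t by lra.
    have ra : a <= iter m f t <= b by rewrite ft lexx andbT; lra.
    have [_ hb] := H2 t m at_ ltac:(lra) (ret t at_ tc ra).
    by have := (proj1 hb) ft; lra.
have fma : iter m f a = a.
  have [ha _] := H2 a m (lexx a) ltac:(lra) (ret a (lexx a) ac (all_in a (lexx a) ac)).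
  exact/ha.
case: m m0 {mmin x0ret m1 m2} out av cl ret all_in fma => // p _ out av cl ret all_in fma.
have /andP[fa0 fa1] : 0 <= f a <= 1 by apply: (lz_range lz); lra.
have fav : f a < v by apply: (lz_supL lz).
have pt t : f a <= t -> t < v -> exists x, [/\ a <= x, x < c & f x = t].
  move=> h1 h2; have [x [k0 k1 k2]] := lz_surL lz (y := t) ltac:(lra) h2.
  exists x; split=> //; rewrite leNgt; apply/negP => xa.
  by have := lz_incL lz k0 xa ac; lra.
have outL j : (j <= p)%N -> clear f c j (f a) v /\
    forall i, (i < j)%N -> iter i f v <= a \/ b <= iter i f (f a).
  elim: j => [|j IHj] jp; first by [].
  have [clj outj] := IHj (ltnW jp).
  have o : iter j f v <= a \/ b <= iter j f (f a).
    have oa := out a j.+1 (lexx a) ac isT jp; rewrite iterSr in oa.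
    have /orP[h|h] := le_total b (iter j f (f a)); first exact: or_intror.
    left; rewrite leNgt; apply/negP => h'.
    have ha : iter j f (f a) < a.
      by rewrite ltNge; apply/negP => h''; apply: oa; rewrite h''.
    have [t [t1 t2 ft]] := iter_ivt (z := a) lz fa0 (ltW fav) v1 clj (ltW ha) (ltW h').
    have tv : t < v by rewrite lt_neqAle t2 andbT; apply/eqP => e; move: h'; rewrite -e ft ltxx.
    have [x [x1' x2 fx]] := pt t t1 tv.
    apply: (out x j.+1 x1' x2 isT jp); rewrite iterSr fx ft lexx /=; lra.
  split=> i; rewrite ltnS leq_eqVlt => /orP[/eqP->|ij];
    [|exact: clj|exact: o|exact: outj].
  by case: o => h; [left; exact: le_lt_trans h ac|right; exact: lt_le_trans cb h].
have [clp outp] := outL p (leqnn p).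
exists p; split=> //; first by rewrite -iterSr.
rewrite leNgt; apply/negP => h.
have ab : iter p f (f a) <= b by rewrite -iterSr fma; exact/ltW/(lt_trans ac).
have [t [t1 t2 ft]] := iter_ivt lz fa0 (ltW fav) v1 clp ab (ltW h).
have tv : t < v by rewrite lt_neqAle t2 andbT; apply/eqP => e; move: h; rewrite -e ft ltxx.
have [x [x1' x2 fx]] := pt t t1 tv.
have fxb : iter p.+1 f x = b by rewrite iterSr fx.
have [_ hb] := H2 x p.+1 x1' ltac:(lra) (ret x x1' x2 (all_in x x1' x2)).
by have := (proj1 hb) fxb; lra.
Qed.

Lemma lorenz_map_inc (R : realType) (g : R -> R) c : lorenz_map c g ->
  forall x y, 0 <= x -> x < y -> y <= 1 -> y < c \/ c < x -> g x < g y.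
Proof.
case=> _ [dg _ _] _ _ pos x y x0 xy y1 side.
have dom t : x <= t -> t <= y -> lorenz_dom c t.
  move=> xt ty; split; first by rewrite /= in_itv /=; apply/andP; split; lra.
  by move=> /= e; lra.
have [z [xz zy e]] := derive_on_MVT dg dom xy.
rewrite -subr_gt0 e; apply: mulr_gt0; last lra.
by apply: pos; apply: dom; exact: ltW.
Qed.

Lemma lorenz_map_ends (R : realType) (g : R -> R) c y : lorenz_map c g ->
  0 <= y -> y <= 1 -> y <> c -> (g y = 0 -> y = 0) /\ (g y = 1 -> y = 1).
Proof.
move=> lg y0 y1 yc; have inc := lorenz_map_inc lg.
have [/andP[c0 c1] _ rng [g0 g1] _] := lg.
have rg t : 0 <= t -> t <= 1 -> t <> c -> 0 <= g t /\ g t <= 1.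
  move=> t0 t1 tc; have := rng t; rewrite in_itv /= => h; apply/andP/h.
  by split=> //=; rewrite in_itv /= t0.
split=> e.
- have [//|/eqP ny] := eqVneq y 0; exfalso.
  have y0' : 0 < y by rewrite lt_neqAle y0 andbT eq_sym; apply/eqP.
  have [lt|gt] : y < c \/ c < y by case: (ltrgtP y c) => h; [left|right|case: (yc h)].
    by have := inc 0 y (lexx 0) y0' y1 (or_introl lt); lra.
  have [k1 k2] := rg ((c + y) / 2) ltac:(lra) ltac:(lra) ltac:(lra).
  by have := inc ((c + y) / 2) y ltac:(lra) ltac:(lra) y1 ltac:(lra); lra.
- have [//|/eqP ny] := eqVneq y 1; exfalso.
  have y1' : y < 1 by rewrite lt_neqAle y1 andbT; apply/eqP.
  have [lt|gt] : y < c \/ c < y by case: (ltrgtP y c) => h; [left|right|case: (yc h)].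
    have [k1 k2] := rg ((c + y) / 2) ltac:(lra) ltac:(lra) ltac:(lra).
    by have := inc y ((c + y) / 2) y0 ltac:(lra) ltac:(lra) ltac:(lra); lra.
  by have := inc y 1 y0 y1' (lexx 1) (or_intror gt); lra.
Qed.

Lemma homeomorphism_ends (R : realType) (h : R -> R) (a b : R) : a < b ->
  homeomorphism_on `[a, b] `[0, 1] h ->
  (h a = 0 /\ h b = 1) \/ (h a = 1 /\ h b = 0).
Proof.
move=> ab [[maps inj surj] ch _].
have rng x : a <= x -> x <= b -> 0 <= h x /\ h x <= 1.
  by move=> ax xb; have := maps x; rewrite /= !in_itv /= ax xb => /(_ isT)/andP.
have [|x0] := surj 0; first by rewrite /= in_itv /= lexx ler01.
rewrite /= in_itv /= => /andP[ax0 x0b] h0.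
have [|x1] := surj 1; first by rewrite /= in_itv /= lexx ler01.
rewrite /= in_itv /= => /andP[ax1 x1b] h1.
have aI : a \in `[a, b] by rewrite in_itv /= lexx ltW.
have bI : b \in `[a, b] by rewrite in_itv /= lexx ltW.
have x0I : x0 \in `[a, b] by rewrite in_itv /= ax0.
have x1I : x1 \in `[a, b] by rewrite in_itv /= ax1.
have [a0 a1] := rng a (lexx a) (ltW ab); have [b0 b1] := rng b (ltW ab) (lexx b).
have inj' : {in `[a, b] &, injective h}.
  by move=> x y xI yI; apply: inj; rewrite inE.
have [mono|mono] := itv_continuous_inj_mono ch inj'.
- have le x y : x \in `[a, b] -> y \in `[a, b] -> x <= y -> h x <= h y.
    by move=> xI yI; rewrite le_eqVlt => /orP[/eqP->//|/(mono x y xI yI)/ltW].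
  by left; split; have := le a x0 aI x0I ax0; have := le x1 b x1I bI x1b; lra.
- have le x y : x \in `[a, b] -> y \in `[a, b] -> x <= y -> h y <= h x.
    by move=> xI yI; rewrite le_eqVlt => /orP[/eqP->//|/(mono y x yI xI)/ltW].
  by right; split; have := le a x1 aI x1I ax1; have := le x0 b x0I bI x0b; lra.
Qed.

Lemma renorm_of_return_map (R : realType) (f : R -> R) c v w a b : lorenz f c v w ->
  0 <= a -> a < c -> c < b -> b <= 1 -> return_map_lorenz c f `[a, b] ->
  exists p q, renorm f c v w a b p q.
Proof.
move=> lz a0 ac cb b1 [c' [g [h [lg hom retc conj]]]].
have ab : a < b by lra.
have ends := homeomorphism_ends ab hom.
have [[maps inj _] _ _] := hom.
have inI x : a <= x -> x <= b -> (`[a, b]%classic : set R) x.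
  by move=> ax xb; rewrite /= in_itv /= ax.
have rng x : a <= x -> x <= b -> 0 <= h x /\ h x <= 1.
  by move=> ax xb; have := maps x (inI x ax xb); rewrite /= in_itv /= => /andP.
have [/andP[c'0 c'1] _ _ [g0 g1] _] := lg.
have retE x n : a <= x -> x <= b ->
    first_return f c a b x n <-> return_time c f `[a, b] x n.
  move=> ax xb; split.
  - case=> n0 av ret out; split=> //.
    + by split=> //; rewrite in_itv /=; apply/andP; split; lra.
    + by move=> j /andP[j0 jn]; rewrite /= in_itv /=; exact: out.
  - case=> n0 [_ av]; rewrite /= in_itv /= => ret out; split=> //.
    by move=> j j0 jn; have := out j; rewrite /= in_itv /= j0 jn => /(_ isT).
have hinj x y : a <= x -> x <= b -> a <= y -> y <= b -> h x = h y -> x = y.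
  by move=> *; apply: inj => //; rewrite inE; apply: inI.
have hc : h c = c'.
  have [//|/eqP ne] := eqVneq (h c) c'.
  have [n /retE] := proj2 (retc c (inI c (ltW ac) (ltW cb))) ne.
  by move=> /(_ (ltW ac) (ltW cb))[n0 av _ _]; case: (av 0%N n0).
have H1 x : a <= x -> x <= b -> x <> c -> exists n, first_return f c a b x n.
  move=> ax xb xc; have [|n hn] := proj2 (retc x (inI x ax xb)).
    by move=> e; apply: xc; apply: hinj => //; [exact: ltW|exact: ltW|rewrite hc].
  by exists n; apply/retE.
have H2 x n : a <= x -> x <= b -> first_return f c a b x n ->
    (iter n f x = a <-> x = a) /\ (iter n f x = b <-> x = b).
  move=> ax xb fr; have rt := proj1 (retE x n ax xb) fr.
  have e := conj x n (inI x ax xb) rt.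
  have hx : h x <> c' by apply: (proj1 (retc x (inI x ax xb))); exists n.
  have [h0 h1] := rng x ax xb.
  have [z0 z1] := lorenz_map_ends lg h0 h1 hx.
  have [_ _ /andP[f1 f2] _] := fr.
  have ha y : y = a \/ y = b -> (iter n f x = y <-> x = y).
    move=> hy; have yab : a <= y /\ y <= b by case: hy => ->; split=> //; exact: ltW.
    have [ay yb] := yab.
    have y01 : h y = 0 \/ h y = 1.
      by case: hy ends => -> [[e1 e2]|[e1 e2]]; rewrite ?e1 ?e2; tauto.
    split=> [fy|xy].
      apply: hinj => //; move: e; rewrite fy => e.
      case: y01 => yy; rewrite yy in e *; first by apply: z0.
      by apply: z1.
    apply: hinj => //; rewrite e xy.
    by case: y01 => ->.
  by split; apply: ha; tauto.
have [p [outL fixL retL]] := return_left lz a0 ac cb b1 H1 H2.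
have H1' x : 1 - b <= x -> x <= 1 - a -> x <> 1 - c ->
    exists n, first_return (flip f) (1 - c) (1 - b) (1 - a) x n.
  move=> bx xa xc; have [|||n hn] := H1 (1 - x); [lra|lra|by move=> e; apply: xc; lra|].
  by exists n; have := first_return_flip hn; rewrite subKr.
have H2' x n : 1 - b <= x -> x <= 1 - a ->
    first_return (flip f) (1 - c) (1 - b) (1 - a) x n ->
    (iter n (flip f) x = 1 - b <-> x = 1 - b) /\
    (iter n (flip f) x = 1 - a <-> x = 1 - a).
  move=> bx xa /first_return_unflip fr; rewrite iter_flip.
  have [|| [i1 i2] [i3 i4]] := H2 (1 - x) n _ _ fr; [lra|lra|].
  split; split=> e.
  - by have := i3 ltac:(lra); lra.
  - by have := i4 ltac:(lra); lra.
  - by have := i1 ltac:(lra); lra.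
  - by have := i2 ltac:(lra); lra.
have [||||q [outR fixR retR]] := return_left (lorenz_flip lz) (a := 1 - b) (b := 1 - a)
  _ _ _ _ H1' H2'; try lra.
have fb : flip f (1 - b) = 1 - f b by rewrite /flip subKr.
exists p, q; split=> //.
- by move=> j /outR; rewrite fb !iter_flip !subKr; lra.
- by move: fixR; rewrite fb !iter_flip !subKr; lra.
- by move: retR; rewrite !iter_flip !subKr; lra.
Qed.

(** * One-sided critical orbits *)

Section CriticalOrbits.
Variables (R : realType) (f : R -> R) (c v w : R).
Hypothesis lz : lorenz f c v w.
Hypothesis nt : no_trap f c.
Hypothesis fc : cont_off f c.
Hypothesis shr : shrinking_renorm f c v w.

Lemma lim_iterS (F : set_system R) (PF : ProperFilter F) n u : 0 <= u -> u <= 1 ->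
  free f c u -> (forall d, 0 < d -> F [set x | 0 <= f x <= 1 /\ `|f x - u| < d]) ->
  lim (iter n.+1 f x @[x --> F]) = iter n f u.
Proof.
move=> u0 u1 fu near_u; apply/cvg_lim => //; apply/cvgrPdist_lt => eps e0.
have [d d0 hd] := iter_cont lz fc u0 u1 (fun j (_ : (j < n)%N) => fu j) e0.
apply: filterS (near_u d d0) => x [/andP[x0 x1] xd].
by rewrite distrC iterSr; have [] := hd _ x0 x1 xd.
Qed.

(** The one-sided iterates of [c] start at time 0 with [c] itself, one step before v. *)
Lemma iterLE n : iterL c f n = if n is m.+1 then iter m f v else c.
Proof.
case: n => [|n]; first by rewrite /iterL; apply/cvg_lim => //; exact: cvg_at_left_filter cvg_id.
have /andP[v0 v1] := lz_v01 lz; have v0' := lz_v0 lz.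
apply: lim_iterS => //; first exact: v_free lz shr.
move=> d d0; set y := Num.max 0 (v - d / 2).
have y0 : 0 <= y by rewrite /y le_max lexx.
have yd : v - d / 2 <= y by rewrite /y le_max lexx orbT.
have yv : y < v by rewrite /y gt_max v0' /=; lra.
have [s [s0 sc fs]] := lz_surL lz y0 yv.
rewrite /at_left /within /=; apply/nbhs_ballP; exists (c - s); first by rewrite /= subr_gt0.
move=> x; rewrite /ball /= ltr_norml => /andP[h1 h2] xc.
have sx : s < x by lra.
have fsx := lz_incL lz s0 sx xc; have fxv := lz_supL lz (le_trans s0 (ltW sx)) xc.
split; first by apply/andP; split; lra.
by rewrite ltr_norml; lra.
Qed.

Lemma iterRE n : iterR c f n = if n is m.+1 then iter m f w else c.
Proof.
case: n => [|n]; first by rewrite /iterR; apply/cvg_lim => //; exact: cvg_at_right_filter cvg_id.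
have /andP[w0 w1] := lz_w01 lz.
have w1' : w < 1 by have := lz_v0 (lorenz_flip lz); lra.
apply: lim_iterS => //; first exact: w_free lz shr.
move=> d d0; set y := Num.min 1 (w + d / 2).
have y0 : y <= 1 by rewrite /y ge_min lexx.
have yd : y <= w + d / 2 by rewrite /y ge_min lexx orbT.
have yw : w < y by rewrite /y lt_min w1' /=; lra.
have [s [sc s1 fs]] := lz_surR lz yw y0.
rewrite /at_right /within /=; apply/nbhs_ballP; exists (s - c); first by rewrite /= subr_gt0.
move=> x; rewrite /ball /= ltr_norml => /andP[h1 h2] cx.
have xs : x < s by lra.
have fxs := lz_incR lz cx xs s1; have wfx := lz_infR lz cx (le_trans (ltW xs) s1).
split; first by apply/andP; split; lra.
by rewrite ltr_norml; lra.
Qed.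

Lemma acc_shift (s t : nat -> R) z : (forall n, s n.+1 = t n) -> acc s z <-> acc t z.
Proof.
move=> st; split=> h eps e0 N.
- have [n [+ hn]] := h eps e0 N.+1; case: n hn => // n hn Nn.
  by exists n; split=> //; rewrite -st.
- have [n [Nn hn]] := h eps e0 N.
  by exists n.+1; split; [exact: leqW|rewrite st].
Qed.

Lemma cluster_iterL : cluster (iterL c f n @[n --> \oo]) = acc (orbit_of f v).
Proof.
apply/seteqP; split=> z.
  by move/cluster_acc; apply: (proj1 (acc_shift _ _)) => n; rewrite iterLE.
by move=> h; apply/cluster_acc/(acc_shift (t := orbit_of f v)) => // n; rewrite iterLE.
Qed.

Lemma cluster_iterR : cluster (iterR c f n @[n --> \oo]) = acc (orbit_of f v).
Proof.
apply/seteqP; split=> z.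
  move/cluster_acc => h; apply/(acc_vw lz nt fc shr).
  by apply/(proj1 (acc_shift _ _)); last exact: h; move=> n; rewrite iterRE.
move/(acc_vw lz nt fc shr) => h; apply/cluster_acc.
by apply/(acc_shift (t := orbit_of f w)) => // n; rewrite iterRE.
Qed.

Lemma side_orbitP (s : nat -> R) u : free f c u -> s 0%N = c ->
  (forall n, s n.+1 = iter n f u) ->
  forall y, side_orbit c s y <-> y = c \/ exists j, y = iter j f u.
Proof.
move=> fu s0 sS y.
have nc p : (0 < p)%N -> s p <> c by case: p => // p _; rewrite sS; apply: fu.
split.
- case=> [[p [p0 sp _ _]]|[_ [[|j] ->]]]; first by case: (nc p p0).
    by left.
  by right; exists j; rewrite sS.
- case=> [->|[j ->]]; right; split=> //; first by exists 0%N.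
  by exists j.+1; rewrite sS.
Qed.

Lemma not_backward x : 0 <= x -> x <= 1 -> ~ backward_orbit c f c x -> free f c x.
Proof. by move=> x0 x1 nb n e; apply: nb; apply/(backward_orbitP lz x0 x1); exists n. Qed.

Lemma forward_orbit_iter i y : 0 <= y -> y <= 1 ->
  (forall j, (j < i)%N -> iter j f y <> c) -> forward_orbit c f y (iter i f y).
Proof.
move=> y0 y1 av; rewrite /forward_orbit; case: ifPn => [|_]; last by exists i.
rewrite inE => /(backward_orbitP lz y0 y1)[m0 fm0].
have exm : exists m, iter m f y == c by exists m0; apply/eqP.
have [m /eqP fm mmin] := ex_minnP exm.
left; left; exists m; split=> //.
  by move=> j jm /eqP/mmin; rewrite leqNgt jm.
by exists i => //; rewrite leqNgt; apply/negP => mi; apply: (av m).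
Qed.

(** ** The limit set is minimal *)

Lemma acc_v_01 z : acc (orbit_of f v) z -> 0 <= z <= 1.
Proof.
move=> vz; have /andP[v0 v1] := lz_v01 lz.
apply/andP; split; rewrite leNgt; apply/negP => h.
- have [n [_]] := vz (- z) ltac:(lra) 0%N; rewrite /orbit_of.
  have /andP[n0 n1] := iter_range lz v0 v1 (fun j (_ : (j < n)%N) => v_free lz shr (n := j)).
  by rewrite ltr_norml; lra.
- have [n [_]] := vz (z - 1) ltac:(lra) 0%N; rewrite /orbit_of.
  have /andP[n0 n1] := iter_range lz v0 v1 (fun j (_ : (j < n)%N) => v_free lz shr (n := j)).
  by rewrite ltr_norml; lra.
Qed.

Lemma acc_v_next z : acc (orbit_of f v) z -> z <> c -> acc (orbit_of f v) (f z).
Proof.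
move=> vz zc eps e0 N; have /andP[z0 z1] := acc_v_01 vz.
have /andP[v0 v1] := lz_v01 lz.
have [d d0 hd] := fc z0 z1 zc e0.
have [n [Nn hn]] := vz d d0 N; exists n.+1; split; first exact: leqW.
have /andP[n0 n1] := iter_range lz v0 v1 (fun j (_ : (j < n)%N) => v_free lz shr (n := j)).
exact: hd.
Qed.

Lemma acc_v_iter z j : acc (orbit_of f v) z ->
  (forall i, (i < j)%N -> iter i f z <> c) -> acc (orbit_of f v) (iter j f z).
Proof.
move=> vz; elim: j => [|j IHj] av //=.
by apply: acc_v_next; [apply: IHj => i ij; apply/av/leqW|exact: av].
Qed.

Lemma closed_acc (s : nat -> R) : closed (acc s).
Proof.
move=> z cz eps e0 N.
have [y [sy yz]] := cz (ball z (eps / 2)) (nbhsx_ballx z (eps / 2) ltac:(lra)).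
have [n [Nn hn]] := sy (eps / 2) ltac:(lra) N; exists n; split=> //.
have -> : s n - z = (s n - y) - (z - y) by ring.
by apply: (le_lt_trans (ler_normB _ _)); move: yz; rewrite /ball /=; lra.
Qed.

Lemma acc_closure (s : nat -> R) (A : set R) z : (forall n, A (s n)) -> acc s z ->
  closure A z.
Proof.
move=> As sz B /nbhs_ballP[e e0 eB]; have [n [_ hn]] := sz e e0 0%N.
by exists (s n); split=> //; apply: eB; rewrite /ball /= distrC.
Qed.

(** The orbit of a point of the limit set accumulates at [c], and hence at the whole
    set, if it does not meet [c]; otherwise it is continued by both critical orbits. *)
Lemma acc_v_minimal : minimal_set c f (acc (orbit_of f v)).
Proof.
have /andP[v0 v1] := lz_v01 lz.
have vf := v_free lz shr; have vc := v_acc_c lz nt shr.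
split; first by exists c.
  by move=> z /acc_v_01; rewrite /= in_itv.
move=> z vz; have /andP[z0 z1] := acc_v_01 vz.
have [hits|] := pselect (backward_orbit c f c z).
- rewrite /forward_orbit mem_set //.
  have sL := side_orbitP vf (iterLE 0) (fun n => iterLE n.+1).
  have sR := side_orbitP (w_free lz shr) (iterRE 0) (fun n => iterRE n.+1).
  apply/seteqP; split.
    rewrite [X in _ `<=` X](proj1 (closure_id _) (closed_acc (s := orbit_of f v))).
    apply: closure_subset => y [[[m [fm first_m [j jm ->]]]|/sL]|/sR].
    + by apply: acc_v_iter => // i ij; apply: first_m; apply: leq_trans ij jm.
    + case=> [->//|[j ->]]; exact: (acc_v_orbit lz nt fc shr v0 v1 vf vc).
    + case=> [->//|[j ->]]; exact: (acc_w_orbit lz nt fc shr v0 v1 vf vc).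
  move=> y; apply: acc_closure => n; left; right; apply/sL; right; by exists n.
- move=> nb; have zf := not_backward z0 z1 nb.
  rewrite /forward_orbit memNset //; apply/seteqP; split.
    rewrite [X in _ `<=` X](proj1 (closure_id _) (closed_acc (s := orbit_of f v))).
    by apply: closure_subset => y [j _ <-]; apply: acc_v_iter.
  move=> y vy; apply: (acc_closure (s := orbit_of f z)); first by move=> n; exists n.
  apply: (acc_v_acc lz nt fc shr z0 z1 zf _ vy).
  apply: (acc_v_acc_c lz nt fc shr z0 z1 zf) => n.
  by apply: acc_v_iter.
Qed.

Lemma omega_eq (x : split_point R) : split_dom c x -> omega c f x c ->
  omega c f x = acc (orbit_of f v).
Proof.
case: x => [y|_ _|_ _] /=; last 2 first.
- exact: cluster_iterL.
- exact: cluster_iterR.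
rewrite cluster_iterL cluster_iterR setUid => -[/= + _].
rewrite in_itv /= => /andP[y0 y1]; case: ifPn => [_ _ //|/negP nb] /cluster_acc yc.
have yf : free f c y by apply: not_backward => // h; apply: nb; rewrite inE.
apply/seteqP; split=> z.
  by move=> /cluster_acc; exact: (acc_acc_v lz nt fc shr y0 y1 yf yc).
move=> vz; apply/cluster_acc; exact: (acc_v_acc lz nt fc shr y0 y1 yf yc vz).
Qed.

(** ** The limit set is contained in the nice trapping regions *)

Section Trapping.
Variables (a b : R) (p q : nat).
Hypothesis J : renorm f c v w a b p q.

Lemma notin_Lambda i y : 0 <= y -> y <= 1 -> (forall j, (j < i)%N -> iter j f y <> c) ->
  a < iter i f y -> iter i f y < b -> (`[0, 1]%classic `\` Lambda_ c f a b) y.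
Proof.
move=> y0 y1 av ay yb; split; first by rewrite /= in_itv /= y0.
move=> [_ h]; have : (set0 : set R) (iter i f y); last by [].
by rewrite -h; split; [exact: forward_orbit_iter|rewrite /= in_itv /= ay].
Qed.

Lemma is_period_left : is_period c f a p.+1.
Proof.
have [a0 ac cb b1] := rn_bnds J; have c1 := lz_c1 lz.
have out j : (j < p)%N -> iter j.+1 f a < a \/ b <= iter j.+1 f a.
  move=> jp; rewrite iterSr; have [_ g _] := rn_lt lz J (ltnW jp).
  by have := rn_outL J jp; lra.
split=> //.
- split; first by rewrite in_itv /=; apply/andP; split; lra.
  move=> [|j] jp e; first by move: e => /=; lra.
  by have := out j jp; rewrite e; lra.
- by rewrite iterSr (rn_fixL J).
- by move=> [|j] // jp e; have := out j jp; rewrite e; lra.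
Qed.

Lemma is_period_right : is_period c f b q.+1.
Proof.
have [a0 ac cb b1] := rn_bnds J; have c0 := lz_c0 lz.
have out j : (j < q)%N -> iter j.+1 f b <= a \/ b < iter j.+1 f b.
  move=> jq; rewrite iterSr.
  have [_ g _] := rn_lt (lorenz_flip lz) (renorm_flip J) (ltnW jq).
  move: g; rewrite /flip subKr !iter_flip !subKr.
  by have := rn_outR J jq; lra.
split=> //.
- split; first by rewrite in_itv /=; apply/andP; split; lra.
  move=> [|j] jp e; first by move: e => /=; lra.
  by have := out j jp; rewrite e; lra.
- by rewrite iterSr (rn_fixR J).
- by move=> [|j] // jp e; have := out j jp; rewrite e; lra.
Qed.

Lemma iter_connected i (x y : R) : 0 <= x -> y <= 1 ->
  (forall t j, x < t -> t < y -> (j < i)%N -> iter j f t <> c) ->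
  connected (iter i f @` `]x, y[).
Proof.
move=> x0 y1 av; apply: connected_continuous_connected.
  by apply/connected_intervalP; exact: interval_is_interval.
apply/subspace_continuousP => t; rewrite /= in_itv /= => /andP[xt ty].
have t0 : 0 <= t by lra. have t1 : t <= 1 by lra.
apply/cvgrPdist_lt => eps e0.
have [d d0 hd] := iter_cont lz fc t0 t1 (fun j (ji : (j < i)%N) => av t j xt ty ji) e0.
rewrite /within /=; apply/nbhs_ballP; exists d => // s ts.
rewrite /= in_itv /= => /andP[xs sy]; rewrite distrC.
have s0 : 0 <= s by lra. have s1 : s <= 1 by lra.
by have [] := hd s s0 s1; first by rewrite distrC.
Qed.

Lemma cycle_interval_ex y i : on_cycle f c v w p q y i ->
  exists I, [/\ cycle_intervals c f a b I, I (iter i f y), connected I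
    & I `<=` `[0, 1]%classic `\` Lambda_ c f a b].
Proof.
have [a0 ac cb b1] := rn_bnds J; have [c0 c1] := (lz_c0 lz, lz_c1 lz).
have rR := rn_retR J; have rL := rn_retL J.
case=> [[h1 [h2 h3]]|[h1 [h2 h3]]].
- exists (iter i f @` `]a, c[); split.
  + by left; exists p.+1, i; split=> //; [exact: is_period_left|exact: leqW].
  + by exists y => //; rewrite /= in_itv /=; apply/andP; split; lra.
  + apply: iter_connected => //; first exact: ltW.
    move=> t j at_ tc ji; apply: (rn_avoid lz J at_ tc).
    exact: leq_trans (ltnW ji) h3.
  + move=> s [t]; rewrite /= in_itv /= => /andP[at_ tc] <-.
    have avt j : (j <= p)%N -> iter j f t <> c by exact: (rn_avoid lz J at_ tc).
    have t0 : 0 <= t by lra. have t1 : t <= 1 by lra.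
    have /andP[i0 i1] : 0 <= iter i f t <= 1.
      by apply: (iter_range lz) => // j ji; apply: avt; exact: leq_trans (ltnW ji) h3.
    have [r1 r2] := rn_return lz J at_ tc.
    apply: (notin_Lambda (i := p.+1 - i)) => //.
    * move=> j jp; rewrite -iterD; apply: avt.
      by move: jp; clear; lia.
    * by rewrite -iterD subnK ?leqW.
    * by rewrite -iterD subnK ?leqW //; lra.
- exists (iter i f @` `]c, b[); split.
  + by right; exists q.+1, i; split=> //; [exact: is_period_right|exact: leqW].
  + by exists y => //; rewrite /= in_itv /=; apply/andP; split; lra.
  + apply: iter_connected => //; first exact: ltW.
    move=> t j ct tb ji; apply: (rn_avoidR lz J ct tb).
    exact: leq_trans (ltnW ji) h3.
  + move=> s [t]; rewrite /= in_itv /= => /andP[ct tb] <-.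
    have avt j : (j <= q)%N -> iter j f t <> c by exact: (rn_avoidR lz J ct tb).
    have t0 : 0 <= t by lra. have t1 : t <= 1 by lra.
    have /andP[i0 i1] : 0 <= iter i f t <= 1.
      by apply: (iter_range lz) => // j ji; apply: avt; exact: leq_trans (ltnW ji) h3.
    have [r1 r2] := rn_returnR lz J ct tb.
    apply: (notin_Lambda (i := q.+1 - i)) => //.
    * move=> j jp; rewrite -iterD; apply: avt.
      by move: jp; clear; lia.
    * by rewrite -iterD subnK ?leqW //; lra.
    * by rewrite -iterD subnK ?leqW.
Qed.

(** A neighbourhood of a point of the limit set enters (a, b) at the same time as
    the point and hence lies in one gap of Lambda_J. It meets the critical orbit,
    which moves along the cycle. *)
Lemma acc_v_trapped z : acc (orbit_of f v) z -> nice_trapping_region c f a b z.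
Proof.
move=> vz; have /andP[z0 z1] := acc_v_01 vz.
have [a0 ac cb b1] := rn_bnds J.
have vf := v_free lz shr; have vc := v_acc_c lz nt shr.
have [i [av [ai ib]]] : exists i, (forall j, (j < i)%N -> iter j f z <> c) /\
    (a < iter i f z /\ iter i f z < b).
  have [hits|nb] := pselect (backward_orbit c f c z).
    have [m0 fm0] := proj1 (backward_orbitP lz z0 z1) hits.
    have exm : exists m, iter m f z == c by exists m0; apply/eqP.
    have [m /eqP fm mmin] := ex_minnP exm.
    exists m; rewrite fm; split=> //.
    by move=> j jm /eqP/mmin; rewrite leqNgt jm.
  have zf := not_backward z0 z1 nb.
  have zc : acc (orbit_of f z) c.
    apply: (acc_v_acc_c lz nt fc shr z0 z1 zf) => n; exact: acc_v_iter.
  have [|n [_]] := zc (Num.min (c - a) (b - c)) _ 0%N; first by rewrite lt_min; lra.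
  rewrite lt_min /orbit_of !ltr_norml => h; exists n; split=> //.
  by move: h; lra.
have [|d d0 hd] := iter_cont lz fc (eps := Num.min (iter i f z - a) (b - iter i f z)) z0 z1 av.
  by rewrite lt_min; lra.
have near y : 0 <= y -> y <= 1 -> `|y - z| < d ->
    (`[0, 1]%classic `\` Lambda_ c f a b) y.
  move=> y0 y1 yz; have [+ avy] := hd y y0 y1 yz.
  rewrite lt_min !ltr_norml => h.
  by apply: (notin_Lambda (i := i)) => //; move: h; lra.
have [N on] := eventually_on_cycle lz nt shr J vf vc.
have [n [Nn vn]] := vz d d0 N.
have [y [k [e oc]]] := on n Nn.
have [I [cI Iy conI subI]] := cycle_interval_ex oc.
have /andP[v0 v1] := lz_v01 lz.
have /andP[n0 n1] := iter_range lz v0 v1 (fun j (_ : (j < n)%N) => vf j).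
pose V := [set t : R | [/\ 0 <= t, t <= 1 & `|t - z| < d]].
have conV : connected V.
  apply/connected_intervalP => s t [s0 s1 sz] [t0 t1 tz] u /andP[su ut].
  split; [exact: le_trans s0 su|exact: le_trans ut t1|].
  by move: sz tz; rewrite !ltr_norml; lra.
have Vz : V z by split=> //; rewrite subrr normr0.
have conVI : connected (V `|` I).
  apply: connectedU => //; exists (iter n f v); split=> //.
  by rewrite e.
have subVI : V `|` I `<=` `[0, 1]%classic `\` Lambda_ c f a b.
  by move=> t [[t0 t1 tz]|/subI//]; apply: near.
have VI := connected_component_max (or_introl Vz : (V `|` I) z) subVI conVI.
exists (connected_component (`[0, 1]%classic `\` Lambda_ c f a b) z).
  split; first by exists z => //; apply: subVI; left.
  by exists I => // t It; apply: VI; right.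
by apply: VI; left.
Qed.

End Trapping.

End CriticalOrbits.

(** * Infinitely many renormalization intervals *)

(** A renormalization interval is determined by either of its return times, so each
    of them takes large values; and they grow together. *)
Lemma infinite_unbounded_renorm (R : realType) (f : R -> R) c v w : lorenz f c v w ->
  no_trap f c -> infinitely_renormalizable c f -> unbounded_renorm f c v w.
Proof.
move=> lz nt inf N.
have ex J : renorm_intervals c f J -> exists p q, renorm f c v w J.1 J.2 p q.
  by case=> a0 /andP[ac cb] b1; apply: renorm_of_return_map.
have [a1 [b1 [p1 [q1 [J1 Np]]]]] : exists a b p q, renorm f c v w a b p q /\ (N <= p)%N.
  apply: contrapT => none; apply: inf.
  pose G n := xget (0, 0) [set J : R * R | exists q, renorm f c v w J.1 J.2 n q].
  apply: (@sub_finite_set _ _ (G @` `I_N)); last exact/finite_image/finite_II.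
  move=> J /ex[p [q hJ]]; exists p.
    by rewrite /= ltnNge; apply/negP => Np; apply: none; exists J.1, J.2, p, q.
  rewrite /G; case: xgetP => [K _ [q' hK]|/(_ J)]; last by case; exists q.
  have [e1 e2 _] := rn_eqp lz nt hJ hK.
  by rewrite (surjective_pairing K) (surjective_pairing J) e1 e2.
have [a2 [b2 [p2 [q2 [J2 Nq]]]]] : exists a b p q, renorm f c v w a b p q /\ (N <= q)%N.
  apply: contrapT => none; apply: inf.
  pose G n := xget (0, 0) [set J : R * R | exists p, renorm f c v w J.1 J.2 p n].
  apply: (@sub_finite_set _ _ (G @` `I_N)); last exact/finite_image/finite_II.
  move=> J /ex[p [q hJ]]; exists q.
    by rewrite /= ltnNge; apply/negP => Nq; apply: none; exists J.1, J.2, p, q.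
  rewrite /G; case: xgetP => [K _ [p' hK]|/(_ J)]; last by case; exists p.
  have [e1 e2 _] := rn_eqp (lorenz_flip lz) (no_trap_flip nt) (renorm_flip hJ)
    (renorm_flip hK).
  by rewrite (surjective_pairing K) (surjective_pairing J); congr pair; lra.
have [pp|pp] := leqP p1 p2.
  by exists a2, b2, p2, q2; split=> //; exact: leq_trans pp.
have [_ _ qq] := rn_ltp lz nt J2 J1 pp.
by exists a1, b1, p1, q1; split=> //; exact: leq_trans (ltnW qq).
Qed.

Theorem theorem1 (R : realType) (c : R) (f : R -> R)
    (f_lorenz : lorenz_map c f) (f_contracting : contracting c f)
    (f_nonflat : nonflat c f)
    (f_no_attractor : ~ exists P : set R, periodic_attractor c f P)
    (f_renorm : infinitely_renormalizable c f) :
  exists L : set R,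
    [/\ compact L, minimal_set c f L, L c,
        L `<=` \bigcap_(J in renorm_intervals c f)
                  nice_trapping_region c f J.1 J.2
      & forall x : split_point R, split_dom c x ->
          omega c f x c -> omega c f x = L].
Proof.
have [v [w [C [lz C0 cr dR dL]]]] := nonflat_lorenz f_lorenz f_nonflat.
have nt := no_attractor_no_trap lz f_contracting f_no_attractor.
have fc := lorenz_map_cont f_lorenz.
have unb := infinite_unbounded_renorm lz nt f_renorm.
have shr : shrinking_renorm f c v w.
  by move=> eps e0; exact: (renorm_shrink lz nt C0 cr dR dL unb e0).
exists (acc (orbit_of f v)); split.
- apply: (subclosed_compact _ (@segment_compact R 0 1)); first exact: closed_acc.
  by move=> z /(acc_v_01 lz shr); rewrite /= in_itv.
- exact: (acc_v_minimal lz nt fc shr).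
- exact: (v_acc_c lz nt shr).
- move=> z vz [a b] [/= a0 /andP[ac cb] b1 ret].
  have [p [q J]] := renorm_of_return_map lz a0 ac cb b1 ret.
  exact: (acc_v_trapped lz nt fc shr J vz).
- by move=> x dx xc; exact: (omega_eq lz nt fc shr dx xc).
Qed.
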